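(* Almost everywhere, $\limsup_{n\to\infty}\frac{\mathsf a'_n}{\sum_{k=1}^{n-1}\mathsf a'_k}=\infty$. More generally, let $g:[0,\infty)\to(3,\infty)$ be measurable with the property that $g(\eta(t))\asymp g(t)$ whenever $\eta(t)\sim t$ as $t\to\infty$. Then for some (any sufficiently large) $c>1$, \[ \limsup_{n\to\infty}\frac{g(\mathsf a'_n)}{\sum_{k=1}^{n-1}\mathsf a'_k}=\infty\ \text{a.e.}\quad\Longleftrightarrow\quad\int_c^\infty\frac{g(y)}{\log\log g(y)}\frac{dy}{y^2\log y}=\infty, \] while if the integral is finite, $\lim_{n\to\infty}\frac{g(\mathsf a'_n)}{\sum_{k=1}^{n-1}\mathsf a'_k}=0$ a.e.
   Context: $I=(0,1]$, ''a.e.'' refers to Lebesgue measure on $I$, $\mathsf a_n(x)$ denotes the $n$-th continued fraction digit of $x\in I$. $\mathbb P$ is the set of primes. The prime digits are $\mathsf a'_n(x):=\mathsf a_n(x)$ if $\mathsf a_n(x)\in\mathbb P$ and $\mathsf a'_n(x):=0$ otherwise (ratios with zero denominator are interpreted as $+\infty$ or ignored; eventually the denominators are positive a.e.). $g(t)\sim h(t)$ means $g(t)/h(t)\to1$; $g(t)\asymp h(t)$ means $0<\liminf_{t\to\infty}g(t)/h(t)\le\limsup_{t\to\infty}g(t)/h(t)<\infty$. *)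

(* Defs.v *)
From HB Require Import structures.
From mathcomp Require Import all_boot all_order all_algebra.
From mathcomp Require Import all_classical all_reals all_analysis.
Set Implicit Arguments. Unset Strict Implicit. Unset Printing Implicit Defensive.
Import Order.TTheory GRing.Theory Num.Theory.
Import numFieldNormedType.Exports.
Local Open Scope classical_set_scope.
Local Open Scope ring_scope.

Definition gauss {R : realType} (x : R) : R := x^-1 - (Num.floor x^-1)%:~R.

(* n-th continued fraction digit a_n(x) = floor(1 / T^(n-1) x), for n >= 1.
   (The value at n = 0 is irrelevant and never used.) *)
Definition cfdigit {R : realType} (n : nat) (x : R) : nat :=
  Num.truncn ((iter n.-1 gauss x)^-1).

Definition pdigit {R : realType} (n : nat) (x : R) : nat :=
  if prime (cfdigit n x) then cfdigit n x else 0%N.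

Definition psum {R : realType} (n : nat) (x : R) : nat :=
  (\sum_(1 <= k < n) pdigit k x)%N.

Definition pratio {R : realType} (g : R -> R) (n : nat) (x : R) : \bar R :=
  if psum n x == 0%N then +oo%E
  else (g (pdigit n x)%:R / (psum n x)%:R)%:E.

Definition asymp_equiv {R : realType} (eta : R -> R) : Prop :=
  (fun t => eta t / t) @ +oo --> (1 : R).

(* u ≍ v as t -> oo (for eventually positive v):
   0 < liminf u/v <= limsup u/v < oo *)
Definition asymp_comparable {R : realType} (u v : R -> R) : Prop :=
  exists c1 c2 : R, 0 < c1 /\ 0 < c2 /\
    \forall t \near +oo, c1 <= u t / v t <= c2.

Definition gintegral {R : realType} (g : R -> R) (c : R) : \bar R :=
  (\int[lebesgue_measure]_(y in `[c, +oo[) 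
     ((g y / ln (ln (g y))) / (y ^+ 2 * ln y))%:E)%E.

(* Main.v *)
Require Import Defs.
From HB Require Import structures.
From mathcomp Require Import all_boot all_order all_algebra.
From mathcomp Require Import all_classical all_reals all_analysis.
From mathcomp Require Import measurable_realfun.
From mathcomp Require Import zify ring lra.
Import Order.TTheory GRing.Theory Num.Theory.
Import numFieldNormedType.Exports.
Local Open Scope classical_set_scope.
Local Open Scope ring_scope.

(* Given the first [n] digits, the tail of [x] is distributed with a density
   between 1/2 and 2, so the next digit is [p] with conditional probability
   1/(p(p+1)) up to a factor 2. This quasi-independence, with Chebyshev's bounds
   for primes, puts the sum of the first [n] prime digits at the scale n log log n:
   after truncating the digits at 16n, Markov's inequality bounds it above with
   conditional probability 3/4, and a Laplace transform bounds it below a.e. for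
   all large [n]. The limsup is therefore governed by the events
   g(a'_n) >= A n log log n. For a fixed digit value [p] the number of [n] with
   A n log log n <= g(p) is of order g(p) / log log g(p), so the total weight of
   these events is the sum over primes of g(p) / (p^2 log log g(p)). Regularity
   of [g] makes g / log log g comparable to a constant on each block
   [32^j, 32^(j+1)], and Chebyshev's bounds turn the sum into the integral.
   If it converges, Borel-Cantelli applies; if it diverges, each block of times of
   total weight about 1/8 produces an event together with a small prefix sum with
   conditional probability at least 1/32. *)

(** * Continued fraction cylinders and the law of the next digit *)

Section ContinuedFractions.
Set Implicit Arguments.
Unset Strict Implicit.
Context {R : realType}.
Implicit Types (x y a b c : R) (u : seq nat) (n p : nat).

(** No invariant measure is brought in: everything rests on Lebesgue measure and on one distortion
    estimate for the Moebius branches of the Gauss map, integrated against functions of the first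
    [n] digits. Only bounds with constants are available, so limit theorems for independent
    variables give way to arguments that survive a factor 2. Two obstacles shape the rest. [g] need
    not be monotone, so a large value of [g] at a digit is not a tail event of the digit. And in the
    divergent case the events contain the prefix sum, hence the whole past, so the second
    Borel-Cantelli lemma does not apply. The regularity of [g] is given for one function [eta] at a
    time and must be made uniform before it can be used on blocks. The identity does not satisfy
    [3 < g t], so the first claim is not an instance of the second; it runs through the shifted
    values [p + 1]. All work takes place on the irrationals of the unit interval, where every
    iterate of the Gauss map stays strictly between 0 and 1. *)

Definition unit_irr : set R := `]0, 1[ `\` rational.

Lemma unit_irr_itv x : unit_irr x -> 0 < x < 1.
Proof. by case; rewrite /= in_itv. Qed.

Lemma rationalD x y : rational x -> rational y -> rational (x + y).
Proof. by move=> [p _ <-] [q _ <-]; exists (p + q) => //; rewrite rmorphD. Qed.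

Lemma rationalV x : rational x -> rational x^-1.
Proof. by move=> [p _ <-]; exists p^-1 => //; rewrite fmorphV. Qed.

Lemma rational_int (m : int) : rational (m%:~R : R).
Proof. by exists m%:Q => //; rewrite ratr_int. Qed.

Lemma gauss_unit_irr x : unit_irr x -> unit_irr (gauss x).
Proof.
move=> [_ xirr].
have gxirr : ~ rational (gauss x).
  move=> gx; apply: xirr; rewrite -[x]invrK; apply: rationalV.
  by rewrite -[x^-1](subrK (Num.floor x^-1)%:~R); apply: rationalD gx (rational_int _).
split=> //=; rewrite in_itv /= /gauss.
have /andP[] := floor_itv x^-1; rewrite intrD => l r.
rewrite subr_gt0 ltrBlDl r andbT lt_neqAle l andbT.
apply/eqP => e; apply: gxirr; rewrite /gauss e subrr.
exact: (rational_int 0).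
Qed.

Lemma iter_gauss_unit_irr n x : unit_irr x -> unit_irr (iter n gauss x).
Proof. by move=> xO; elim: n => //= n; apply: gauss_unit_irr. Qed.

Lemma inv_cfdigit1 x : unit_irr x -> x^-1 = (cfdigit 1 x)%:R + gauss x.
Proof.
move=> /unit_irr_itv/andP[x0 x1]; rewrite /cfdigit /gauss /= truncn_floor invr_ge0 (ltW x0).
have f0 : (0 <= Num.floor x^-1) by rewrite floor_ge_int ?mulr0z invr_ge0 ltW.
by rewrite natr_absz ger0_norm // addrC subrK.
Qed.

Lemma cfdigit_iter n x : cfdigit n.+1 x = cfdigit 1 (iter n gauss x).
Proof. by []. Qed.

Lemma cfdigitSS n x : cfdigit n.+2 x = cfdigit n.+1 (gauss x).
Proof. by rewrite /cfdigit /= -iterS iterSr. Qed.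

Lemma cfdigit_gt0 n x : unit_irr x -> (0 < cfdigit n.+1 x)%N.
Proof.
move=> /(iter_gauss_unit_irr n)/unit_irr_itv/andP[x0 x1].
by rewrite cfdigit_iter /cfdigit /= truncn_gt0 invf_ge1 // ltW.
Qed.

Definition digits n x : seq nat := [seq cfdigit k.+1 x | k <- iota 0 n].

Lemma size_digits n x : size (digits n x) = n.
Proof. by rewrite size_map size_iota. Qed.

Lemma digitsS n x : digits n.+1 x = cfdigit 1 x :: digits n (gauss x).
Proof.
rewrite /digits /= (iotaDl 1 0) -map_comp; congr cons.
by apply: eq_map => k /=; rewrite add1n cfdigitSS.
Qed.

Lemma nth_digits k n x : (k < n)%N -> nth 0%N (digits n x) k = cfdigit k.+1 x.
Proof. by move=> kn; rewrite (nth_map 0%N) ?size_iota // nth_iota. Qed.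

Lemma digits_eqP n x y :
  (forall k, (k < n)%N -> cfdigit k.+1 x = cfdigit k.+1 y) <-> digits n x = digits n y.
Proof.
split=> [e|e k kn]; last by rewrite -(nth_digits x kn) e nth_digits.
by apply/eq_in_map => k; rewrite mem_iota => /andP[_]; apply: e.
Qed.

(* End points of the set of [x] with digits [u] whose tail lies in [ab]. *)
Fixpoint cyl_itv u (ab : R * R) : R * R :=
  if u is a :: u' then
    let lr := cyl_itv u' ab in ((a%:R + lr.2)^-1, (a%:R + lr.1)^-1)
  else ab.

Lemma cyl_itv_bound u a b : all (ltn 0) u -> 0 <= a -> a < b -> b <= 1 ->
  [/\ 0 <= (cyl_itv u (a, b)).1, (cyl_itv u (a, b)).1 < (cyl_itv u (a, b)).2
    & (cyl_itv u (a, b)).2 <= 1].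
Proof.
move=> + a0 ab b1; elim: u => [|d u IH] //= /andP[d0 /IH[]].
case: (cyl_itv u (a, b)) => l r /= l0 lr r1.
have d1 : 1 <= d%:R :> R by rewrite ler1n.
split; first by rewrite invr_ge0; lra.
- by rewrite ltf_pV2 ?ltrD2l // posrE; lra.
- by rewrite invf_le1; lra.
Qed.

(** By induction on the word, with [1/x] written as its first digit plus [gauss x]. The interval
    found for the tail lies in [0, 1], so the integer part of [1/x] cannot differ from the letter
    [d]. *)
Lemma cyl_itvP u a b x : all (ltn 0) u -> 0 <= a -> a < b -> b <= 1 -> unit_irr x ->
  (digits (size u) x = u /\ a < iter (size u) gauss x < b) <->
  (cyl_itv u (a, b)).1 < x < (cyl_itv u (a, b)).2.
Proof.
move=> + a0 ab b1; elim: u x => [|d u IH] x /=; first by move=> _ _; split=> [[]|].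
move=> /andP[d0 u0] xO; rewrite digitsS.
have [] := cyl_itv_bound u0 a0 ab b1.
have := IH (gauss x) u0 (gauss_unit_irr xO).
case: (cyl_itv u (a, b)) => l r /= {}IH l0 lr r1.
have d1 : 1 <= d%:R :> R by rewrite ler1n.
have x0 : 0 < x by case/andP: (unit_irr_itv xO).
have /andP[g0 g1] := unit_irr_itv (gauss_unit_irr xO).
have ex := inv_cfdigit1 xO.
have -> : ((d%:R + r)^-1 < x < (d%:R + l)^-1) = (d%:R + l < x^-1 < d%:R + r).
  rewrite -{1 2}[x]invrK !ltf_pV2 ?posrE ?invr_gt0 //; lra.
rewrite -iterS iterSr ex; split=> [[[e1 e2] e3]|lxr].
  by rewrite e1 !ltrD2l; apply/IH.
have ed : cfdigit 1 x = d.
  have h1 : (cfdigit 1 x < d.+1)%N by rewrite -(ltr_nat R) -natr1; lra.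
  have h2 : (d < (cfdigit 1 x).+1)%N by rewrite -(ltr_nat R) -natr1; lra.
  by apply/eqP; rewrite eqn_leq -ltnS h1 -ltnS h2.
have /IH[e2 e3] : l < gauss x < r by move: lxr; rewrite ed !ltrD2l.
by rewrite ed e2.
Qed.

(** [A / C] and [B / D] are the last two convergents of the word; the determinant changes sign with
    each digit. [D <= C] bounds the distortion. [B + D <= A + C] is carried along because prepending
    a digit [d] turns [C], [D] into [d C + A], [d D + B], and this inequality keeps them in
    order. *)
Lemma cyl_itv_moebius u : all (ltn 0) u -> exists A B C D : R,
  [/\ 0 <= A, 0 <= B, 0 < C, 0 <= D & D <= C] /\ B + D <= A + C /\
  ((B * C - A * D = 1 /\ forall a b : R, 0 <= a -> a < b -> b <= 1 ->
      cyl_itv u (a, b) = ((A + B * a) / (C + D * a), (A + B * b) / (C + D * b))) \/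
   (B * C - A * D = - 1 /\ forall a b : R, 0 <= a -> a < b -> b <= 1 ->
      cyl_itv u (a, b) = ((A + B * b) / (C + D * b), (A + B * a) / (C + D * a)))).
Proof.
elim: u => [|d u IH] /=.
  move=> _; exists 0, 1, 1, 0; split; first by split; lra.
  split; [lra|left; split; first lra] => a b _ _ _.
  by rewrite !add0r !mul1r !mul0r !addr0 !divr1.
move=> /andP[d0 /IH[A [B [C [D [[A0 B0 C0 D0 DC] [BD H]]]]]]].
have d1 : 1 <= d%:R :> R by rewrite ler1n.
have dC : C <= d%:R * C by rewrite ler_peMl // ltW.
have dCD : C - D <= d%:R * (C - D) by rewrite ler_peMl // subr_ge0.
have step (c : R) : 0 <= c -> (d%:R + (A + B * c) / (C + D * c))^-1 =
    (C + D * c) / ((d%:R * C + A) + (d%:R * D + B) * c).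
  move=> c0; have Dc : 0 <= D * c by apply: mulr_ge0.
  have Bc : 0 <= B * c by apply: mulr_ge0.
  have dDc : 0 <= d%:R * (D * c) by apply: mulr_ge0 => //; lra.
  have h1 : C + D * c != 0 by rewrite gt_eqF; lra.
  have h2 : d%:R * C + A + (d%:R * D + B) * c != 0.
    by rewrite gt_eqF // !mulrDl -mulrA; lra.
  rewrite -{1}[d%:R](mulfK h1) -mulrDl invf_div; congr (_ / _); ring.
exists C, D, (d%:R * C + A), (d%:R * D + B).
have dD : 0 <= d%:R * D by apply: mulr_ge0 => //; lra.
split; first by split; [lra|lra|lra|lra|move: dCD; rewrite mulrBr; lra].
split; first by move: dCD; rewrite mulrBr; lra.
have edet : D * (d%:R * C + A) - C * (d%:R * D + B) = - (B * C - A * D) by ring.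
case: H => -[det H]; [right|left]; (split; first by rewrite edet det ?opprK).
  by move=> a b a0 ab b1; rewrite H //= !step //; lra.
by move=> a b a0 ab b1; rewrite H //= !step //; lra.
Qed.

(** The length is [(b - a) / ((C + D a) (C + D b))]. The denominator lies between [C^2] and
    [(C + D)^2], and for the whole cylinder it is [C (C + D)]; as [D <= C], each comparison loses at
    most a factor 2. This is the source of the factors 2 and 1/2 in all conditional bounds. *)
Lemma cyl_itv_len u a b : all (ltn 0) u -> 0 <= a -> a < b -> b <= 1 ->
  2^-1 * (b - a) * ((cyl_itv u (0, 1)).2 - (cyl_itv u (0, 1)).1)
    <= (cyl_itv u (a, b)).2 - (cyl_itv u (a, b)).1
    <= 2 * (b - a) * ((cyl_itv u (0, 1)).2 - (cyl_itv u (0, 1)).1).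
Proof.
move=> u0 a0 ab b1.
have [A [B [C [D [[A0 B0 C0 D0 DC] [_ H]]]]]] := cyl_itv_moebius u0.
have len (c e : R) : 0 <= c -> c < e -> e <= 1 ->
    (cyl_itv u (c, e)).2 - (cyl_itv u (c, e)).1 = (e - c) / ((C + D * c) * (C + D * e)).
  move=> c0 ce e1.
  have Dc : 0 <= D * c by apply: mulr_ge0.
  have De : 0 <= D * e by apply: mulr_ge0 => //; lra.
  have h1 : C + D * c != 0 by rewrite gt_eqF; lra.
  have h2 : C + D * e != 0 by rewrite gt_eqF; lra.
  case: H => -[det H]; rewrite H //=.
    transitivity ((B * C - A * D) * (e - c) / ((C + D * c) * (C + D * e))); last by rewrite det mul1r.
    by field; apply/andP.
  transitivity (- (B * C - A * D) * (e - c) / ((C + D * c) * (C + D * e))); last by rewrite det opprK mul1r.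
  by field; apply/andP.
rewrite !len ?lexx ?ltr01 // mulr0 mulr1 addr0 subr0.
have Da : 0 <= D * a by apply: mulr_ge0.
have Db : 0 <= D * b by apply: mulr_ge0 => //; lra.
have Da1 : D * a <= D by rewrite ler_piMr //; lra.
have Db1 : D * b <= D by rewrite ler_piMr //.
have bnd : C * C <= (C + D * a) * (C + D * b) <= (C + D) * (C + D).
  by apply/andP; split; apply: ler_pM; lra.
have CC0 : 0 < C * C by apply: mulr_gt0.
have CD0 : 0 < C * (C + D) by apply: mulr_gt0 => //; lra.
have CDCC : (C + D) * (C + D) <= 2 * (C * (C + D)) by rewrite mulrA ler_wpM2r; lra.
have CDC2 : C * (C + D) <= 2 * (C * C) by rewrite mulrCA ler_wpM2l; lra.
set X := (C + D * a) * _ in bnd *; set Y := C * (C + D) in CD0 CDCC CDC2 *.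
case/andP: bnd => bnd1 bnd2.
have X0 : 0 < X by lra.
have ba : 0 <= b - a by lra.
have Y0 : Y != 0 by rewrite gt_eqF.
clearbody X Y.
apply/andP; split.
  have -> : 2^-1 * (b - a) * (1 / Y) = (b - a) * (2 * Y)^-1 by field.
  by rewrite ler_wpM2l // lef_pV2 ?posrE; lra.
have -> : 2 * (b - a) * (1 / Y) = (b - a) * (Y / 2)^-1 by field.
by rewrite ler_wpM2l // lef_pV2 ?posrE; lra.
Qed.

End ContinuedFractions.

(** * Measure of cylinders and distortion of the tail *)

Section DigitMeasure.
Context {R : realType}.
Set Implicit Arguments.
Unset Strict Implicit.
Implicit Types (x y a b : R) (u : seq nat) (n i : nat) (F G : R -> R).
Local Notation mu := (@lebesgue_measure R).
Local Notation Om := (@unit_irr R).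

Lemma measurable_rational : measurable (@rational R : set (measurableTypeR R)).
Proof.
apply: countable_measurable; first by move=> t; apply: measurable_set1.
by apply: sub_countable (card_image_le _ _) _; apply: countableP.
Qed.

Lemma measurable_unit_irr : measurable (Om : set (measurableTypeR R)).
Proof. by apply: measurableD => //; apply: measurable_rational. Qed.

Lemma unit_irr_measure_itv a b : 0 <= a -> a <= b -> b <= 1 ->
  mu (Om `&` `]a, b[) = (b - a)%:E.
Proof.
move=> a0 ab b1.
have -> : Om `&` `]a, b[ = `]a, b[ `\` (`]a, b[ `&` rational).
  rewrite setDIr setDv set0U; apply/seteqP; split=> x /=.
    by move=> [[_ xr] xab]; split.
  by move=> [xab xr]; split=> //; split=> //=; move: xab; rewrite !in_itv /=; lra.
have q0 : mu (`]a, b[ `&` rational) = 0.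
  apply/eqP; rewrite eq_le measure_ge0 andbT -(lebesgue_measure_rat R).
  rewrite le_measure ?inE //; try exact: subIsetr.
    by apply: measurableI => //; apply: measurable_rational.
  exact: measurable_rational.
have mI : measurable (`]a, b[ `&` @rational R : set (measurableTypeR R)).
  by apply: measurableI => //; apply: measurable_rational.
have muab : mu `]a, b[ = (b - a)%:E.
  rewrite lebesgue_measure_itv /= lte_fin; case: ltP => // ba.
  have -> : b = a by lra.
  by rewrite subrr.
rewrite measureD //; last by rewrite [ltLHS]muab ltry.
by rewrite setIA setIid [X in (_ - X)%E]q0 sube0.
Qed.

Lemma unit_irr_measure : mu Om = 1%E.
Proof.
have -> : Om = Om `&` `]0, 1[.
  by apply/seteqP; split=> x; [move=> xO; split=> //; case: xO|case].
by rewrite unit_irr_measure_itv // subr0.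
Qed.

Definition cylinder n u a b := [set x | Om x /\ digits n x = u /\ a < iter n gauss x < b].

Lemma cylinderE n u a b : 0 <= a -> a < b -> b <= 1 ->
  cylinder n u a b = if all (ltn 0) u && (size u == n)
    then Om `&` `](cyl_itv u (a, b)).1, (cyl_itv u (a, b)).2[ else set0.
Proof.
move=> a0 ab b1; case: ifPn => [/andP[u0 /eqP <-]|h].
  apply/seteqP; split=> x /=; rewrite in_itv /=.
    by move=> [xO]; rewrite cyl_itvP.
  by move=> [xO lr]; split=> //; rewrite cyl_itvP.
apply/seteqP; split=> x //= -[xO [e _]]; exfalso; move/negP: h; apply.
rewrite -e size_digits eqxx andbT; apply/allP => k /mapP[j _ ->].
exact: cfdigit_gt0.
Qed.

Lemma measurable_cylinder n u a b : 0 <= a -> a < b -> b <= 1 ->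
  measurable (cylinder n u a b : set (measurableTypeR R)).
Proof.
move=> a0 ab b1; rewrite cylinderE //; case: ifP => // _.
by apply: measurableI => //; apply: measurable_unit_irr.
Qed.

Lemma cylinder_measure_bound n u a b : 0 <= a -> a < b -> b <= 1 ->
  ((2^-1 * (b - a))%:E * mu (cylinder n u 0 1) <= mu (cylinder n u a b)
   <= (2 * (b - a))%:E * mu (cylinder n u 0 1))%E.
Proof.
move=> a0 ab b1; rewrite !cylinderE ?ltr01 //; case: ifP => [/andP[u0 _]|_]; last first.
  by rewrite measure0 !mule0 lexx.
have [l0 lr r1] := cyl_itv_bound u0 a0 ab b1.
have [l0' lr' r1'] := cyl_itv_bound u0 (lexx (0 : R)) (@ltr01 R) (lexx (1 : R)).
rewrite !unit_irr_measure_itv ?(ltW lr) ?(ltW lr') // -!EFinM !lee_fin.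
exact: cyl_itv_len.
Qed.

(* [code_cyl n] enumerates the cylinders of rank [n] by the codes of their words. *)
Definition code_cyl n i := [set x | Om x /\ pickle (digits n x) = i].

Lemma code_cylE n x : Om x -> code_cyl n (pickle (digits n x)) = cylinder n (digits n x) 0 1.
Proof.
move=> xO; apply/seteqP; split=> y /= [yO].
  move=> e; split=> //; split; first exact: (pcan_inj pickleK).
  exact: (unit_irr_itv (iter_gauss_unit_irr n yO)).
by move=> [e _]; split=> //; rewrite e.
Qed.

Lemma code_cyl_cases n i : code_cyl n i = set0 \/
  exists2 x, Om x & i = pickle (digits n x).
Proof.
have [|/set0P[x [xO e]]] := eqVneq (code_cyl n i) set0; first by left.
by right; exists x.
Qed.

Lemma measurable_code_cyl n i : measurable (code_cyl n i : set (measurableTypeR R)).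
Proof.
case: (code_cyl_cases n i) => [->//|[x xO ->]].
by rewrite code_cylE //; apply: measurable_cylinder.
Qed.

Lemma bigcup_code_cyl n : \bigcup_i code_cyl n i = Om.
Proof.
apply/seteqP; split=> [x [i _ []]//|x xO].
by exists (pickle (digits n x)).
Qed.

Lemma trivIset_code_cyl n : trivIset setT (code_cyl n).
Proof. by apply/trivIsetP => i j _ _ ij; apply/seteqP; split=> x //= [[_ ei] [_ ej]]; move: ij; rewrite -ei -ej eqxx. Qed.

(** Measurability with respect to the first [n] digits, expressed as factorization through the word
    instead of through a sigma-algebra. It composes for arbitrary codomains, and Borel measurability
    follows because there are countably many words. *)
Definition adapted (T : Type) n (F : R -> T) :=
  forall x y, Om x -> Om y -> digits n x = digits n y -> F x = F y.

Lemma measurable_adapted n F : adapted n F ->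
  measurable_fun (Om : set (measurableTypeR R)) F.
Proof.
move=> aF _ Y mY.
have -> : Om `&` F @^-1` Y = \bigcup_(i in [set i | exists2 x, code_cyl n i x & Y (F x)]) code_cyl n i.
  apply/seteqP; split=> [x [xO FY]|x [i [y [yO ey] FY] [xO ex]]].
    by exists (pickle (digits n x)) => //=; exists x.
  split=> //=; rewrite (aF x y) //.
  by apply: (pcan_inj pickleK); rewrite ex ey.
by apply: bigcup_measurable => i _; apply: measurable_code_cyl.
Qed.

Definition tail_in n a b x : R := (a < iter n gauss x < b)%R%:R.

Lemma tail_inE n a b x : tail_in n a b x = \1_[set x | a < iter n gauss x < b] x.
Proof.
rewrite /tail_in indicE; congr (_%:R); congr nat_of_bool.
by apply/idP/idP; rewrite inE.
Qed.

Lemma measurable_tail_set n a b : 0 <= a -> a < b -> b <= 1 ->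
  measurable (Om `&` [set x | a < iter n gauss x < b] : set (measurableTypeR R)).
Proof.
move=> a0 ab b1.
have -> : Om `&` [set x | a < iter n gauss x < b] = \bigcup_u cylinder n u a b.
  apply/seteqP; split=> x /=; first by move=> [xO xab]; exists (digits n x).
  by move=> [u _ [xO [_]]].
apply: countable_bigcupT_measurable => [|u]; last exact: measurable_cylinder.
exact: countableP.
Qed.

Lemma measurable_tail_in n a b : 0 <= a -> a < b -> b <= 1 ->
  measurable_fun (Om : set (measurableTypeR R)) (tail_in n a b).
Proof.
move=> a0 ab b1.
pose A := Om `&` [set x | a < iter n gauss x < b].
apply: (eq_measurable_fun (\1_A : measurableTypeR R -> R)).
  by move=> x; rewrite inE => xO; rewrite tail_inE !indicE in_setI mem_set // andTb.
by apply: measurable_indic; apply: measurable_tail_set.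
Qed.

(** Weak independence in integrated form: [F] is constant on each cylinder of rank [n], the
    cylinders form a countable partition, and the distortion bound applies on each. Conditional
    statements are obtained later by the choice of [F]. *)
Lemma integral_tail_in n F a b : adapted n F -> (forall x, Om x -> 0 <= F x) ->
  0 <= a -> a < b -> b <= 1 ->
  (((2^-1 * (b - a))%:E * \int[mu]_(x in Om) (F x)%:E
    <= \int[mu]_(x in Om) (F x * tail_in n a b x)%:E
    <= (2 * (b - a))%:E * \int[mu]_(x in Om) (F x)%:E)%E).
Proof.
move=> aF F0 a0 ab b1.
have mF := measurable_adapted aF.
have t0 x : 0 <= tail_in n a b x by [].
have split_int (G : R -> R) : measurable_fun (Om : set (measurableTypeR R)) G ->
    (forall x, Om x -> 0 <= G x) ->
    (\int[mu]_(x in Om) (G x)%:E = \sum_(0 <= i <oo) \int[mu]_(x in code_cyl n i) (G x)%:E)%E.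
  move=> mG G0; rewrite -(bigcup_code_cyl n) ge0_integral_bigcup //.
  - by move=> i; apply: measurable_code_cyl.
  - by rewrite bigcup_code_cyl; apply/measurable_EFinP.
  - by move=> x; rewrite bigcup_code_cyl => xO; rewrite lee_fin G0.
  - exact: trivIset_code_cyl.
have int_ge0 (G : R -> R) i : (forall x, Om x -> 0 <= G x) ->
    (0 <= \int[mu]_(x in code_cyl n i) (G x)%:E)%E.
  by move=> G0; apply: integral_ge0 => x [xO _]; rewrite lee_fin G0.
rewrite !split_int //; last 2 first.
- by apply: measurable_funM => //; apply: measurable_tail_in.
- by move=> x xO; rewrite mulr_ge0 // F0.
rewrite -!nneseriesZl; try by move=> i _; apply: int_ge0.
have termwise i :
    ((2^-1 * (b - a))%:E * \int[mu]_(x in code_cyl n i) (F x)%:E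
    <= \int[mu]_(x in code_cyl n i) (F x * tail_in n a b x)%:E
    <= (2 * (b - a))%:E * \int[mu]_(x in code_cyl n i) (F x)%:E)%E.
  case: (code_cyl_cases n i) => [->|[z zO ->]]; first by rewrite !integral_set0 !mule0 lexx.
  rewrite code_cylE //; set C := cylinder n (digits n z) 0 1.
  have mC : measurable (C : set (measurableTypeR R)) by apply: measurable_cylinder.
  have FC x : C x -> F x = F z by move=> [xO [e _]]; apply: aF.
  have -> : (\int[mu]_(x in C) (F x)%:E = (F z)%:E * mu C)%E.
    rewrite -integral_cst //; apply: eq_integral => x; rewrite inE => xC.
    by rewrite /cst FC.
  have -> : (\int[mu]_(x in C) (F x * tail_in n a b x)%:E =
             (F z)%:E * mu (cylinder n (digits n z) a b))%E.
    transitivity (\int[mu]_(x in C) ((F z)%:E * (\1_(cylinder n (digits n z) a b) x)%:E))%E.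
      apply: eq_integral => x; rewrite inE => xC; rewrite FC // EFinM tail_inE.
      congr (_ * _%:E)%E; rewrite !indicE; congr (_%:R); congr nat_of_bool.
      case: xC => xO [e _].
      by apply/idP/idP; rewrite !inE //=; case=> _ [].
    rewrite ge0_integralZl //.
    - rewrite integral_indic //; last exact: measurable_cylinder.
      congr (_ * mu _)%E; apply/seteqP; split=> x /=; first by case.
      move=> [xO [e xab]]; split=> //; split=> //; split=> //.
      exact: (unit_irr_itv (iter_gauss_unit_irr n xO)).
    - by apply/measurable_EFinP; apply: measurable_indic; apply: measurable_cylinder.
    - by rewrite lee_fin F0.
  have /andP[h1 h2] := cylinder_measure_bound n (digits n z) a0 ab b1.
  have Fz : (0 <= (F z)%:E)%E by rewrite lee_fin F0.
  by rewrite ![(_%:E * ((F z)%:E * _))%E]muleCA !lee_wpmul2l.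
have c1 : (0 <= (2^-1 * (b - a))%:E)%E by rewrite lee_fin; lra.
apply/andP; split; apply: lee_nneseries => i _; first by rewrite mule_ge0 // int_ge0.
- by have /andP[] := termwise i.
- by move=> _; apply: (int_ge0 (fun x => F x * tail_in n a b x)) => x xO; rewrite mulr_ge0 // F0.
- by have /andP[] := termwise i.
Qed.

End DigitMeasure.

(** * Expectations of functions of finitely many digits *)

Section Expectation.
Context {R : realType}.
Set Implicit Arguments.
Unset Strict Implicit.
Implicit Types (x y a b c : R) (n m p k L P : nat) (F G : R -> R).
Local Notation mu := (@lebesgue_measure R).
Local Notation Om := (@unit_irr R).

(** The domain has measure one, so this is an expectation in the probabilistic sense. It is kept
    real-valued; integrability comes from [bounded_adapted]. *)
Definition expect F : R := \int[mu]_(x in Om) F x.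

Definition bounded_adapted n F :=
  adapted n F /\ exists B : R, forall x, Om x -> `|F x| <= B.

Lemma digits_le m n x y : (m <= n)%N -> digits n x = digits n y -> digits m x = digits m y.
Proof.
move=> mn /digits_eqP e; apply/digits_eqP => k km; apply: e.
exact: leq_trans km mn.
Qed.

Lemma adapted_le (T : Type) m n (F : R -> T) : (m <= n)%N -> adapted m F -> adapted n F.
Proof. by move=> mn aF x y xO yO /(digits_le mn); apply: aF. Qed.

Lemma adapted_cfdigit k n : (k < n)%N -> adapted n (@cfdigit R k.+1).
Proof. by move=> kn x y _ _ /digits_eqP; apply. Qed.

Lemma adapted_pdigit k n : (k < n)%N -> adapted n (@pdigit R k.+1).
Proof. by move=> kn x y xO yO e; rewrite /pdigit (adapted_cfdigit kn xO yO e). Qed.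

Lemma adapted_psum n : adapted n (@psum R n.+1).
Proof.
move=> x y xO yO e; apply: eq_big_nat => -[//|k] /andP[_ kn].
exact: (@adapted_pdigit k n).
Qed.

Lemma adapted_comp (T U : Type) n (f : T -> U) (F : R -> T) :
  adapted n F -> adapted n (fun x => f (F x)).
Proof. by move=> aF x y xO yO e; rewrite (aF x y). Qed.

Lemma adapted_comp2 (T U V : Type) n (f : T -> U -> V) (F : R -> T) (G : R -> U) :
  adapted n F -> adapted n G -> adapted n (fun x => f (F x) (G x)).
Proof. by move=> aF aG x y xO yO e; rewrite (aF x y) // (aG x y). Qed.

Lemma bounded_adapted_le m n F : (m <= n)%N -> bounded_adapted m F -> bounded_adapted n F.
Proof. by move=> mn [aF BF]; split=> //; apply: adapted_le mn aF. Qed.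

Lemma bounded_adapted_cst n c : bounded_adapted n (fun _ => c).
Proof. by split=> //; exists `|c|. Qed.

Lemma bounded_adapted_bool n (Q : R -> bool) :
  adapted n Q -> bounded_adapted n (fun x => (Q x)%:R).
Proof.
move=> aQ; split; first exact: (adapted_comp (fun b : bool => b%:R)).
by exists 1 => x _; case: (Q x); rewrite ?normr1 ?normr0.
Qed.

Lemma bounded_adaptedD n F G : bounded_adapted n F -> bounded_adapted n G ->
  bounded_adapted n (fun x => F x + G x).
Proof.
move=> [aF [B FB]] [aG [C GC]]; split; first exact: (adapted_comp2 +%R).
exists (B + C) => x xO; apply: le_trans (ler_normD _ _) _.
by rewrite lerD ?FB ?GC.
Qed.

Lemma bounded_adaptedM n F G : bounded_adapted n F -> bounded_adapted n G ->
  bounded_adapted n (fun x => F x * G x).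
Proof.
move=> [aF [B FB]] [aG [C GC]]; split; first exact: (adapted_comp2 *%R).
by exists (B * C) => x xO; rewrite normrM ler_pM ?FB ?GC.
Qed.

Lemma bounded_adaptedB n F G : bounded_adapted n F -> bounded_adapted n G ->
  bounded_adapted n (fun x => F x - G x).
Proof.
move=> bF bG; under eq_fun do rewrite -mulN1r.
by apply: bounded_adaptedD => //; apply: bounded_adaptedM => //; apply: bounded_adapted_cst.
Qed.

Lemma bounded_adapted_sum (I : Type) (r : seq I) (Q : pred I) (F : I -> R -> R) n :
  (forall i, Q i -> bounded_adapted n (F i)) ->
  bounded_adapted n (fun x => \sum_(i <- r | Q i) F i x).
Proof.
move=> bF; elim: r => [|i r IH].
  under eq_fun do rewrite big_nil; exact: bounded_adapted_cst.
have [Qi|Qi] := boolP (Q i); last by under eq_fun do rewrite big_cons (negPf Qi).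
by under eq_fun do rewrite big_cons Qi; apply: bounded_adaptedD => //; apply: bF.
Qed.

Lemma bounded_adapted_integrable n F : bounded_adapted n F -> mu.-integrable Om (EFin \o F).
Proof.
move=> [aF [B FB]]; apply: measurable_bounded_integrable.
- exact: measurable_unit_irr.
- by rewrite [ltLHS]unit_irr_measure ltry.
- exact: measurable_adapted aF.
- exists B; split; first exact: num_real.
  by move=> M BM x xO; apply: le_trans (FB x xO) (ltW BM).
Qed.

Lemma expectD n m F G : bounded_adapted n F -> bounded_adapted m G ->
  expect (fun x => F x + G x) = expect F + expect G.
Proof.
move=> /bounded_adapted_integrable iF /bounded_adapted_integrable iG.
by rewrite /expect RintegralD //; apply: measurable_unit_irr.
Qed.

Lemma expectZ n F c : bounded_adapted n F -> expect (fun x => c * F x) = c * expect F.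
Proof.
move=> /bounded_adapted_integrable iF.
by rewrite /expect RintegralZl //; apply: measurable_unit_irr.
Qed.

Lemma expect_le n m F G : bounded_adapted n F -> bounded_adapted m G ->
  (forall x, Om x -> F x <= G x) -> expect F <= expect G.
Proof.
move=> /bounded_adapted_integrable iF /bounded_adapted_integrable iG FG.
by apply: le_Rintegral => //; apply: measurable_unit_irr.
Qed.

Lemma expect_ge0 F : (forall x, Om x -> 0 <= F x) -> 0 <= expect F.
Proof. by move=> F0; apply: Rintegral_ge0 => x; apply: F0. Qed.

Lemma eq_expect F G : (forall x, Om x -> F x = G x) -> expect F = expect G.
Proof. by move=> FG; apply: eq_Rintegral => x; rewrite inE; apply: FG. Qed.

Lemma expect_cst c : expect (fun _ => c) = c.
Proof.
rewrite /expect Rintegral_cst; last exact: measurable_unit_irr.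
by rewrite [X in fine X]unit_irr_measure mulr1.
Qed.

Lemma expect_sum (I : Type) (r : seq I) (Q : pred I) (F : I -> R -> R) n :
  (forall i, Q i -> bounded_adapted n (F i)) ->
  expect (fun x => \sum_(i <- r | Q i) F i x) = \sum_(i <- r | Q i) expect (F i).
Proof.
move=> bF; elim: r => [|i r IH].
  by rewrite big_nil; under eq_expect do rewrite big_nil; exact: expect_cst.
rewrite big_cons; case: ifPn => Qi; last first.
  by under eq_expect do rewrite big_cons (negPf Qi).
under eq_expect do rewrite big_cons Qi.
by rewrite (@expectD n n) ?IH //; [apply: bF|apply: bounded_adapted_sum].
Qed.

Lemma expectB n m F G : bounded_adapted n F -> bounded_adapted m G ->
  expect (fun x => F x - G x) = expect F - expect G.
Proof.
move=> /bounded_adapted_integrable iF /bounded_adapted_integrable iG.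
by rewrite /expect RintegralB //; apply: measurable_unit_irr.
Qed.

Lemma measure_adapted n (Q : R -> bool) : adapted n Q ->
  mu (Om `&` [set x | Q x]) = (expect (fun x => (Q x)%:R))%:E.
Proof.
move=> aQ; have bQ := bounded_adapted_bool aQ.
have mO := @measurable_unit_irr R.
have mQ : measurable (Om `&` [set x | Q x] : set (measurableTypeR R)).
  have := @measurable_adapted R n (fun x => (Q x)%:R) bQ.1.
  move=> /(_ mO [set 1] (measurable_set1 1)).
  congr (measurable (_ `&` _)); apply/seteqP; split=> x /=; case: (Q x) => //.
    by move=> /esym/eqP; rewrite oner_eq0.
have iQ := bounded_adapted_integrable bQ.
rewrite /expect /Rintegral fineK; last exact: integrable_fin_num iQ.
rewrite -[X in mu (X `&` _)]setIid -setIA setIC.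
rewrite -(integral_indic mu mO mQ); apply: eq_integral => x; rewrite inE => xO.
congr (_%:E); rewrite indicE; congr (_%:R); congr nat_of_bool.
by apply/idP/idP; rewrite inE //= => -[].
Qed.

Lemma tail_in_bound n F a b : bounded_adapted n F -> (forall x, Om x -> 0 <= F x) ->
  0 <= a -> a < b -> b <= 1 ->
  2^-1 * (b - a) * expect F <= expect (fun x => F x * tail_in n a b x)
    <= 2 * (b - a) * expect F.
Proof.
move=> bF F0 a0 ab b1.
have mO := @measurable_unit_irr R.
have iF : (\int[mu]_(x in Om) (F x)%:E)%E \is a fin_num.
  exact: integrable_fin_num (bounded_adapted_integrable bF).
have := integral_tail_in bF.1 F0 a0 ab b1.
rewrite -[X in (_ * X <= _ <= _ * X)%E](fineK iF) -!EFinM => /andP[h1 h2].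
have iG : (\int[mu]_(x in Om) (F x * tail_in n a b x)%:E)%E \is a fin_num.
  rewrite ge0_fin_numE; first exact: le_lt_trans h2 (ltry _).
  by apply: integral_ge0 => x xO; rewrite lee_fin mulr_ge0 // F0.
by rewrite -!lee_fin /expect /Rintegral [X in (_ <= X <= _)%E]fineK // h1 h2.
Qed.

(** Length of the interval ]1/(p+1), 1/p[ of numbers with first digit [p]. At [p = 0] the convention
    for the inverse of 0 gives weight 0, in accordance with the digits being positive. *)
Definition cf_weight p : R := (p * p.+1)%:R^-1.

Lemma cf_weight_ge0 p : 0 <= cf_weight p.
Proof. by rewrite invr_ge0. Qed.

Lemma cf_weightE p : (0 < p)%N -> cf_weight p = p%:R^-1 - p.+1%:R^-1.
Proof.
move=> p0; have h1 : p%:R != 0 :> R by rewrite pnatr_eq0 -lt0n.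
have h2 : p%:R + 1 != 0 :> R by rewrite natr1 pnatr_eq0.
rewrite /cf_weight natrM -natr1; field.
by rewrite h2.
Qed.

Lemma tail_in_cfdigit n p x : Om x -> (0 < p)%N ->
  tail_in n p.+1%:R^-1 p%:R^-1 x = (cfdigit n.+1 x == p)%:R.
Proof.
move=> xO p0; rewrite /tail_in; congr (_%:R); congr nat_of_bool.
have yO := iter_gauss_unit_irr n xO.
rewrite cfdigit_iter; have := inv_cfdigit1 yO.
have /andP[g0 g1] := unit_irr_itv (gauss_unit_irr yO).
have /andP[y0 y1] := unit_irr_itv yO.
set y := iter n gauss x in yO g0 g1 y0 y1 *; set d := cfdigit 1 y => ed.
have p0R : 0 < p%:R :> R by rewrite ltr0n.
have -> : (p.+1%:R^-1 < y < p%:R^-1) = (p%:R < y^-1 < p.+1%:R).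
  rewrite -[X in _ < X < _]invrK !ltf_pV2 ?posrE ?invr_gt0 ?ltr0n //.
  by rewrite andbC.
rewrite ed -natr1; apply/idP/eqP => [pd|<-]; last by apply/andP; split; lra.
have h1 : (p < d.+1)%N by rewrite -(ltr_nat R) -natr1; lra.
have h2 : (d < p.+1)%N by rewrite -(ltr_nat R) -natr1; lra.
by apply/eqP; rewrite eqn_leq -ltnS h2 -ltnS h1.
Qed.

Lemma expect_digit_eq n F p : bounded_adapted n F -> (forall x, Om x -> 0 <= F x) ->
  2^-1 * cf_weight p * expect F <= expect (fun x => F x * (cfdigit n.+1 x == p)%:R)
    <= 2 * cf_weight p * expect F.
Proof.
move=> bF F0; case: p => [|p].
  rewrite /cf_weight mul0n invr0 !mulr0 mul0r.
  rewrite (@eq_expect _ (fun _ => 0)) ?expect_cst ?lexx // => x xO.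
  by rewrite gtn_eqF ?cfdigit_gt0 // mulr0.
have := @tail_in_bound n F p.+2%:R^-1 p.+1%:R^-1 bF F0.
rewrite -cf_weightE // (@eq_expect (fun x => F x * tail_in _ _ _ x)
  (fun x => F x * (cfdigit n.+1 x == p.+1)%:R)).
  apply; rewrite ?invr_ge0 // ?ltf_pV2 ?posrE ?ltr_nat //.
  by rewrite invf_le1 // ler1n.
by move=> x xO; rewrite tail_in_cfdigit.
Qed.

Lemma expect_digit_gt n F L : bounded_adapted n F -> (forall x, Om x -> 0 <= F x) ->
  expect (fun x => F x * (L < cfdigit n.+1 x)%N%:R) <= 2 / L.+1%:R * expect F.
Proof.
move=> bF F0; have := @tail_in_bound n F 0 L.+1%:R^-1 bF F0 (lexx _).
rewrite invr_gt0 ltr0n subr0 (@eq_expect (fun x => F x * tail_in _ _ _ x)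
  (fun x => F x * (L < cfdigit n.+1 x)%N%:R)).
  move=> /(_ isT); rewrite invf_le1 // ler1n => /(_ isT).
  by move=> /andP[_].
move=> x xO; rewrite /tail_in; congr (_ * _%:R); congr nat_of_bool.
have yO := iter_gauss_unit_irr n xO.
rewrite cfdigit_iter; have := inv_cfdigit1 yO.
have /andP[g0 g1] := unit_irr_itv (gauss_unit_irr yO).
have /andP[y0 y1] := unit_irr_itv yO.
set y := iter n gauss x in yO g0 g1 y0 y1 *; set d := cfdigit 1 y => ed.
rewrite y0 /= -[X in X < _]invrK ltf_pV2 ?posrE ?invr_gt0 ?ltr0n // ed.
apply/idP/idP.
  by move=> h; rewrite -ltnS -(ltr_nat R) -[d.+1%:R]natr1; lra.
by rewrite -(ler_nat R); lra.
Qed.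

(** Decomposition over the values of the digit. The cutoff [P] makes it a finite sum, so linearity
    of the expectation is enough; unbounded functions of a digit are truncated before use. *)
Lemma expect_digit_fun n F (h : nat -> R) P : bounded_adapted n F ->
  (forall x, Om x -> 0 <= F x) -> (forall p, 0 <= h p) -> (forall p, (P <= p)%N -> h p = 0) ->
  2^-1 * (\sum_(p < P) h p * cf_weight p) * expect F
    <= expect (fun x => F x * h (cfdigit n.+1 x))
    <= 2 * (\sum_(p < P) h p * cf_weight p) * expect F.
Proof.
move=> bF F0 h0 hP.
have bFp p : bounded_adapted n.+1 (fun x => F x * (cfdigit n.+1 x == p)%:R).
  apply: bounded_adaptedM; first exact: bounded_adapted_le bF.
  by apply: bounded_adapted_bool; apply: (adapted_comp (fun d => d == p)); apply: adapted_cfdigit.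
have -> : expect (fun x => F x * h (cfdigit n.+1 x)) =
    \sum_(p < P) h p * expect (fun x => F x * (cfdigit n.+1 x == p)%:R).
  under [RHS]eq_bigr do rewrite -(expectZ _ (bFp _)).
  rewrite -(@expect_sum _ _ _ _ n.+1); last first.
    by move=> p _; apply: bounded_adaptedM => //; apply: bounded_adapted_cst.
  apply: eq_expect => x xO; set d := cfdigit n.+1 x.
  under eq_bigr do rewrite mulrCA; rewrite -mulr_sumr; congr (_ * _).
  have [Pd|dP] := leqP P d.
    rewrite hP // big1 // => p _; rewrite gtn_eqF ?mulr0 //.
    exact: leq_trans (ltn_ord p) Pd.
  rewrite (bigD1 (Ordinal dP)) //= eqxx mulr1 big1 ?addr0 // => p pd.
  by move: pd; rewrite -val_eqE /= eq_sym => /negPf ->; rewrite mulr0.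
rewrite !mulr_sumr !mulr_suml; apply/andP; split; apply: ler_sum => p _;
  have /andP[h1 h2] := expect_digit_eq p bF F0.
  by apply: le_trans (ler_wpM2l (h0 p) h1); rewrite !mulrA [h p * _]mulrC.
by apply: le_trans (ler_wpM2l (h0 p) h2) _; rewrite !mulrA [h p * _]mulrC.
Qed.

End Expectation.

(** * Borel-Cantelli and the size of the prime digit sums *)

Section AlmostSure.
Context {R : realType}.
Set Implicit Arguments.
Unset Strict Implicit.
Implicit Types (x y c : R) (n p k N L P : nat) (Q : R -> bool).
Local Notation mu := (@lebesgue_measure R).
Local Notation Om := (@unit_irr R).
Local Notation expect := (@expect R).
Local Notation cf_weight := (@cf_weight R).

(** The shift by 16 gives [ln (n + 16) >= 2], hence a value of at least 1/2 at every [n], without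
    changing the order for large [n]. *)
Definition lnln n : R := ln (ln (n + 16)%:R).
Definition nlnln n : R := n%:R * lnln n.

Lemma ln_ge_1BV c : 0 < c -> 1 - c^-1 <= ln c.
Proof.
move=> c0; have := @le_ln1Dx R (c^-1 - 1).
have -> : 1 + (c^-1 - 1) = c^-1 by lra.
rewrite lnV ?posrE // ltrBrDr addrC subrr invr_gt0 => /(_ c0); lra.
Qed.

Lemma ln2_ge_half : 2^-1 <= ln (2 : R).
Proof. by have := @ln_ge_1BV 2 (ltr0n _ 2); lra. Qed.

Lemma ln16_ge2 : 2 <= ln (16 : R).
Proof.
have -> : (16 : R) = 2 ^+ 4 by rewrite -natrX.
by rewrite lnXn // -[_ *+ 4]mulr_natr; have := ln2_ge_half; lra.
Qed.

Lemma lnln_ge_half n : 2^-1 <= lnln n.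
Proof.
apply: le_trans ln2_ge_half _; rewrite /lnln.
have h : 2 <= ln ((n + 16)%:R : R).
  by apply: le_trans ln16_ge2 _; rewrite ler_ln ?posrE ?ltr0n ?ler_nat ?addn_gt0 ?leq_addl ?orbT.
by rewrite ler_ln ?posrE //; lra.
Qed.

Lemma lnln_gt0 n : 0 < lnln n.
Proof. by have := lnln_ge_half n; lra. Qed.

Lemma nlnln_ge_half n : n%:R / 2 <= nlnln n.
Proof. by rewrite /nlnln ler_wpM2l // lnln_ge_half. Qed.

Lemma nlnln_gt0 n : (0 < n)%N -> 0 < nlnln n.
Proof. by move=> n0; rewrite mulr_gt0 ?ltr0n ?lnln_gt0. Qed.

(** Up to a factor 2, the conditional mean of a prime digit truncated at [L]; it is of order log log
    [L]. *)
Definition prime_mean L : R := \sum_(p < L.+1 | prime p) p%:R * cf_weight p.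

Lemma prime_mean_ge0 L : 0 <= prime_mean L.
Proof. by apply: sumr_ge0 => p _; rewrite mulr_ge0 ?cf_weight_ge0. Qed.

Definition trunc_prime L p : R := if prime p && (p <= L)%N then p%:R else 0.

Lemma trunc_prime_ge0 L p : 0 <= trunc_prime L p.
Proof. by rewrite /trunc_prime; case: ifP. Qed.

Lemma trunc_prime_out L p : (L.+1 <= p)%N -> trunc_prime L p = 0.
Proof. by move=> Lp; rewrite /trunc_prime leqNgt Lp andbF. Qed.

Lemma sum_trunc_prime L :
  \sum_(p < L.+1) trunc_prime L p * cf_weight p = prime_mean L.
Proof.
rewrite /prime_mean [RHS]big_mkcond; apply: eq_bigr => p _ /=.
by rewrite /trunc_prime -ltnS ltn_ord andbT; case: ifP; rewrite ?mul0r.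
Qed.

Lemma psumS n x : psum n.+1 x = (\sum_(k < n) pdigit k.+1 x)%N.
Proof. by rewrite /psum big_add1 big_mkord. Qed.

Lemma borel_cantelli (A : nat -> set R) (f : nat -> R) (B : R) :
  (forall n, measurable (A n : set (measurableTypeR R))) ->
  (forall n, (mu (A n) <= (f n)%:E)%E) ->
  (forall N, \sum_(n < N) f n <= B) ->
  mu.-negligible (lim_sup_set A).
Proof.
move=> mA Af fB; apply/negligibleP; last first.
  apply: lim_sup_set_cvg0 => //; apply: (@le_lt_trans _ _ B%:E); last exact: ltry.
  apply: lime_le; first by apply: is_cvg_nneseries => n _ _; apply: measure_ge0.
  near=> N; rewrite big_mkord; apply: (@le_trans _ _ (\sum_(n < N) (f n)%:E)%E).
    by apply: lee_sum => n _; apply: Af.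
  by rewrite sumEFin lee_fin.
apply: bigcapT_measurable => n; apply: bigcup_measurable => k _; exact: mA.
Unshelve. all: by end_near.
Qed.

Lemma measurable_adapted_set n Q : adapted n Q ->
  measurable (Om `&` [set x | Q x] : set (measurableTypeR R)).
Proof.
move=> aQ.
have := @measurable_adapted R n (fun x => (Q x)%:R) (bounded_adapted_bool aQ).1.
move=> /(_ (@measurable_unit_irr R) [set 1] (measurable_set1 1)).
congr (measurable (_ `&` _)); apply/seteqP; split=> x /=; case: (Q x) => //.
by move=> /esym/eqP; rewrite oner_eq0.
Qed.

Lemma adapted_has n N (D : pred nat) (T : nat -> R -> bool) :
  (forall k, (k < N)%N -> D k -> adapted n (T k)) ->
  adapted n (fun x => [exists k : 'I_N, D k && T k x]).
Proof.
move=> aT x y xO yO e; apply: eq_existsb => k.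
by case Dk : (D k) => //=; apply: aT.
Qed.

Lemma exists_le_sum N (T : nat -> bool) :
  ([exists k : 'I_N, T k])%:R <= \sum_(k < N) (T k)%:R :> R.
Proof.
case: existsP => [[k Tk]|_]; last by apply: sumr_ge0.
by rewrite (bigD1 k) //= Tk lerDl sumr_ge0.
Qed.

Lemma expect_digit_eq1 k p : expect (fun x => (cfdigit k.+1 x == p)%:R) <= 2 * cf_weight p.
Proof.
have bF : bounded_adapted k (fun _ : R => 1 : R) by apply: bounded_adapted_cst.
have /andP[_] := @expect_digit_eq R k (fun _ => 1) p bF (fun _ _ => ler01).
by rewrite expect_cst mulr1; under eq_expect do rewrite mul1r.
Qed.

Lemma expect_digit_gt1 k L : expect (fun x => (L < cfdigit k.+1 x)%N%:R) <= 2 / L.+1%:R.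
Proof.
have bF : bounded_adapted k (fun _ : R => 1 : R) by apply: bounded_adapted_cst.
have := @expect_digit_gt R k (fun _ => 1) L bF (fun _ _ => ler01).
by rewrite expect_cst mulr1; under eq_expect do rewrite mul1r.
Qed.

(* Borel-Cantelli is applied to the values [p] of the digits rather than to
   their positions: for each [p] there are finitely many positions to consider. *)
Lemma finitely_many_digits (D : nat -> pred nat) (M : nat -> nat) (B : R) :
  (forall p n, D n p -> (n < M p)%N) ->
  (forall P, \sum_(p < P) cf_weight p * (\sum_(n < M p) D n p)%:R <= B) ->
  mu.-negligible (Om `&` [set x | forall N, exists n, (N <= n)%N /\ D n (cfdigit n.+1 x)]).
Proof.
move=> DM sB.
pose U p := Om `&` [set x | [exists n : 'I_(M p), D n p && (cfdigit n.+1 x == p)]].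
have aU p : adapted (M p) (fun x => [exists n : 'I_(M p), D n p && (cfdigit n.+1 x == p)]).
  apply: (@adapted_has (M p) (M p) (fun n => D n p) (fun n x => cfdigit n.+1 x == p)) => k kM _.
  by apply: (adapted_comp (fun d => d == p)); apply: adapted_cfdigit.
have Ub p : (mu (U p) <= (2 * (cf_weight p * (\sum_(n < M p) D n p)%:R))%:E)%E.
  rewrite (measure_adapted (aU p)) lee_fin.
  have bF k : (k < M p)%N -> bounded_adapted (M p) (fun x => ((cfdigit k.+1 x == p) : bool)%:R).
    move=> kM; apply: bounded_adapted_bool; apply: (adapted_comp (fun d => d == p)).
    exact: adapted_cfdigit.
  apply: (@le_trans _ _ (expect (fun x => \sum_(n < M p) (D n p && (cfdigit n.+1 x == p))%:R))).
    apply: (@expect_le _ (M p) (M p)).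
    - exact: bounded_adapted_bool.
    - apply: bounded_adapted_sum => k _; case: (D k p) => /=; last exact: bounded_adapted_cst.
      exact: bF.
    - by move=> x _; apply: (@exists_le_sum _ (fun n => D n p && (cfdigit n.+1 x == p))).
  rewrite (@expect_sum _ _ _ _ _ (M p)); last first.
    move=> k _; case: (D k p) => /=; last exact: bounded_adapted_cst.
    exact: bF.
  apply: (@le_trans _ _ (\sum_(n < M p) 2 * cf_weight p * (D n p)%:R)).
    apply: ler_sum => n _; case: (D n p) => /=; last by rewrite expect_cst mulr0.
    by rewrite mulr1 expect_digit_eq1.
  by rewrite -mulr_sumr -natr_sum -mulrA.
have := @borel_cantelli U (fun p => 2 * (cf_weight p * (\sum_(n < M p) D n p)%:R)) (2 * B).
move=> /(_ (fun p => measurable_adapted_set (aU p)) Ub) [].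
  by move=> P; rewrite -mulr_sumr ler_wpM2l.
move=> V [mV V0 sV]; exists V; split=> // x [xO Hx]; apply: sV => p0 _ /=.
(* Beyond this position the digit value is at least [p0]: a smaller value would, by [DM], put the
   position below the maximum. *)
have [n [Nn Dn]] := Hx (\max_(p < p0) M p)%N.
exists (cfdigit n.+1 x) => /=.
  rewrite leqNgt; apply/negP => h; have := DM _ _ Dn.
  rewrite ltnNge => /negP; apply.
  exact: leq_trans (leq_bigmax (Ordinal h)) Nn.
split=> //=; apply/existsP.
have h : (n < M (cfdigit n.+1 x))%N by apply: DM.
by exists (Ordinal h) => /=; rewrite Dn eqxx.
Qed.

End AlmostSure.

(** * Upper bound for the prefix sums given the past *)

Section UpperLaw.
Context {R : realType}.
Set Implicit Arguments.
Unset Strict Implicit.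
Implicit Types (x c : R) (n m p k K N L P : nat) (Q : R -> bool).
Local Notation Om := (@unit_irr R).
Local Notation expect := (@expect R).
Local Notation cf_weight := (@cf_weight R).
Local Notation nlnln := (@nlnln R).
Local Notation lnln := (@lnln R).
Local Notation prime_mean := (@prime_mean R).

Lemma sum_cond_le n (T : pred nat) (f : nat -> R) c : 0 <= c ->
  (forall k, (k < n)%N -> T k -> f k <= c) -> \sum_(k < n | T k) f k <= n%:R * c.
Proof.
move=> c0 fc; rewrite big_mkcond -[n in n%:R]card_ord -sum1_card natr_sum mulr_suml.
by apply: ler_sum => k _; rewrite mul1r; case: ifP => // /fc; apply.
Qed.

Lemma expect_bool_digit_fun n Q (h : nat -> R) P : adapted n Q ->
  (forall p, 0 <= h p) -> (forall p, (P <= p)%N -> h p = 0) ->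
  2^-1 * (\sum_(p < P) h p * cf_weight p) * expect (fun x => (Q x)%:R)
    <= expect (fun x => (Q x)%:R * h (cfdigit n.+1 x))
    <= 2 * (\sum_(p < P) h p * cf_weight p) * expect (fun x => (Q x)%:R).
Proof.
move=> aQ h0 hP; apply: expect_digit_fun => //.
exact: bounded_adapted_bool.
Qed.

Lemma bounded_adapted_digit_fun n k (h : nat -> R) P : (k < n)%N ->
  (forall p, (P <= p)%N -> h p = 0) ->
  bounded_adapted n (fun x => h (cfdigit k.+1 x)).
Proof.
move=> kn hP; split; first exact: (adapted_comp h (adapted_cfdigit kn)).
exists (\sum_(p < P) `|h p|) => x _.
have [Pd|dP] := leqP P (cfdigit k.+1 x); first by rewrite hP // normr0 sumr_ge0.
by rewrite (bigD1 (Ordinal dP)) //= lerDl sumr_ge0.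
Qed.

(** [Q] is an event about the first [K] digits on which they are at most [L], and [n0] is uniform
    over such [Q], so the bound can be restarted after any past. The loss of 1/4 is 1/8 for a digit
    above [16 * n] at a position from [K] on, by a union bound, plus 1/8 for the truncated sum, by
    Markov. The first [K] digits add at most [K * L], which is below half of the threshold once [n]
    is large. *)
Lemma psum_upper (C2 : R) : 0 < C2 ->
  (forall n, (0 < n)%N -> prime_mean (16 * n) <= C2 * lnln n) ->
  forall K L, exists n0, forall n, (n0 <= n)%N -> forall Q, adapted K Q ->
    (forall x, Om x -> Q x -> forall k, (k < K)%N -> (cfdigit k.+1 x <= L)%N) ->
    3 / 4 * expect (fun x => (Q x)%:R) <=
    expect (fun x => (Q x && ((psum n.+1 x)%:R <= 32 * C2 * nlnln n))%:R).
Proof.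
move=> C20 mC K L.
have fw (w r : R) : 0 < w -> 2 / w * (w / 16 * r) = r / 8 by move=> w0; field; rewrite gt_eqF.
have fw2 (w : R) : 0 < w -> 2 / w * (w / 2) = 1 by move=> w0; field; rewrite gt_eqF.
set C := 32 * C2.
have C0 : 0 < C by rewrite mulr_gt0.
exists (maxn K.+1 (Num.truncn (4 * (K * L)%:R / C)).+1) => n.
rewrite geq_max => /andP[Kn ltn] Q aQ QL.
have n0 : (0 < n)%N by apply: leq_trans Kn.
have nR : 0 < n%:R :> R by rewrite ltr0n.
set u := nlnln n.
have u0 : 0 < u by apply: nlnln_gt0.
have KLu : (K * L)%:R <= C * u / 2.
  have h1 : 4 * (K * L)%:R / C <= n%:R.
    apply/ltW; apply: lt_le_trans (_ : (Num.truncn (4 * (K * L)%:R / C)).+1%:R <= _); last by rewrite ler_nat.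
    exact: truncnS_gt.
  have h2 := @nlnln_ge_half R n.
  rewrite ler_pdivrMr // in h1.
  have : C * (n%:R / 2) <= C * u by rewrite ler_wpM2l // ltW.
  by lra.
set q := expect (fun x => (Q x)%:R).
have q0 : 0 <= q by apply: expect_ge0.
have aQk k : (K <= k)%N -> adapted k Q by move=> Kk; apply: adapted_le aQ.
have bQ m : (K <= m)%N -> bounded_adapted m (fun x => (Q x)%:R).
  by move=> Km; apply: bounded_adapted_bool; apply: aQk.
have KnW : (K <= n)%N by apply: ltnW.
pose T1 k x := (Q x)%:R * (16 * n < cfdigit k.+1 x)%N%:R : R.
pose t := @trunc_prime R (16 * n).
pose T2 k x := (Q x)%:R * t (cfdigit k.+1 x).
have bT1 k : (k < n)%N -> bounded_adapted n (T1 k).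
  move=> kn; apply: bounded_adaptedM; first exact: bQ.
  apply: bounded_adapted_bool; apply: (adapted_comp (fun d => 16 * n < d)%N).
  exact: adapted_cfdigit.
have bT2 k : (k < n)%N -> bounded_adapted n (T2 k).
  move=> kn; apply: bounded_adaptedM; first exact: bQ.
  by apply: (bounded_adapted_digit_fun kn) => p; apply: trunc_prime_out.
have bS1 : bounded_adapted n (fun x => \sum_(k < n | (K <= k)%N) T1 k x).
  by apply: bounded_adapted_sum => k _; apply: bT1.
have bS2 : bounded_adapted n (fun x => \sum_(k < n | (K <= k)%N) T2 k x).
  by apply: bounded_adapted_sum => k _; apply: bT2.
have eS1 : expect (fun x => \sum_(k < n | (K <= k)%N) T1 k x) <= q / 8.
  rewrite (@expect_sum _ _ _ _ _ n) => [|k _]; last exact: bT1.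
  apply: le_trans (@sum_cond_le n (fun k => K <= k)%N (fun k => expect (T1 k)) (2 / (16 * n).+1%:R * q) _ _) _.
  - by rewrite mulr_ge0.
  - move=> k kn Kk; apply: expect_digit_gt => //; exact: bQ.
  - have e : (16 * n).+1%:R = 16 * n%:R + 1 :> R by rewrite -natr1 natrM.
    rewrite mulrA [leRHS]mulrC ler_wpM2r // mulrA ler_pdivrMr ?ltr0n // e.
    by lra.
have eS2 : expect (fun x => \sum_(k < n | (K <= k)%N) T2 k x) <= C * u / 16 * q.
  rewrite (@expect_sum _ _ _ _ _ n) => [|k _]; last exact: bT2.
  apply: le_trans (@sum_cond_le n (fun k => K <= k)%N (fun k => expect (T2 k)) (2 * prime_mean (16 * n) * q) _ _) _.
  - by rewrite !mulr_ge0 // prime_mean_ge0.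
  - move=> k kn Kk; rewrite -sum_trunc_prime.
    have := @expect_bool_digit_fun k Q t (16 * n).+1 (aQk k Kk) (fun p => trunc_prime_ge0 _ p)
      (fun p => @trunc_prime_out R _ p).
    by move=> /andP[].
  - rewrite mulrA ler_wpM2r // /u /nlnln /C.
    have : n%:R * prime_mean (16 * n) <= n%:R * (C2 * lnln n) by rewrite ler_wpM2l // ?mC.
    by lra.
(* The indicator of the good event dominates [Q], minus the number of large digits, minus the
   truncated sum divided by half of the threshold. Both exceptional events are thus handled by
   linearity. *)
apply: (@le_trans _ _ (expect (fun x => (Q x)%:R - \sum_(k < n | (K <= k)%N) T1 k x
   - 2 / (C * u) * \sum_(k < n | (K <= k)%N) T2 k x))).
  have bS2' := bounded_adaptedM (bounded_adapted_cst n (2 / (C * u))) bS2.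
  have bQ1 : bounded_adapted n (fun x => (Q x)%:R - \sum_(k < n | (K <= k)%N) T1 k x).
    by apply: bounded_adaptedB => //; apply: bQ.
  rewrite (expectB bQ1 bS2') (expectB (bQ n KnW) bS1) (expectZ _ bS2) -/q.
  have Cu : 0 < C * u by rewrite mulr_gt0.
  have : 2 / (C * u) * expect (fun x => \sum_(k < n | (K <= k)%N) T2 k x) <= 2 / (C * u) * (C * u / 16 * q).
    by rewrite ler_wpM2l // divr_ge0 // ltW.
  rewrite fw //.
  by lra.
have aG : adapted n (fun x => Q x && ((psum n.+1 x)%:R <= C * u)).
  apply: (adapted_comp2 andb (aQk n KnW)).
  exact: (adapted_comp (fun s => s%:R <= C * u) (@adapted_psum R n)).
have bS2' := bounded_adaptedM (bounded_adapted_cst n (2 / (C * u))) bS2.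
apply: (@expect_le _ n n); last first.
- move=> x xO.
  have S1 : 0 <= \sum_(k < n | (K <= k)%N) T1 k x by apply: sumr_ge0 => k _; rewrite mulr_ge0.
  have t0 k : 0 <= T2 k x by rewrite mulr_ge0 // trunc_prime_ge0.
  have Cu : 0 < C * u by rewrite mulr_gt0.
  have S2 : 0 <= 2 / (C * u) * \sum_(k < n | (K <= k)%N) T2 k x.
    by rewrite mulr_ge0 // ?divr_ge0 // ?sumr_ge0 // ltW.
  case Qx : (Q x) => /=; last by move: S1 S2; rewrite /=; lra.
  case: (leP (psum n.+1 x)%:R (C * u)) => [_|psumC] /=; first by lra.
  have [/existsP[k /andP[Kk dk]]|] := boolP [exists k : 'I_n, (K <= k)%N && (16 * n < cfdigit k.+1 x)%N].
    have : 1 <= \sum_(k < n | (K <= k)%N) T1 k x.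
      rewrite (bigD1 k) //= {1}/T1 Qx dk mul1r lerDl.
      by apply: sumr_ge0 => j _; rewrite mulr_ge0.
    by lra.
  rewrite negb_exists => /forallP small.
  suff : C * u / 2 <= \sum_(k < n | (K <= k)%N) T2 k x.
    move=> h; have : 2 / (C * u) * (C * u / 2) <= 2 / (C * u) * \sum_(k < n | (K <= k)%N) T2 k x.
      by rewrite ler_wpM2l // divr_ge0 // ltW.
    rewrite fw2 //.
    by lra.
  have -> : \sum_(k < n | (K <= k)%N) T2 k x = (\sum_(k < n | (K <= k)%N) pdigit k.+1 x)%:R.
    rewrite natr_sum; apply: eq_bigr => k Kk; have := small k; rewrite Kk /= -leqNgt => dk.
    by rewrite /T2 /t /trunc_prime dk andbT Qx mul1r /pdigit; case: ifP.
  move: psumC; rewrite psumS (bigID (fun k : 'I_n => (K <= k)%N)) /= natrD.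
  suff : (\sum_(k < n | ~~ (K <= k)%N) pdigit k.+1 x)%:R <= (K * L)%:R :> R by lra.
  rewrite ler_nat.
  apply: (@leq_trans (\sum_(k < n | (k < K)%N) L)).
    rewrite (eq_bigl (fun k : 'I_n => (k < K)%N)); last by move=> k; rewrite -ltnNge.
    apply: leq_sum => k kK; apply: leq_trans (QL x xO Qx k kK).
    by rewrite /pdigit; case: ifP.
  by rewrite -(big_ord_widen n (fun=> L) KnW) sum_nat_const card_ord.
- exact: bounded_adapted_bool.
- by do 2?apply: bounded_adaptedB => //; apply: bQ.
Qed.

End UpperLaw.

(** * Infinitely many hits in the divergent case *)

Section InfinitelyOften.
Context {R : realType}.
Set Implicit Arguments.
Unset Strict Implicit.
Implicit Types (x a : R) (n m p k j K N L P : nat) (Q : R -> bool).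
Local Notation mu := (@lebesgue_measure R).
Local Notation Om := (@unit_irr R).
Local Notation expect := (@expect R).
Local Notation cf_weight := (@cf_weight R).
Local Notation nlnln := (@nlnln R).
Local Notation lnln := (@lnln R).
Local Notation prime_mean := (@prime_mean R).

Lemma exists_ordS j (T : pred nat) :
  [exists n : 'I_j.+1, T n] = [exists n : 'I_j, T n] || T j.
Proof.
apply/existsP/orP => [[n Tn]|[/existsP[n Tn]|Tj]].
- have := ltn_ord n; rewrite ltnS leq_eqVlt => /orP[/eqP e|nj]; first by right; rewrite -e.
  by left; apply/existsP; exists (Ordinal nj).
- by exists (widen_ord (leqnSn j) n).
- by exists ord_max.
Qed.

Lemma expect_bool_le n m Q (Q' : R -> bool) : adapted n Q -> adapted m Q' ->
  (forall x, Om x -> Q x -> Q' x) ->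
  expect (fun x => (Q x)%:R) <= expect (fun x => (Q' x)%:R).
Proof.
move=> aQ aQ' QQ'; apply: (@expect_le _ n m); try exact: bounded_adapted_bool.
by move=> x xO; case Qx : (Q x) => //; rewrite (QQ' x).
Qed.

Lemma adapted_nexists n N (T : nat -> R -> bool) (D : pred nat) :
  (forall k, (k < N)%N -> D k -> adapted n (T k)) ->
  adapted n (fun x => ~~ [exists k : 'I_N, D k && T k x]).
Proof. by move=> aT; apply: (adapted_comp negb); apply: adapted_has. Qed.

Section Avoid.
Variables (C2 : R) (D : nat -> pred nat).
Hypothesis C20 : 0 < C2.
Hypothesis mC : forall n, (0 < n)%N -> prime_mean (16 * n) <= C2 * lnln n.
Hypothesis divD : forall n1, exists P N',
  8^-1 <= \sum_(n1 <= n < N') \sum_(p < P) (D n p)%:R * cf_weight p.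

Let small_psum n x := ((psum n.+1 x)%:R <= 32 * C2 * nlnln n).
Let hit n x := D n (cfdigit n.+1 x) && small_psum n x.
Let avoid N K x := ~~ [exists n : 'I_K, (N <= n)%N && hit n x].

Let adapted_small n : adapted n (small_psum n).
Proof. exact: (adapted_comp (fun s => s%:R <= 32 * C2 * nlnln n) (@adapted_psum R n)). Qed.

Let adapted_hit n : adapted n.+1 (hit n).
Proof.
apply: (adapted_comp2 andb); first by apply: (adapted_comp (D n)); apply: adapted_cfdigit.
exact: adapted_le (leqnSn n) (@adapted_small n).
Qed.

Let adapted_avoid N K : adapted K (avoid N K).
Proof. by apply: adapted_nexists => k kK _; apply: (adapted_le _ (@adapted_hit k)). Qed.

(* The block stops as soon as its weight reaches [1/8]: each of its hits is then
   the first one, with a small prefix sum, with conditional probability at least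
   [3/4 - 2/8] times half its weight. *)
Let avoid_step N K e : (N <= K)%N -> 0 < e -> exists2 K', (N <= K')%N &
  expect (fun x => (avoid N K' x)%:R) <= 31 / 32 * expect (fun x => (avoid N K x)%:R) + e.
Proof.
move=> NK e0.
(* By a union bound some of the first [K] digits exceeds this [L] with probability at most [e];
   excluding that event gives the bounded past that [psum_upper] asks for. *)
pose L := Num.truncn (2 * K%:R / e).
have Le : K%:R * (2 / L.+1%:R) <= e.
  have : 2 * K%:R / e < L.+1%:R by apply: truncnS_gt.
  by rewrite ltr_pdivrMr // mulrA ler_pdivrMr ?ltr0n // => /ltW; rewrite [_ * 2]mulrC [e * _]mulrC.
pose large x := [exists k : 'I_K, true && (L < cfdigit k.+1 x)%N].
have alarge : adapted K large.
  apply: (@adapted_has _ _ _ (fun=> true) (fun k x => L < cfdigit k.+1 x)%N) => k kK _.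
  by apply: (adapted_comp (fun d => L < d)%N); apply: adapted_cfdigit.
have elarge : expect (fun x => (large x)%:R) <= e.
  have bk k : (k < K)%N -> bounded_adapted K (fun x => ((L < cfdigit k.+1 x)%N)%:R : R).
    move=> kK; apply: bounded_adapted_bool; apply: (adapted_comp (fun d => L < d)%N).
    exact: adapted_cfdigit.
  apply: (@le_trans _ _ (expect (fun x => \sum_(k < K) (L < cfdigit k.+1 x)%N%:R))).
    apply: (@expect_le _ K K); first exact: bounded_adapted_bool.
      by apply: bounded_adapted_sum => k _; apply: bk.
    by move=> x _; apply: (@exists_le_sum _ _ (fun k => L < cfdigit k.+1 x)%N).
  rewrite (@expect_sum _ _ _ _ _ K) => [|k _]; last exact: bk.
  apply: le_trans Le.
  apply: (@sum_cond_le _ K xpredT (fun k => expect (fun x => (L < cfdigit k.+1 x)%N%:R))).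
    by rewrite divr_ge0.
  by move=> k _ _; apply: expect_digit_gt1.
pose Q x := avoid N K x && ~~ large x.
have aQ : adapted K Q by apply: (adapted_comp2 andb (@adapted_avoid N K)); apply: (adapted_comp negb).
have QL x : Om x -> Q x -> forall k, (k < K)%N -> (cfdigit k.+1 x <= L)%N.
  move=> _ /andP[_]; rewrite negb_exists => /forallP H k kK.
  by have := H (Ordinal kK); rewrite /= -leqNgt.
have [n0 upper] := psum_upper C20 mC K L.
pose n1 := maxn n0 K.
have [P [N1 divN1]] := divD n1.
(* Cutting [D] at [P] makes the weight of each time a finite sum, as the bounds for functions of one
   digit require. *)
pose D' n p := D n p && (p < P)%N.
pose q n := \sum_(p < P) (D' n p)%:R * cf_weight p.
have qE n : q n = \sum_(p < P) (D n p)%:R * cf_weight p.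
  by apply: eq_bigr => p _; rewrite /D' (ltn_ord p) andbT.
have q_ge0 n : 0 <= q n by apply: sumr_ge0 => p _; rewrite mulr_ge0 ?cf_weight_ge0.
have exN : exists m, 8^-1 <= \sum_(n1 <= n < m) q n.
  by exists N1; under eq_bigr do rewrite qE.
case: (ex_minnP exN) => K' divK' minK'.
have n1K' : (n1 < K')%N.
  rewrite ltnNge; apply/negP => h; move: divK'; rewrite big_geq //.
  by rewrite leNgt invr_gt0 ltr0n.
have Kn1 : (K <= n1)%N by rewrite leq_maxr.
have n0n1 : (n0 <= n1)%N by rewrite leq_maxl.
exists K'; first by apply: leq_trans (ltnW n1K'); apply: leq_trans Kn1.
pose noE j x := ~~ [exists n : 'I_j, (n1 <= n)%N && D' n (cfdigit n.+1 x)].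
have aD' k : adapted k.+1 (fun x => D' k (cfdigit k.+1 x)).
  by apply: (adapted_comp (D' k)); apply: adapted_cfdigit.
have anoE j : adapted j (noE j).
  by apply: (@adapted_nexists _ _ (fun n x => D' n (cfdigit n.+1 x))) => k kj _; apply: (adapted_le kj (aD' k)).
pose good n x := Q x && small_psum n x.
have aQn n : (n1 <= n)%N -> adapted n Q by move=> h; apply: (adapted_le _ aQ); apply: leq_trans h.
have agood n : (n1 <= n)%N -> adapted n (good n).
  by move=> h; apply: (adapted_comp2 andb (aQn n h) (@adapted_small n)).
pose pre n x := good n x && noE n x.
have apre n : (n1 <= n)%N -> adapted n (pre n).
  by move=> h; apply: (adapted_comp2 andb (agood n h) (anoE n)).
pose B n x := pre n x && D' n (cfdigit n.+1 x).
have aB n : (n1 <= n)%N -> adapted n.+1 (B n).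
  by move=> h; apply: (adapted_comp2 andb (adapted_le (leqnSn n) (apre n h)) (aD' n)).
set eQ := expect (fun x => (Q x)%:R).
have eQ0 : 0 <= eQ by apply: expect_ge0.
have D'out n p : (P <= p)%N -> (D' n p)%:R = 0 :> R by rewrite /D' leqNgt => /negPf ->; rewrite andbF.
have eB n : (n1 <= n)%N -> (n < K')%N -> q n * (eQ / 4) <= expect (fun x => (B n x)%:R).
  move=> n1n nK'.
  have /andP[+ _] := @expect_bool_digit_fun R n (pre n) (fun p => (D' n p)%:R) P (apre n n1n)
    (fun p => ler0n _ _) (D'out n).
  under [X in _ <= X]eq_expect do rewrite -natrM mulnb.
  apply: le_trans; rewrite -/(q n) mulrAC [leRHS]mulrC ler_wpM2l //.
  have bgood := bounded_adapted_bool (agood n n1n).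
  pose S x := \sum_(n1 <= k < n) (Q x)%:R * (D' k (cfdigit k.+1 x))%:R : R.
  have bterm k : (n1 <= k < n)%N -> bounded_adapted n (fun x => (Q x)%:R * (D' k (cfdigit k.+1 x))%:R).
    move=> /andP[_ kn]; apply: bounded_adaptedM; apply: bounded_adapted_bool; first exact: aQn.
    exact: (adapted_le kn (aD' k)).
  have SE : S = (fun x => \sum_(k <- index_iota n1 n | (n1 <= k < n)%N) (Q x)%:R * (D' k (cfdigit k.+1 x))%:R).
    apply: funext => x; rewrite /S big_seq_cond; apply: eq_bigl => k.
    by rewrite mem_index_iota andbT.
  have bS : bounded_adapted n S by rewrite SE; apply: bounded_adapted_sum.
  have eS : expect S <= eQ / 4.
    rewrite SE (@expect_sum _ _ _ _ _ n) //.
    apply: (@le_trans _ _ (\sum_(k <- index_iota n1 n | (n1 <= k < n)%N) 2 * q k * eQ)).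
      apply: ler_sum => k /andP[n1k _].
      by have /andP[_] := @expect_bool_digit_fun R k Q (fun p => (D' k p)%:R) P (aQn k n1k)
        (fun p => ler0n _ _) (D'out k).
    rewrite -mulr_suml -mulr_sumr [leRHS]mulrC ler_wpM2r //.
    have : \sum_(n1 <= k < n) q k < 8^-1.
      by rewrite ltNge; apply/negP => /minK'; rewrite leqNgt nK'.
    rewrite big_seq_cond (eq_bigl (fun k => n1 <= k < n)%N); first by lra.
    by move=> k; rewrite mem_index_iota andbT.
  have egood : 3 / 4 * eQ <= expect (fun x => (good n x)%:R).
    by apply: upper => //; apply: leq_trans n1n.
  (* [S] counts the earlier occurrences of [D'] within [Q], so a good point outside [pre n] has [S]
     at least 1. *)
  have : expect (fun x => (good n x)%:R - S x) <= expect (fun x => (pre n x)%:R).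
    apply: (@expect_le _ n n).
    - exact: bounded_adaptedB.
    - exact: bounded_adapted_bool (apre n n1n).
    move=> x xO; rewrite /pre.
    have S0 : 0 <= S x by apply: sumr_ge0 => k _; rewrite mulr_ge0.
    case gx : (good n x) => /=; last by lra.
    case: (boolP (noE n x)) => /= [_|]; first by lra.
    rewrite negbK => /existsP[k /andP[n1k Dk]].
    rewrite subr_le0 /S (bigD1_seq (k : nat)) ?iota_uniq ?mem_index_iota ?n1k ?ltn_ord //=.
    have /andP[-> _] := gx; rewrite Dk mul1r lerDl.
    by apply: sumr_ge0 => j _.
  by rewrite (expectB bgood bS); lra.
(* The events [B n] are disjoint, since each requires that [D'] did not occur earlier in the
   block. *)
have disj x j : (n1 <= j)%N -> \sum_(n1 <= n < j) (B n x)%:R <= (Q x && ~~ noE j x)%:R :> R.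
  elim: j => [|j IH].
    by rewrite leqn0 => /eqP ->; rewrite big_geq.
  rewrite leq_eqVlt => /orP[/eqP <-|]; first by rewrite big_geq.
  rewrite ltnS => n1j; rewrite big_nat_recr //=.
  have -> : noE j.+1 x = noE j x && ~~ D' j (cfdigit j.+1 x).
    by rewrite /noE (@exists_ordS j (fun n => (n1 <= n)%N && D' n (cfdigit n.+1 x))) n1j negb_or.
  move: (IH n1j); rewrite /B /pre /good.
  case: (Q x) => /=; last by rewrite addr0.
  case: (noE j x) => /=; last by rewrite andbF addr0.
  case: (D' j _) => /=; last by rewrite andbF addr0.
  by case: (small_psum j x) => /=; lra.
have bB n : (n1 <= n < K')%N -> bounded_adapted K' (fun x => (B n x)%:R).
  by move=> /andP[n1n nK']; apply: bounded_adapted_bool; apply: (adapted_le nK' (aB n n1n)).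
pose SB x := \sum_(n1 <= n < K') (B n x)%:R : R.
have SBE : SB = (fun x => \sum_(n <- index_iota n1 K' | (n1 <= n < K')%N) (B n x)%:R).
  by apply: funext => x; rewrite /SB big_seq_cond; apply: eq_bigl => k; rewrite mem_index_iota andbT.
have bSB : bounded_adapted K' SB by rewrite SBE; apply: bounded_adapted_sum.
have KK' : (K <= K')%N by apply: leq_trans (ltnW n1K').
have bQ := bounded_adapted_bool (adapted_le KK' aQ).
have bl := bounded_adapted_bool (adapted_le KK' alarge).
(* A point that avoids all hits up to [K'] either has a large digit among the first [K] or lies in
   [Q] outside every [B n]. *)
have point : expect (fun x => (avoid N K' x)%:R) <= expect (fun x => (large x)%:R + (Q x)%:R - SB x).
  apply: (@expect_le _ K' K').
  - exact: bounded_adapted_bool.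
  - by apply: bounded_adaptedB => //; apply: bounded_adaptedD.
  move=> x xO.
  have SBQ : SB x <= (Q x)%:R.
    by apply: le_trans (disj x K' (ltnW n1K')) _; case: (Q x) => //=; case: (~~ _).
  have l0 : 0 <= (large x)%:R :> R by [].
  have [av|_] := boolP (avoid N K' x); last by rewrite /=; lra.
  have avK : avoid N K x.
    apply: contra av => /existsP[n hn]; apply/existsP.
    by exists (widen_ord KK' n).
  have SB0 : SB x = 0.
    rewrite SBE big1 // => n /andP[n1n nK']; rewrite /B /pre /good.
    case Dn : (D' n _); rewrite ?andbF // andbT.
    have [sn|] := boolP (small_psum n x); last by rewrite andbF.
    exfalso; move/negP: av; apply; apply/existsP; exists (Ordinal nK') => /=.
    rewrite /hit sn andbT; have /andP[-> _] := Dn.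
    by rewrite andbT (leq_trans NK) // (leq_trans Kn1).
  by rewrite SB0 /Q avK /=; case: (large x) => /=; lra.
apply: le_trans point _.
rewrite (expectB (bounded_adaptedD bl bQ) bSB) (expectD bl bQ) -/eQ.
have eQav : eQ <= expect (fun x => (avoid N K x)%:R).
  by apply: (expect_bool_le aQ (@adapted_avoid N K)) => x _ /andP[].
suff : eQ / 32 <= expect SB by lra.
rewrite SBE (@expect_sum _ _ _ _ _ K') //.
apply: (@le_trans _ _ (\sum_(n <- index_iota n1 K' | (n1 <= n < K')%N) q n * (eQ / 4))); last first.
  by apply: ler_sum => n /andP[n1n nK']; apply: eB.
rewrite -mulr_suml.
have -> : \sum_(n <- index_iota n1 K' | (n1 <= n < K')%N) q n = \sum_(n1 <= n < K') q n.
  by rewrite [RHS]big_seq_cond; apply: eq_bigl => k; rewrite mem_index_iota andbT.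
have : 8^-1 * (eQ / 4) <= (\sum_(n1 <= n < K') q n) * (eQ / 4).
  by rewrite ler_wpM2r // divr_ge0.
by lra.
Qed.

Let avoid_small N j : exists2 K, (N <= K)%N &
  expect (fun x => (avoid N K x)%:R) <= (63 / 64) ^+ j.
Proof.
elim: j => [|j [K NK IH]].
  exists N => //; rewrite expr0 -[leRHS](@expect_cst R).
  apply: (@expect_le _ N N); [exact: bounded_adapted_bool|exact: bounded_adapted_cst|].
  by move=> x _; case: (avoid N N x).
(* The error is chosen so that [31/32 + 1/64 = 63/64]. *)
have e0 : 0 < (63 / 64) ^+ j / 64 :> R by rewrite divr_gt0 // exprn_gt0 // divr_gt0.
have [K' NK' h] := avoid_step NK e0; exists K' => //.
move: h IH; rewrite exprS.
by move: ((63 / 64) ^+ j) (expect _) (expect _) => r s t; lra.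
Qed.

(** For each [N] the probability of avoiding all hits between [N] and [K] falls below every power of
    63/64 for suitable [K]. The points without a hit after [N] therefore form a null set, and there
    are countably many [N]. *)
Lemma infinitely_often_digits : mu.-negligible (Om `&` [set x | exists N, forall n, (N <= n)%N ->
  ~ (D n (cfdigit n.+1 x) /\ (psum n.+1 x)%:R <= 32 * C2 * nlnln n)]).
Proof.
suff neg : mu.-negligible (\bigcup_N \bigcap_K (Om `&` [set x | avoid N K x])).
  apply: negligibleS neg => x [xO [N HN]]; exists N => // K _; split=> //=.
  apply/negP => /existsP[n /andP[Nn /andP[h1 h2]]].
  exact: (HN n Nn).
apply: negligible_bigcup => N.
have mA K : measurable (Om `&` [set x | avoid N K x] : set (measurableTypeR R)).
  exact: measurable_adapted_set (@adapted_avoid N K).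
have mI : measurable (\bigcap_K (Om `&` [set x | avoid N K x]) : set (measurableTypeR R)).
  exact: bigcapT_measurable.
apply/negligibleP => //.
apply/eqP; rewrite eq_le measure_ge0 andbT.
apply/lee_addgt0Pr => e e0; rewrite add0e.
have [j je] : exists j, (63 / 64) ^+ j <= e.
  have q1 : `|63 / 64 : R| < 1 by rewrite ger0_norm ?divr_ge0 //; lra.
  have /cvgr0_norm_le /(_ e e0) [j _ /(_ j (leqnn j))] := cvg_expr q1.
  by rewrite /= ger0_norm ?exprn_ge0 ?divr_ge0 //; exists j.
have [K NK h] := avoid_small N j.
apply: (@le_trans _ _ (mu (Om `&` [set x | avoid N K x]))).
  by rewrite le_measure ?inE // => x /(_ K I).
by rewrite (measure_adapted (@adapted_avoid N K)) lee_fin; apply: le_trans je.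
Qed.

End Avoid.
End InfinitelyOften.

(** * Lower bound for the prefix sums, almost everywhere *)

Section LowerLaw.
Context {R : realType}.
Set Implicit Arguments.
Unset Strict Implicit.
Implicit Types (x y : R) (n p k N L : nat).
Local Notation mu := (@lebesgue_measure R).
Local Notation Om := (@unit_irr R).
Local Notation expect := (@expect R).
Local Notation cf_weight := (@cf_weight R).
Local Notation nlnln := (@nlnln R).
Local Notation lnln := (@lnln R).
Local Notation prime_mean := (@prime_mean R).
Local Notation trunc_prime := (@trunc_prime R).

Lemma one_sub_expRN y : 0 <= y -> y <= 1 -> y / 2 <= 1 - expR (- y).
Proof.
move=> y0 y1; rewrite expRN.
have h : (expR y)^-1 <= (1 + y)^-1.
  by rewrite lef_pV2 ?posrE ?expR_gt0 ?expR_ge1Dx //; lra.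
have : (1 + y)^-1 <= 1 - y / 2.
  by rewrite -[leLHS]mul1r ler_pdivrMr; nra.
lra.
Qed.

(** From [y / 4 <= expR (y / 4)]. The fourth power is what the lower law needs: its [y] is at least
    a multiple of sqrt [n], and the bound is then summable. *)
Lemma expRN_le y : 0 < y -> expR (- y) <= 256 / y ^+ 4.
Proof.
move=> y0.
have h : y / 4 <= expR (y / 4) by have := @expR_ge1Dx R (y / 4); lra.
have h4 : (y / 4) ^+ 4 <= expR y.
  have -> : expR y = expR (y / 4) ^+ 4.
    by rewrite -expRM_natl; congr expR; field.
  by rewrite lerXn2r ?nnegrE ?expR_ge0 // divr_ge0 // ltW.
have -> : 256 / y ^+ 4 = ((y / 4) ^+ 4)^-1 by field; rewrite gt_eqF.
by rewrite expRN lef_pV2 ?posrE ?expR_gt0 // exprn_gt0 // divr_gt0.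
Qed.

Lemma sum_cf_weight_le1 N : \sum_(n < N) cf_weight n <= 1.
Proof.
case: N => [|N]; first by rewrite big_ord0.
suff -> : \sum_(n < N.+1) cf_weight n = 1 - N.+1%:R^-1 by rewrite gerBl invr_ge0.
elim: N => [|N IH]; first by rewrite big_ord1 /cf_weight mul0n invr0 invr1 subrr.
by rewrite big_ord_recr /= IH cf_weightE // addrA subrK.
Qed.

Section Laplace.
Variables (L : nat) (t : R).
Hypotheses (t0 : 0 <= t) (tL : t * L%:R <= 1).

Let w p : R := 1 - expR (- (t * trunc_prime L p)).

Let scaled_trunc_ge0 p : 0 <= t * trunc_prime L p.
Proof. by rewrite mulr_ge0 // trunc_prime_ge0. Qed.

Let w0 p : 0 <= w p.
Proof. by rewrite subr_ge0 -[leRHS]expR0 ler_expR oppr_le0. Qed.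

Let w1 p : w p <= 1.
Proof. by rewrite gerBl expR_ge0. Qed.

Let wout p : (L.+1 <= p)%N -> w p = 0.
Proof. by move=> Lp; rewrite /w trunc_prime_out // mulr0 oppr0 expR0 subrr. Qed.

Let wt p : t * trunc_prime L p / 2 <= w p.
Proof.
apply: one_sub_expRN (scaled_trunc_ge0 p) _; apply: le_trans tL.
rewrite ler_wpM2l // /trunc_prime; case: ifP => // /andP[_ pL].
by rewrite ler_nat.
Qed.

Let laplace n x := \prod_(k < n) (1 - w (cfdigit k.+1 x)).

Let bounded_adapted_laplace n : bounded_adapted n (laplace n).
Proof.
elim: n => [|n IH]; rewrite /laplace.
  by under eq_fun do rewrite big_ord0; exact: bounded_adapted_cst.
under eq_fun do rewrite big_ord_recr /=.
apply: bounded_adaptedM; first exact: bounded_adapted_le (leqnSn n) IH.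
apply: bounded_adaptedB; first exact: bounded_adapted_cst.
exact: (bounded_adapted_digit_fun (ltnSn n) wout).
Qed.

Let laplace_ge0 n x : 0 <= laplace n x.
Proof. by apply: prodr_ge0 => k _; rewrite subr_ge0. Qed.

(** The conditional mean of [w] at the last digit is at least half of the sum of
    [w p * cf_weight p], and [w p] is at least half of the scaled truncated digit because
    [t * L <= 1]. The two halves make the 4, and [1 - s <= expR (- s)] closes the step. *)
Let expect_laplace n : expect (laplace n) <= expR (- (t * prime_mean L / 4)) ^+ n.
Proof.
elim: n => [|n IH].
  rewrite expr0 -[leRHS](@expect_cst R).
  apply: (@expect_le _ 0 0); [exact: bounded_adapted_laplace|exact: bounded_adapted_cst|].
  by move=> x _; rewrite /laplace big_ord0.
have bl := bounded_adapted_laplace n.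
have bw : bounded_adapted n.+1 (fun x => laplace n x * w (cfdigit n.+1 x)).
  apply: bounded_adaptedM; first exact: bounded_adapted_le (leqnSn n) bl.
  exact: (bounded_adapted_digit_fun (ltnSn n) wout).
have -> : expect (laplace n.+1) = expect (laplace n) - expect (fun x => laplace n x * w (cfdigit n.+1 x)).
  rewrite -(expectB bl bw); apply: eq_expect => x _.
  by rewrite /laplace big_ord_recr /= mulrBr mulr1.
have /andP[h _] := expect_digit_fun bl (fun x _ => laplace_ge0 n x) w0 wout.
have hw : t * prime_mean L / 2 <= \sum_(p < L.+1) w p * cf_weight p.
  rewrite -sum_trunc_prime mulr_sumr mulr_suml; apply: ler_sum => p _.
  by have := ler_wpM2r (cf_weight_ge0 p) (wt p); lra.
have e0 : 0 <= expect (laplace n) by apply: expect_ge0.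
have h2 : t * prime_mean L / 4 * expect (laplace n) <= expect (fun x => laplace n x * w (cfdigit n.+1 x)).
  apply: le_trans h; rewrite ler_wpM2r //; lra.
have h3 := @expR_ge1Dx R (- (t * prime_mean L / 4)).
rewrite exprSr; apply: le_trans (_ : expect (laplace n) * expR (- (t * prime_mean L / 4)) <= _).
  by have := ler_wpM2l e0 h3; lra.
by rewrite ler_wpM2r ?expR_ge0.
Qed.

(** Exponential Markov inequality: [expR (t * s) * laplace n] dominates the indicator, since
    truncation only lowers the sum. *)
Lemma psum_le_prob n s : expect (fun x => ((psum n.+1 x)%:R <= s)%R%:R) <=
  expR (t * s - n%:R * (t * prime_mean L / 4)).
Proof.
have -> : expR (t * s - n%:R * (t * prime_mean L / 4)) =
    expR (t * s) * expR (- (t * prime_mean L / 4)) ^+ n.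
  by rewrite -expRM_natl -expRD mulrN.
apply: le_trans (ler_wpM2l (expR_ge0 _) (expect_laplace n)).
rewrite -(expectZ _ (bounded_adapted_laplace n)).
have aps : adapted n (fun x => (psum n.+1 x)%:R <= s).
  exact: (adapted_comp (fun q => q%:R <= s) (@adapted_psum R n)).
apply: (@expect_le _ n n); first exact: bounded_adapted_bool.
  by apply: bounded_adaptedM; [exact: bounded_adapted_cst|exact: bounded_adapted_laplace].
move=> x _; case: (leP (psum n.+1 x)%:R s) => [ps|_] /=; last first.
  by rewrite mulr_ge0 ?expR_ge0.
have -> : laplace n x = expR (- (t * \sum_(k < n) trunc_prime L (cfdigit k.+1 x))).
  rewrite mulr_sumr -sumrN expR_sum; apply: eq_bigr => k _.
  by rewrite /w subKr.
rewrite -expRD -[leLHS]expR0 ler_expR -mulrBr mulr_ge0 // subr_ge0.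
apply: le_trans ps; rewrite psumS natr_sum; apply: ler_sum => k _.
by rewrite /trunc_prime /pdigit; case: (prime _) => //=; case: ifP.
Qed.

End Laplace.

(** A truncation level [Lw n] of at most sqrt [n] can still have a mean of order log log [n], while
    [t = 1 / Lw n] makes [t * n] at least sqrt [n]. The exponent is then below a negative multiple
    of sqrt [n], so the exceptional probabilities are summable. *)
Lemma psum_lower (c1 : R) (n0 : nat) (Lw : nat -> nat) : 0 < c1 ->
  (forall n, (n0 <= n)%N -> (0 < Lw n)%N /\ (Lw n ^ 2 <= n)%N) ->
  (forall n, (n0 <= n)%N -> c1 * lnln n <= prime_mean (Lw n)) ->
  mu.-negligible (Om `&` [set x | forall N, exists n, (N <= n)%N /\
    (psum n.+1 x)%:R <= c1 / 8 * nlnln n]).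
Proof.
move=> c10 HL Hm.
pose A n := Om `&` [set x | (n0 < n)%N && ((psum n.+1 x)%:R <= c1 / 8 * nlnln n)].
have aA n : adapted n (fun x => (n0 < n)%N && ((psum n.+1 x)%:R <= c1 / 8 * nlnln n)).
  exact: (adapted_comp (fun q => (n0 < n)%N && (q%:R <= c1 / 8 * nlnln n)) (@adapted_psum R n)).
have d0 : 0 < c1 / 16 by lra.
set d := c1 / 16 in d0.
(* 256 comes from the quartic bound on the exponential, and the remaining 2 from [n + 1 <= 2 * n]
   when [1 / n^2] is compared with [cf_weight n]. *)
pose C : R := 512 / d ^+ 4.
have C0 : 0 <= C by apply: divr_ge0; [exact: ler0n|apply: exprn_ge0; exact: ltW].
have Ab n : (mu (A n) <= (C * cf_weight n)%:E)%E.
  rewrite (measure_adapted (aA n)) lee_fin.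
  have [nn0|n0n] /= := leqP n n0.
    by rewrite expect_cst mulr_ge0 // cf_weight_ge0.
  have [L0 Ln] := HL n (ltnW n0n).
  have LR : 0 < (Lw n)%:R :> R by rewrite ltr0n.
  have np : (0 < n)%N by apply: leq_ltn_trans n0n.
  have nR : 0 < n%:R :> R by rewrite ltr0n.
  set t : R := (Lw n)%:R^-1.
  have t0 : 0 < t by rewrite invr_gt0.
  have tL : t * (Lw n)%:R <= 1 by rewrite mulVf // gt_eqF.
  apply: le_trans (psum_le_prob (ltW t0) tL n _) _.
  set y := t * n%:R * d.
  have y0 : 0 < y by rewrite !mulr_gt0.
  apply: (@le_trans _ _ (expR (- y))).
    rewrite ler_expR /y /nlnln /d.
    have h1 : t * n%:R * (c1 * lnln n) <= t * n%:R * prime_mean (Lw n).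
      by apply: ler_wpM2l; [rewrite mulr_ge0 // ltW|apply: Hm; apply: ltnW].
    have h2 : t * n%:R * c1 * 2^-1 <= t * n%:R * c1 * lnln n.
      by apply: ler_wpM2l; [rewrite !mulr_ge0 // ltW|apply: lnln_ge_half].
    lra.
  apply: le_trans (expRN_le y0) _.
  have tn : n%:R <= (t * n%:R) ^+ 2.
    have -> : (t * n%:R) ^+ 2 = n%:R * (n%:R / (Lw n ^ 2)%:R).
      by rewrite /t natrX; field; rewrite gt_eqF.
    rewrite -[leLHS]mulr1 ler_wpM2l // ler_pdivlMr ?ltr0n ?expn_gt0 ?L0 // mul1r.
    by rewrite ler_nat.
  have y4 : n%:R ^+ 2 * d ^+ 4 <= y ^+ 4.
    rewrite /y [in leRHS]exprMn ler_wpM2r ?exprn_ge0 ?(ltW d0) //.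
    by rewrite (exprM _ 2 2) lerXn2r ?nnegrE ?exprn_ge0 ?mulr_ge0 // ltW.
  have z0 : 0 < n%:R ^+ 2 * d ^+ 4 by rewrite mulr_gt0 ?exprn_gt0.
  apply: (@le_trans _ _ (256 / (n%:R ^+ 2 * d ^+ 4))).
    by rewrite ler_wpM2l // lef_pV2 ?posrE ?exprn_gt0.
  have -> : 256 / (n%:R ^+ 2 * d ^+ 4) = C / 2 / n%:R ^+ 2.
    by rewrite /C; field; rewrite (gt_eqF nR) (gt_eqF d0).
  rewrite -mulrA ler_wpM2l // /cf_weight natrM -invfM lef_pV2 ?posrE ?mulr_gt0 ?exprn_gt0 ?ltr0n //.
  have : 1 <= n%:R :> R by rewrite ler1n.
  rewrite -natr1 expr2; nra.
have neg := @borel_cantelli R A (fun n => C * cf_weight n) C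
  (fun n => measurable_adapted_set (aA n)) Ab.
apply: negligibleS (neg _) => [x [xO Hx] N _ /=|N].
  have [n [Nn pn]] := Hx (maxn N n0.+1).
  exists n; first by apply: leq_trans Nn; apply: leq_maxl.
  by split=> //=; rewrite pn andbT; apply: leq_trans Nn; apply: leq_maxr.
by rewrite -mulr_sumr -[leRHS]mulr1 ler_wpM2l // sum_cf_weight_le1.
Qed.

End LowerLaw.

(** * Chebyshev bounds *)

Section Chebyshev.
Set Implicit Arguments.
Unset Strict Implicit.
Implicit Types (n m k p a b j : nat).
Local Open Scope nat_scope.

Definition nprimes a b := \sum_(a <= p < b | prime p) 1.

Lemma nprimes_cat a b m : a <= m -> m <= b -> nprimes a b = nprimes a m + nprimes m b.
Proof. exact: big_cat_nat. Qed.

Lemma nprimes_le a b : nprimes a b <= b - a.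
Proof.
rewrite /nprimes big_mkcond -[leqRHS]muln1 -sum_nat_const_nat.
by apply: leq_sum => p _; case: ifP.
Qed.

Lemma bin_le_exp2 n k : 'C(n, k) <= 2 ^ n.
Proof.
elim: n k => [|n IH] [|k]; rewrite ?bin0 ?expn_gt0 // binS expnS mul2n -addnn.
exact: leq_add.
Qed.

Lemma exp2_le_central n : 2 ^ n <= 'C(2 * n, n).
Proof.
elim: n => // n IH; rewrite mulnS add2n binS binS.
have -> : 'C((2 * n).+1, n) = 'C(2 * n, n) + 'C((2 * n).+1, n) - 'C(2 * n, n) by rewrite addKn.
have h : 'C(2 * n, n) <= 'C((2 * n).+1, n).
  by case: n {IH} => // n; rewrite [leqRHS]binS leq_addr.
rewrite expnS; lia.
Qed.

Lemma divn_double n d : (2 * n) %/ d <= 2 * (n %/ d) + (0 < d <= 2 * n).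
Proof.
case: (posnP d) => [->|d0]; first by rewrite !divn0.
have [d2n|n2d] := leqP d (2 * n); last by rewrite divn_small.
by rewrite /= mul2n -addnn; have := leq_divDl d n n; lia.
Qed.

(** By Legendre's formula the power [p^k] contributes [(2n) %/ p^k - 2 * (n %/ p^k)], which is at
    most 1, and 0 once [p^k > 2n]. Hence each prime power in the central binomial coefficient is at
    most [2n]. *)
Lemma logn_central n p : 0 < n -> prime p -> logn p 'C(2 * n, n) <= trunc_log p (2 * n).
Proof.
move=> n0 pp; have p1 := prime_gt1 pp.
have nn : n <= 2 * n by rewrite leq_pmull.
have := congr1 (logn p) (bin_fact nn).
have -> : 2 * n - n = n by lia.
rewrite !lognM ?fact_gt0 ?muln_gt0 ?bin_gt0 ?fact_gt0 // !logn_fact //.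
have ext : \sum_(1 <= k < n.+1) n %/ p ^ k = \sum_(1 <= k < (2 * n).+1) n %/ p ^ k.
  rewrite [RHS](@big_cat_nat _ _ _ n.+1) //= [X in _ = _ + X]big1_seq ?addn0 // => k.
  rewrite mem_index_iota => /andP[_ /andP[nk _]].
  by rewrite divn_small //; apply: leq_trans nk _; apply: ltnW; apply: ltn_expl.
rewrite ext => e.
have : \sum_(1 <= k < (2 * n).+1) (2 * n) %/ p ^ k <=
    \sum_(1 <= k < (2 * n).+1) (2 * (n %/ p ^ k) + (p ^ k <= 2 * n)).
  apply: leq_sum => k _; have := divn_double n (p ^ k).
  by rewrite expn_gt0 (ltnW p1).
rewrite -e big_split /= -big_distrr /=.
have : \sum_(1 <= k < (2 * n).+1) (p ^ k <= 2 * n) <= trunc_log p (2 * n).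
  apply: (@leq_trans (\sum_(1 <= k < (2 * n).+1 | k < (trunc_log p (2 * n)).+1) 1)).
    rewrite [leqRHS]big_mkcond; apply: leq_sum => k _.
    case: (leqP (p ^ k)) => //= h; first by rewrite ltnS (trunc_log_max p1 h).
  have tl : (trunc_log p (2 * n)).+1 <= (2 * n).+1.
    rewrite ltnS; apply: leq_trans (trunc_logP p1 _); last by rewrite muln_gt0.
    exact/ltnW/ltn_expl.
  by rewrite -(big_nat_widen _ _ _ xpredT _ tl) sum_nat_const_nat; lia.
lia.
Qed.

Lemma central_factor n m : 'C(2 * n, n) <= m ->
  'C(2 * n, n) = \prod_(0 <= p < m.+1) p ^ logn p 'C(2 * n, n).
Proof.
move=> Cm; have C0 : 0 < 'C(2 * n, n) by rewrite bin_gt0 leq_pmull.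
by rewrite -[LHS]partnT // (widen_partn _ Cm).
Qed.

Lemma prod_cond_exp a m (P : pred nat) :
  \prod_(0 <= p < m) (if P p then a else 1) = a ^ \sum_(0 <= p < m | P p) 1.
Proof.
rewrite expn_sum [RHS]big_mkcond; apply: eq_bigr => p _; by case: (P p).
Qed.

Lemma nprimes_cond a b m : b <= m ->
  \sum_(0 <= p < m | prime p && (a <= p < b)) 1 = nprimes a b.
Proof.
move=> bm; rewrite /nprimes (big_nat_widenl a 0) // (big_nat_widen 0 b m) //.
by apply: eq_bigl => p; rewrite andbA.
Qed.

Lemma prime_double n : 2 <= n -> ~~ prime (2 * n).
Proof.
by move=> n2; apply/negP => pn; have := @dvdn_prime2 2 (2 * n) isT pn; rewrite dvdn_mulr // => /esym/eqP; lia.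
Qed.

(** With [n = 2^m], every prime between [n] and [2n] divides the central binomial coefficient, which
    is at most [2^(2n)]; so [n] to the number of these primes is at most [2^(2n)], and exponents of
    2 are compared. For [m >= 2] the end point [n] is not itself prime. *)
Lemma nprimes_dyadic_upper m : 2 <= m -> m * nprimes (2 ^ m) (2 ^ m.+1) <= 2 ^ m.+1.
Proof.
move=> m2; set n := 2 ^ m; have n0 : 0 < n by rewrite expn_gt0.
have e2n : 2 ^ m.+1 = 2 * n by rewrite expnS.
rewrite -(leq_exp2l _ _ (isT : 1 < 2)) expnM -/n e2n.
apply: leq_trans (bin_le_exp2 (2 * n) n).
set M := maxn 'C(2 * n, n) (2 * n).
rewrite (@central_factor n M) ?leq_maxl //.
rewrite -(@nprimes_cond n (2 * n) M.+1); last first.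
  by apply: leq_trans (leqnSn _); apply: leq_maxr.
rewrite -prod_cond_exp; apply: leq_prod => p _.
case: ifP => [/andP[pp /andP[np p2n]]|_]; last first.
  by case: p => [|p]; rewrite ?expn_gt0 // lognE /=.
have nltp : n < p.
  rewrite ltn_neqAle np andbT; apply/eqP => e; move: pp; rewrite -e /n.
  case: m m2 {n0 e2n M np p2n e} @n => [|m] //= m1.
  by rewrite expnS (negPf (prime_double _)) // -[2]/(2 ^ 1) leq_exp2l.
apply: (@leq_trans (p ^ 1)); first by rewrite expn1 ltnW.
rewrite leq_exp2l ?prime_gt1 // -pfactor_dvdn ?bin_gt0 ?leq_pmull // expn1.
have : p %| (2 * n)`! by rewrite dvdn_fact // prime_gt0 // ltnW.
rewrite -(@bin_fact (2 * n) n) ?leq_pmull //.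
have -> : 2 * n - n = n by lia.
have nf : ~~ (p %| n`!).
  apply/negP; move: nltp; elim: (n) => [|k IH] kp.
    by rewrite fact0 dvdn1 => /eqP p1; move: pp; rewrite p1.
  rewrite factS Euclid_dvdM // => /orP[/dvdn_leq|]; first by lia.
  by apply: IH; apply: ltnW.
by rewrite !Euclid_dvdM // (negPf nf) !orbF.
Qed.

(** The central binomial coefficient is at least [2^n] and is a product, over the primes up to [2n],
    of prime powers each at most [2n = 2^(m+1)]. *)
Lemma nprimes_dyadic_lower m : 1 <= m -> 2 ^ m <= m.+1 * nprimes 0 (2 ^ m.+1).
Proof.
move=> m1; set n := 2 ^ m; have n0 : 0 < n by rewrite expn_gt0.
have e2n : 2 ^ m.+1 = 2 * n by rewrite expnS.
rewrite -(leq_exp2l _ _ (isT : 1 < 2)) expnM e2n.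
apply: leq_trans (exp2_le_central n) _.
set M := maxn 'C(2 * n, n) (2 * n).
rewrite {1}(@central_factor n M) ?leq_maxl //.
rewrite -(@nprimes_cond 0 (2 * n) M.+1); last first.
  by apply: leq_trans (leqnSn _); apply: leq_maxr.
rewrite -prod_cond_exp; apply: leq_prod => p _ /=.
have [pp|npp] := boolP (prime p); last first.
  by rewrite lognE (negPf npp).
have p1 := prime_gt1 pp.
case: ltnP => /= p2n.
  apply: leq_trans (trunc_logP p1 _); last by rewrite muln_gt0.
  by rewrite leq_exp2l // logn_central.
have : logn p 'C(2 * n, n) <= trunc_log p (2 * n) by apply: logn_central.
have [e|pne] := eqVneq p (2 * n).
  by move: pp; rewrite e (negPf (prime_double _)) // -[2]/(2 ^ 1) leq_exp2l.
have -> : trunc_log p (2 * n) = 0.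
  by apply/eqP; rewrite trunc_log_eq0; apply/orP; right; lia.
by rewrite leqn0 => /eqP ->.
Qed.

(** The 4 from the primes below [2^m] and the 2 from the next dyadic interval must fit into 8 after
    multiplication by [(m + 1) / m], which holds from [m = 3] on. *)
Lemma nprimes_upper m : 3 <= m -> m * nprimes 0 (2 ^ m) <= 2 ^ m.+2.
Proof.
elim: m => // m IH; rewrite leq_eqVlt => /orP[/eqP[<-]|].
  by apply: leq_trans (leq_mul (leqnn 3) (nprimes_le 0 (2 ^ 3))) _.
rewrite ltnS => m3; have {}IH := IH m3.
have up := @nprimes_dyadic_upper m (ltnW m3).
rewrite (@nprimes_cat 0 (2 ^ m.+1) (2 ^ m)) //; last by rewrite leq_exp2l.
move: IH up; rewrite !expnS; set x := nprimes _ _; set y := nprimes _ _.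
set z := 2 ^ m => h1 h2; nia.
Qed.

(** The ratio 32 originates here: the lower bound up to [32^(j+1)] must beat the upper bound up to
    [32^j]. With [m = 5 * j] the former is [16 * 2^m / (m + 5) >= 8 * 2^m / m], the latter
    [4 * 2^m / m]. The same computation with ratio 16 leaves nothing at [j = 1]. *)
Lemma nprimes_block j : 1 <= j ->
  4 * 32 ^ j <= 5 * j * nprimes (32 ^ j) (32 ^ j.+1) <= 128 * 32 ^ j.
Proof.
move=> j1; pose m := 5 * j.
have e1 i : 32 ^ i = 2 ^ (5 * i) by rewrite expnM.
rewrite !e1 mulnS addnC -/m.
have m5 : 5 <= m by rewrite /m; lia.
have cat : nprimes 0 (2 ^ (m + 5)) = nprimes 0 (2 ^ m) + nprimes (2 ^ m) (2 ^ (m + 5)).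
  by apply: nprimes_cat => //; rewrite leq_exp2l ?leq_addr.
have u1 : m * nprimes 0 (2 ^ m) <= 4 * 2 ^ m.
  by apply: leq_trans (@nprimes_upper m _) _; [lia|rewrite !expnS; lia].
have u2 : (m + 5) * nprimes 0 (2 ^ (m + 5)) <= 128 * 2 ^ m.
  by apply: leq_trans (@nprimes_upper (m + 5) _) _; [lia|rewrite !expnS expnD; lia].
have l1 : 16 * 2 ^ m <= (m + 5) * nprimes 0 (2 ^ (m + 5)).
  have := @nprimes_dyadic_lower (m + 4); rewrite -addnS expnD mulnC; apply; lia.
move: cat u1 u2 l1; set x := nprimes 0 _; set y := nprimes 0 _; set w := nprimes (2 ^ m) _.
set z := 2 ^ m => -> {x} h1 h2 h3; apply/andP; split; nia.
Qed.

End Chebyshev.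

(** * Growth of the truncated mean of the prime digits *)

Section PrimeMean.
Context {R : realType}.
Set Implicit Arguments.
Unset Strict Implicit.
Implicit Types (a b c : R) (n p k j J T N L : nat).
Local Notation cf_weight := (@cf_weight R).
Local Notation lnln := (@lnln R).
Local Notation prime_mean := (@prime_mean R).

(** The constants are those of the block count, rounded: [4/5] down to 1/2 here, [128/5] up to 26 in
    the upper version. *)
Lemma block_sum_lower (f : nat -> R) lo j : (0 < j)%N -> 0 <= lo ->
  (forall p, prime p -> (32 ^ j <= p < 32 ^ j.+1)%N -> lo <= f p) ->
  lo * (2^-1 * (32 ^ j)%:R / j%:R) <= \sum_(32 ^ j <= p < 32 ^ j.+1 | prime p) f p.
Proof.
move=> j0 lo0 lof.
apply: (@le_trans _ _ (lo * (nprimes (32 ^ j) (32 ^ j.+1))%:R)).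
  rewrite ler_wpM2l // ler_pdivrMr ?ltr0n //.
  have /andP[+ _] := @nprimes_block j j0.
  rewrite -(ler_nat R) !natrM.
  by have := ler0n R (32 ^ j); lra.
rewrite /nprimes natr_sum mulr_sumr big_seq_cond [leRHS]big_seq_cond.
apply: ler_sum => p; rewrite mem_index_iota => /andP[pj pp].
by rewrite mulr1 lof.
Qed.

Lemma block_sum_upper (f : nat -> R) hi j : (0 < j)%N -> 0 <= hi ->
  (forall p, prime p -> (32 ^ j <= p < 32 ^ j.+1)%N -> f p <= hi) ->
  \sum_(32 ^ j <= p < 32 ^ j.+1 | prime p) f p <= hi * (26 * (32 ^ j)%:R / j%:R).
Proof.
move=> j0 hi0 fhi.
apply: (@le_trans _ _ (hi * (nprimes (32 ^ j) (32 ^ j.+1))%:R)); last first.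
  rewrite ler_wpM2l // ler_pdivlMr ?ltr0n //.
  have /andP[_] := @nprimes_block j j0.
  rewrite -(ler_nat R) !natrM.
  by have := ler0n R (32 ^ j); lra.
rewrite /nprimes natr_sum mulr_sumr big_seq_cond [leRHS]big_seq_cond.
apply: ler_sum => p; rewrite mem_index_iota => /andP[pj pp].
by rewrite mulr1 fhi.
Qed.

Lemma block_sums (f : nat -> R) J T : (J <= T)%N ->
  \sum_(32 ^ J <= p < 32 ^ T | prime p) f p =
  \sum_(J <= j < T) \sum_(32 ^ j <= p < 32 ^ j.+1 | prime p) f p.
Proof.
elim: T => [|T IH]; first by rewrite leqn0 => /eqP ->; rewrite !big_geq.
rewrite leq_eqVlt => /orP[/eqP ->|]; first by rewrite !big_geq.
rewrite ltnS => JT; rewrite big_nat_recr //= -IH //.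
by rewrite (@big_cat_nat _ _ _ (32 ^ T)%N) //= leq_exp2l.
Qed.

Lemma natr_mul_cf_weight p : (0 < p)%N -> p%:R * cf_weight p = p.+1%:R^-1.
Proof.
move=> p0; rewrite /cf_weight natrM invfM mulrA mulfV ?mul1r //.
by rewrite pnatr_eq0 -lt0n.
Qed.

Lemma harmonic_lower J : (0 < J)%N -> ln J%:R <= \sum_(1 <= j < J) (j%:R^-1 : R).
Proof.
elim: J => // -[|J] IH _; first by rewrite big_geq // ln1.
rewrite big_nat_recr //=; apply: le_trans (lerD (IH isT) (lexx _)).
have J0 : 0 < J.+1%:R :> R by rewrite ltr0n.
have -> : J.+2%:R = J.+1%:R * (1 + J.+1%:R^-1) :> R.
  by rewrite mulrDr mulr1 mulfV ?gt_eqF // natr1.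
rewrite lnM ?posrE ?addr_gt0 ?invr_gt0 // lerD2l.
by apply: le_ln1Dx; apply: lt_le_trans (_ : 0 <= _); rewrite ?ltrN10 // invr_ge0 ltW.
Qed.

Lemma harmonic_upper T : (0 < T)%N -> \sum_(1 <= j < T.+1) (j%:R^-1 : R) <= 1 + ln T%:R.
Proof.
elim: T => // -[|T] IH _; first by rewrite big_nat1 ln1 invr1 addr0.
rewrite big_nat_recr //=; apply: le_trans (lerD (IH isT) (lexx _)) _.
rewrite -addrA lerD2l.
have T0 : 0 < T.+1%:R :> R by rewrite ltr0n.
have T20 : 0 < T.+2%:R :> R by rewrite ltr0n.
have e : T.+2%:R = T.+1%:R * (T.+2%:R / T.+1%:R) :> R by rewrite mulrCA mulfV ?mulr1 // gt_eqF.
rewrite {2}e lnM ?posrE ?divr_gt0 // lerD2l.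
apply: le_trans (ln_ge_1BV _); last by rewrite divr_gt0.
rewrite invf_div -[T.+2%:R]natr1 in T20 *.
have -> : 1 - T.+1%:R / (T.+1%:R + 1) = (T.+1%:R + 1)^-1 :> R by field; rewrite gt_eqF.
by [].
Qed.

(** Block [j] contributes at least [1 / (64 * j)]: each term is [1 / (p + 1) >= 1 / (32 * 32^j)],
    and there are at least [32^j / (2 * j)] primes. *)
Lemma prime_mean_lower J : (0 < J)%N -> ln J%:R / 64 <= prime_mean (32 ^ J).
Proof.
move=> J0.
apply: (@le_trans _ _ (\sum_(32 ^ 1 <= p < 32 ^ J | prime p) p%:R * cf_weight p)); last first.
  rewrite /prime_mean -(big_mkord (fun p => prime p) (fun p => p%:R * cf_weight p)).
  rewrite [leRHS](@big_cat_nat _ _ _ (32 ^ 1)) //=; last first.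
    by rewrite ltnW // ltnS leq_exp2l.
  rewrite [X in _ <= _ + X](@big_cat_nat _ _ _ (32 ^ J)) ?leq_exp2l //=.
  rewrite addrCA lerDl addr_ge0 //; apply: sumr_ge0 => p _; by rewrite mulr_ge0 ?cf_weight_ge0.
rewrite block_sums // ler_pdivrMr //; apply: le_trans (harmonic_lower J0) _.
rewrite mulr_suml big_seq_cond [leRHS]big_seq_cond; apply: ler_sum => j.
rewrite mem_index_iota andbT => /andP[j1 jJ].
have p32 : 0 < (32 ^ j)%:R :> R by rewrite ltr0n expn_gt0.
have e : (32 * (32 ^ j)%:R)^-1 * (2^-1 * (32 ^ j)%:R / j%:R) = j%:R^-1 / 64 :> R.
  have jR : j%:R != 0 :> R by rewrite pnatr_eq0 -lt0n.
  by move: p32 jR; move: (32 ^ j)%:R j%:R => z w z0 w0; field; rewrite w0 gt_eqF.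
have h := @block_sum_lower (fun p => p%:R * cf_weight p) (32 * (32 ^ j)%:R)^-1 j j1.
rewrite -ler_pdivrMr // -e; apply: h => [|p pp /andP[_ pj]].
  by rewrite invr_ge0 mulr_ge0.
rewrite natr_mul_cf_weight ?prime_gt0 // lef_pV2 ?posrE ?mulr_gt0 ?ltr0n ?expn_gt0 //.
by rewrite -natrM ler_nat -expnS.
Qed.

(** 58 = 32 + 26: the terms below 32 are at most 1 each, and the blocks give 26 times a harmonic
    sum, at most [1 + ln T]. *)
Lemma prime_mean_upper L T : (0 < T)%N -> (L < 32 ^ T)%N -> prime_mean L <= 58 + 26 * ln T%:R.
Proof.
move=> T0 LT.
have pw p : 0 <= p%:R * cf_weight p by rewrite mulr_ge0 ?cf_weight_ge0.
apply: (@le_trans _ _ (\sum_(0 <= p < 32 ^ T | prime p) p%:R * cf_weight p)).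
  rewrite /prime_mean -(big_mkord (fun p => prime p) (fun p => p%:R * cf_weight p)).
  rewrite [leRHS](@big_cat_nat _ _ _ L.+1) //= lerDl.
  exact: sumr_ge0.
rewrite (@big_cat_nat _ _ _ (32 ^ 1)) ?leq_exp2l //= block_sums //.
have h1 : \sum_(0 <= p < 32 ^ 1 | prime p) p%:R * cf_weight p <= 32.
  rewrite expn1; apply: (@le_trans _ _ (\sum_(0 <= p < 32) 1)); last first.
    by rewrite sumr_const_nat subn0.
  rewrite big_mkcond; apply: ler_sum => p _; case: ifP => // pp.
  by rewrite natr_mul_cf_weight ?prime_gt0 // invf_le1 // ler1n.
have h2 : \sum_(1 <= j < T) \sum_(32 ^ j <= p < 32 ^ j.+1 | prime p) p%:R * cf_weight p <=
    \sum_(1 <= j < T) 26 * j%:R^-1.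
  rewrite big_seq_cond [leRHS]big_seq_cond; apply: ler_sum => j.
  rewrite mem_index_iota andbT => /andP[j1 jJ].
  have p32 : 0 < (32 ^ j)%:R :> R by rewrite ltr0n expn_gt0.
  have e : ((32 ^ j)%:R)^-1 * (26 * (32 ^ j)%:R / j%:R) = 26 * j%:R^-1 :> R.
    have jR : j%:R != 0 :> R by rewrite pnatr_eq0 -lt0n.
    by move: p32 jR; move: (32 ^ j)%:R j%:R => z w z0 w0; field; rewrite w0 gt_eqF.
  rewrite -e; apply: block_sum_upper => // p pp /andP[pj _].
  rewrite natr_mul_cf_weight ?prime_gt0 // lef_pV2 ?posrE ?ltr0n ?expn_gt0 //.
  by rewrite ler_nat ltnW.
rewrite -mulr_sumr in h2.
have h3 : \sum_(1 <= j < T) j%:R^-1 <= \sum_(1 <= j < T.+1) (j%:R^-1 : R).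
  by rewrite big_nat_recr //= lerDl invr_ge0.
have h4 := harmonic_upper T0.
lra.
Qed.

Lemma ln2_le1 : ln 2 <= (1 : R).
Proof. by have := @le_ln1Dx R 1; rewrite (_ : 1 + 1 = 2) //; apply; lra. Qed.

Lemma ln32E : ln 32 = ln 2 * 5 :> R.
Proof.
have -> : (32 : R) = 2 ^+ 5 by rewrite -natrX.
by rewrite lnXn // -[_ *+ 5]mulr_natr.
Qed.

Lemma lnXn32 k : ln (32 ^ k)%:R = k%:R * ln 32 :> R.
Proof. by rewrite natrX lnXn ?ltr0n // mulr_natl. Qed.

Lemma ln_shift_ge2 n : 2 <= ln (n + 16)%:R :> R.
Proof.
apply: le_trans ln16_ge2 _.
by rewrite ler_ln ?posrE ?ltr0n ?addn_gt0 ?orbT // ler_nat leq_addl.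
Qed.

(** 194 = 168 + 26: the bound is at most [84 + 26 * lnln n], and [84 <= 168 * lnln n] because
    [lnln n >= 1/2]. *)
Lemma prime_mean_le_lnln n : (0 < n)%N -> prime_mean (16 * n) <= 194 * lnln n.
Proof.
move=> n0; pose t := trunc_log 32 n; pose T := t.+2.
have LT : (16 * n < 32 ^ T)%N.
  have h : (n < 32 ^ t.+1)%N by apply: trunc_log_ltn.
  by rewrite /T expnS; lia.
apply: le_trans (prime_mean_upper (isT : (0 < T)%N) LT) _.
have g2 := ln_shift_ge2 n.
have tl : t%:R <= ln (n + 16)%:R :> R.
  apply: (@le_trans _ _ (ln (32 ^ t)%:R)).
    by rewrite lnXn32 ler_peMr // ln32E; have := @ln2_ge_half R; lra.
  rewrite ler_ln ?posrE ?ltr0n ?expn_gt0 ?addn_gt0 ?n0 // ler_nat.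
  by apply: leq_trans (leq_addr _ _); apply: trunc_logP.
have Tl : T%:R <= 2 * ln (n + 16)%:R :> R by rewrite /T -natr1 -natr1; lra.
have : ln T%:R <= ln (2 * ln (n + 16)%:R) :> R by rewrite ler_ln ?posrE ?ltr0n //; lra.
rewrite lnM ?posrE //; last by lra.
rewrite -/(lnln n); have := ln2_le1; have := @lnln_ge_half R n.
move: (ln T%:R) (ln 2) (lnln n) => a b c; lra.
Qed.

(** A level of at most sqrt [n], taken as an exact power of 32 so that [prime_mean_lower]
    applies. *)
Definition sqrt_level n := (32 ^ (trunc_log 32 n)./2)%N.

Lemma sqrt_level_bound n : (0 < n)%N -> (0 < sqrt_level n)%N /\ (sqrt_level n ^ 2 <= n)%N.
Proof.
move=> n0; split; first by rewrite expn_gt0.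
apply: leq_trans (@trunc_logP 32 n isT n0).
by rewrite /sqrt_level -expnM leq_exp2l // muln2 -[leqRHS]odd_double_half leq_addl.
Qed.

(** With [J] half of [trunc_log 32 n], [ln (n + 16) <= 5 * (2 * J + 3) <= J^2] for [J >= 13], so
    [lnln n <= 2 * ln J]: passing to the square root costs only a constant. *)
Lemma lnln_le_prime_mean n : (26 <= trunc_log 32 n)%N -> 128^-1 * lnln n <= prime_mean (sqrt_level n).
Proof.
set t := trunc_log 32 n => t26; pose J := t./2.
have J13 : (13 <= J)%N by rewrite (half_leq t26).
have J0 : (0 < J)%N by apply: leq_trans J13.
apply: le_trans (prime_mean_lower J0).
have t2J : (t <= J * 2 + 1)%N.
  by rewrite -[leqLHS]odd_double_half -/J -muln2 addnC leq_add2l leq_b1.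
have nt : (n + 16 <= 32 ^ t.+2)%N.
  have h : (n < 32 ^ t.+1)%N by apply: trunc_log_ltn.
  by rewrite expnS; lia.
have J13R : 13 <= J%:R :> R by rewrite (ler_nat R 13).
have h1 : ln (n + 16)%:R <= J%:R ^+ 2 :> R.
  apply: (@le_trans _ _ (ln (32 ^ t.+2)%:R)).
    by rewrite ler_ln ?posrE ?ltr0n ?expn_gt0 ?addn_gt0 ?orbT // ler_nat.
  rewrite lnXn32; apply: (@le_trans _ _ ((J%:R * 2 + 3) * 5)).
    apply: ler_pM => //; first by rewrite ln32E; have := @ln2_ge_half R; lra.
      have : t%:R <= J%:R * 2 + 1 :> R by rewrite -(ler_nat R) natrD natrM in t2J.
      by rewrite -[t.+2%:R]natr1 -[t.+1%:R]natr1; lra.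
    by rewrite ln32E; have := ln2_le1; lra.
  rewrite expr2; nra.
have g2 := ln_shift_ge2 n.
have : lnln n <= ln (J%:R ^+ 2).
  by rewrite ler_ln ?posrE ?exprn_gt0 ?ltr0n //; lra.
by rewrite lnXn ?ltr0n // -mulr_natr; lra.
Qed.

End PrimeMean.

(** * The gauge function and its integral *)

Section RegularGauge.
Context {R : realType}.
Set Implicit Arguments.
Unset Strict Implicit.
Implicit Types (z w s t a c e : R) (n m k j : nat).

(** Makes [ln (ln (g t))] positive when [g t > 3]. As [ln 3 = ln 15 - ln 5], it suffices that
    [1/6 + ... + 1/15 > 1]. *)
Lemma ln3_gt1 : 1 < ln (3 : R).
Proof.
have step k : (0 < k)%N -> ln k%:R + k.+1%:R^-1 <= ln k.+1%:R :> R.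
  move=> k0; have kR : 0 < k%:R :> R by rewrite ltr0n.
  have k1R : 0 < k%:R + 1 :> R by rewrite addr_gt0.
  have e : k.+1%:R = k%:R * (k.+1%:R / k%:R) :> R by rewrite mulrCA mulfV ?mulr1 // gt_eqF.
  rewrite [in leRHS]e lnM ?posrE ?divr_gt0 ?ltr0n // lerD2l.
  apply: le_trans (ln_ge_1BV _); last by rewrite divr_gt0 ?ltr0n.
  rewrite invf_div -natr1.
  have -> : 1 - k%:R / (k%:R + 1) = (k%:R + 1)^-1 :> R by field; rewrite gt_eqF.
  by [].
have e : ln 15 = ln 5 + ln 3 :> R.
  by rewrite -lnM ?posrE ?ltr0n // -natrM.
have s5 : ln 5 + 6^-1 <= ln 6 :> R := step 5%N isT.
have s6 : ln 6 + 7^-1 <= ln 7 :> R := step 6%N isT.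
have s7 : ln 7 + 8^-1 <= ln 8 :> R := step 7%N isT.
have s8 : ln 8 + 9^-1 <= ln 9 :> R := step 8%N isT.
have s9 : ln 9 + 10^-1 <= ln 10 :> R := step 9%N isT.
have s10 : ln 10 + 11^-1 <= ln 11 :> R := step 10%N isT.
have s11 : ln 11 + 12^-1 <= ln 12 :> R := step 11%N isT.
have s12 : ln 12 + 13^-1 <= ln 13 :> R := step 12%N isT.
have s13 : ln 13 + 14^-1 <= ln 14 :> R := step 13%N isT.
have s14 : ln 14 + 15^-1 <= ln 15 :> R := step 14%N isT.
lra.
Qed.

Lemma lnln3_gt0 : 0 < ln (ln (3 : R)).
Proof. by rewrite ln_gt0 // ln3_gt1. Qed.

Lemma lnln_ge3 z : 3 <= z -> 1 < ln z /\ ln (ln 3) <= ln (ln z).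
Proof.
move=> z3; have l3 := ln3_gt1.
have h : ln 3 <= ln z by rewrite ler_ln ?posrE //; lra.
by split; [lra|rewrite ler_ln ?posrE //; lra].
Qed.

Lemma lnln_ge3_gt0 z : 3 <= z -> 0 < ln (ln z).
Proof. by move=> /lnln_ge3[_]; apply: lt_le_trans; apply: lnln3_gt0. Qed.

(** [ln w <= (ln c + 1) * ln z], and the outer logarithm turns this factor into a summand, absorbed
    because [ln (ln z) >= ln (ln 3) > 0]. *)
Lemma lnln_le_mul c : 1 <= c -> exists2 d : R, 0 < d &
  forall z w, 3 <= z -> 3 <= w -> w <= c * z -> ln (ln w) <= d * ln (ln z).
Proof.
move=> c1; have lc0 : 0 <= ln c by rewrite ln_ge0.
have l30 := lnln3_gt0.
have llc : 0 <= ln (ln c + 1) by rewrite ln_ge0 //; lra.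
exists (ln (ln c + 1) / ln (ln 3) + 1); first by rewrite ltr_wpDl // divr_ge0 // ltW.
move=> z w z3 w3 wz.
have [lz l3z] := lnln_ge3 z3; have [lw _] := lnln_ge3 w3.
have h1 : ln w <= (ln c + 1) * ln z.
  apply: (@le_trans _ _ (ln (c * z))); first by rewrite ler_ln ?posrE ?mulr_gt0 //; lra.
  by rewrite lnM ?posrE //; [nra|lra|lra].
apply: (@le_trans _ _ (ln ((ln c + 1) * ln z))).
  by rewrite ler_ln ?posrE ?mulr_gt0 //; lra.
rewrite lnM ?posrE; [|lra|lra].
by rewrite mulrDl mul1r lerD2r mulrAC ler_pdivlMr // ler_wpM2l.
Qed.

(* The truncated count of [n] with [n lnln n <= z] is of this order. *)
Definition count_order z : R := z / ln (ln z).

Lemma count_order_gt0 z : 3 <= z -> 0 < count_order z.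
Proof. by move=> z3; rewrite divr_gt0 ?lnln_ge3_gt0 //; lra. Qed.

Lemma count_order_le c : 1 <= c -> exists2 d : R, 0 < d &
  forall z w, 3 <= z -> 3 <= w -> w <= c * z -> z <= c * w ->
    count_order z <= d * count_order w.
Proof.
move=> c1; have [d d0 H] := lnln_le_mul c1.
exists (c * d); first by rewrite mulr_gt0 //; lra.
move=> z w z3 w3 wz zw; rewrite /count_order.
have lz := lnln_ge3_gt0 z3; have lw := lnln_ge3_gt0 w3.
have -> : c * d * (w / ln (ln w)) = c * w * (d / ln (ln w)) by ring.
apply: ler_pM => //; [lra|by rewrite invr_ge0 ltW|].
by rewrite ler_pdivlMr // mulrC ler_pdivrMr // H.
Qed.

Variable g : R -> R.
Hypothesis g3 : forall t, 0 <= t -> 3 < g t.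
Hypothesis greg : forall eta : R -> R, asymp_equiv eta -> asymp_comparable (fun t => g (eta t)) g.

(** Otherwise there are pairs [(s, t)] with [t] arbitrarily large, [s / t] arbitrarily close to 1
    and the values of [g] arbitrarily far apart in ratio. A sequence of them yields an [eta] that
    sends each [t] to its [s] and fixes all other points; it satisfies [asymp_equiv] and contradicts
    the regularity of [g]. *)
Lemma gauge_uniform : exists d c T : R, [/\ 0 < d, 1 <= c, 0 < T &
  forall s t, T <= t -> `|s - t| <= d * t -> g s <= c * g t /\ g t <= c * g s].
Proof.
apply: contrapT => nH.
have bad k T : exists st : R * R, [/\ T <= st.2, 1 <= st.2, `|st.1 - st.2| <= k.+1%:R^-1 * st.2 &
    ~ (g st.1 <= k.+1%:R * g st.2 /\ g st.2 <= k.+1%:R * g st.1)].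
  apply: contrapT => nbad; apply: nH.
  exists k.+1%:R^-1, k.+1%:R, (Num.max T 1); split.
  - by rewrite invr_gt0.
  - by rewrite ler1n.
  - by rewrite lt_max ltr01 orbT.
  move=> s t; rewrite ge_max => /andP[Tt t1] st; apply: contrapT => h.
  by apply: nbad; exists (s, t).
pose f k T := sval (cid (bad k T)).
have fP k T : [/\ T <= (f k T).2, 1 <= (f k T).2, `|(f k T).1 - (f k T).2| <= k.+1%:R^-1 * (f k T).2 &
    ~ (g (f k T).1 <= k.+1%:R * g (f k T).2 /\ g (f k T).2 <= k.+1%:R * g (f k T).1)].
  exact: (svalP (cid (bad k T))).
(* Each new [t] exceeds the previous one by at least 1: the points are distinct, so [eta] is well
   defined, and they tend to infinity, so late indices pass every threshold. *)
pose st := fix st k := if k is k'.+1 then f k ((st k').2 + 1) else f 0%N 1.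
have stE k : exists T, st k = f k T by case: k => [|k]; [exists 1|exists ((st k).2 + 1)].
have st1 k : 1 <= (st k).2 by have [T ->] := stE k; case: (fP k T).
have std k : `|(st k).1 - (st k).2| <= k.+1%:R^-1 * (st k).2.
  by have [T ->] := stE k; case: (fP k T).
have stb k : ~ (g (st k).1 <= k.+1%:R * g (st k).2 /\ g (st k).2 <= k.+1%:R * g (st k).1).
  by have [T ->] := stE k; case: (fP k T).
have stS k : (st k).2 + 1 <= (st k.+1).2 by case: (fP k.+1 ((st k).2 + 1)).
have st_ge k : k%:R <= (st k).2.
  elim: k => [|k IH]; first by apply: le_trans (st1 0%N).
  by apply: le_trans (stS k); rewrite -natr1 lerD2r.
have st_lt m n : (m < n)%N -> (st m).2 < (st n).2.
  elim: n => // n IH; rewrite ltnS leq_eqVlt => /orP[/eqP ->|/IH h].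
    by have := stS n; lra.
  by have := stS n; lra.
have st_le m n : (st m).2 <= (st n).2 -> (m <= n)%N.
  by apply: contraTT; rewrite -ltnNge -ltNge; apply: st_lt.
have st_inj m n : (st m).2 = (st n).2 -> m = n.
  by move=> e; apply/eqP; rewrite eqn_leq !st_le // e.
pose eta t := if pselect (exists k, (st k).2 = t) is left h then (st (projT1 (cid h))).1 else t.
have etaE k : eta (st k).2 = (st k).1.
  rewrite /eta; case: pselect => [h|[]]; last by exists k.
  by rewrite (st_inj _ _ (projT2 (cid h))).
have eta_equiv : asymp_equiv eta.
  apply/cvgrPdist_le => /= e e0.
  pose k0 := Num.truncn e^-1.
  exists (st k0).2; split; first exact: num_real.
  move=> t tk0.
  have t0 : 0 < t by apply: lt_trans tk0; apply: lt_le_trans (st1 k0).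
  have [[k ek]|nk] := pselect (exists k, (st k).2 = t); last first.
    rewrite /eta; case: pselect => // _.
    by rewrite divff ?gt_eqF // subrr normr0 ltW.
  rewrite -ek etaE ek.
  have kk0 : (k0 <= k)%N by apply: st_le; rewrite ek ltW.
  have ke : k.+1%:R^-1 <= e.
    rewrite -[leRHS]invrK lef_pV2 ?posrE ?invr_gt0 ?ltr0n //.
    apply: le_trans (ltW (truncnS_gt e^-1)) _.
    by rewrite ler_nat ltnS.
  have -> : 1 - (st k).1 / t = (t - (st k).1) / t by field; rewrite gt_eqF.
  rewrite normrM normfV (gtr0_norm t0) ler_pdivrMr // distrC.
  have h := std k; rewrite ek in h; apply: le_trans h _.
  by rewrite ler_wpM2r // ltW.
have [c1 [c2 [c10 [c20 [M [_ HM]]]]]] := greg eta_equiv.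
pose k := maxn (Num.truncn M).+1 (maxn (Num.truncn c2).+1 (Num.truncn c1^-1).+1).
have ltk a : ((Num.truncn a).+1 <= k)%N -> a < k%:R.
  by move=> h; apply: lt_le_trans (truncnS_gt a) _; rewrite ler_nat.
have Mk : M < (st k).2 by apply: lt_le_trans (st_ge k); apply: ltk; rewrite leq_maxl.
have c2k : c2 <= k.+1%:R.
  by rewrite -natr1; have := ltk c2; rewrite !leq_max leqnn orbT => /(_ isT); lra.
have c1k : c1^-1 <= k.+1%:R.
  by rewrite -natr1; have := ltk c1^-1; rewrite !leq_max leqnn !orbT => /(_ isT); lra.
have gt0 : 0 < g (st k).2.
  have := st1 k => h; have : 3 < g (st k).2 by apply: g3; lra.
  lra.
have /andP[] := HM _ Mk; rewrite etaE ler_pdivlMr // ler_pdivrMr // => h1 h2.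
have gs0 : 0 < g (st k).1 by apply: lt_le_trans h1; rewrite mulr_gt0.
apply: (stb k); split; first by apply: le_trans h2 _; rewrite ler_wpM2r // ltW.
rewrite -ler_pdivlMl // in h1.
by apply: le_trans h1 _; rewrite ler_wpM2r // ltW.
Qed.

(** A chain of [m] steps of ratio at most [1 + d], with [(1 + d)^m >= 32] by Bernoulli's inequality,
    spans a whole block. *)
Lemma gauge_comparable : exists c T : R, [/\ 1 <= c, 1 <= T &
  forall s t, T <= t -> t <= s -> s <= 32 * t -> g s <= c * g t /\ g t <= c * g s].
Proof.
have [d [c [T [d0 c1 T0 H]]]] := gauge_uniform.
have d1 : 0 < 1 + d by lra.
have iter m s t : Num.max T 1 <= t -> t <= s -> s <= (1 + d) ^+ m * t ->
    g s <= c ^+ m * g t /\ g t <= c ^+ m * g s.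
  rewrite ge_max => /andP[Tt t1]; elim: m s => [|m IH] s ts.
    by rewrite !expr0 !mul1r => st; have -> : s = t by lra.
  rewrite exprS -mulrA => st.
  pose s' := Num.max t (s / (1 + d)).
  have ts' : t <= s' by rewrite le_max lexx.
  have s's : s' <= s by rewrite ge_max ts /= ler_pdivrMr // ler_peMr //; lra.
  have ss' : s <= (1 + d) * s' by rewrite mulrC -ler_pdivrMr // le_max lexx orbT.
  have s'm : s' <= (1 + d) ^+ m * t.
    rewrite ge_max ler_pdivrMr // [_ * (1 + d)]mulrC st andbT.
    by rewrite ler_peMl ?exprn_ege1 //; lra.
  have [h1 h2] := IH s' ts' s'm.
  have [h3 h4] : g s <= c * g s' /\ g s' <= c * g s.
    by apply: H; [lra|rewrite ger0_norm; lra].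
  have cm : 0 <= c ^+ m by rewrite exprn_ge0 //; lra.
  rewrite !exprS; split.
    by apply: le_trans h3 _; rewrite -mulrA ler_wpM2l //; lra.
  by apply: le_trans h2 _; rewrite [c * _]mulrC -mulrA ler_wpM2l.
have bern m : 1 + m%:R * d <= (1 + d) ^+ m.
  elim: m => [|m IH]; first by rewrite mul0r addr0 expr0.
  rewrite exprS; apply: le_trans (ler_wpM2l (ltW d1) IH).
  have m0 : 0 <= m%:R * d * d by rewrite !mulr_ge0 // ltW.
  by rewrite -natr1; lra.
pose m := (Num.truncn (32 / d)).+1.
have m32 : 32 <= (1 + d) ^+ m.
  apply: le_trans (bern m).
  have : 32 / d < m%:R by apply: truncnS_gt.
  by rewrite ltr_pdivrMr //; lra.
exists (c ^+ m), (Num.max T 1); split.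
- exact: exprn_ege1.
- by rewrite le_max lexx orbT.
move=> s t Tt ts st; apply: iter => //; apply: le_trans st _.
rewrite ler_wpM2r //; move: Tt; rewrite ge_max => /andP[_]; lra.
Qed.

Lemma gauge_order_comparable : exists (c : R) (J : nat), [/\ 0 < c, (0 < J)%N &
  forall j s t, (J <= j)%N -> (32 ^ j)%:R <= s <= (32 ^ j.+1)%:R ->
    (32 ^ j)%:R <= t <= (32 ^ j.+1)%:R ->
    count_order (g s) <= c * count_order (g t)].
Proof.
have [c [T [c1 T1 H]]] := gauge_comparable.
have [d d0 Hd] := count_order_le c1.
pose J := (Num.truncn T).+1.
exists d, J; split => // j s t Jj /andP[js sj] /andP[jt tj].
have Tj : T <= (32 ^ j)%:R.
  apply: le_trans (ltW (truncnS_gt T)) _; rewrite ler_nat.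
  by apply: leq_trans Jj _; apply/ltnW/ltn_expl.
have e : (32 ^ j.+1)%:R = 32 * (32 ^ j)%:R :> R by rewrite expnS natrM.
rewrite e in sj tj.
have gs3 : 3 <= g s by apply/ltW/g3; lra.
have gt3 : 3 <= g t by apply/ltW/g3; lra.
have [st|ts] := leP t s.
  have [h1 h2] : g s <= c * g t /\ g t <= c * g s by apply: H; lra.
  by apply: Hd.
have [h1 h2] : g t <= c * g s /\ g s <= c * g t by apply: H; lra.
by apply: Hd.
Qed.

End RegularGauge.

(** * Block comparison of the integral with the sum over primes *)

Section GaugeIntegral.
Context {R : realType}.
Set Implicit Arguments.
Unset Strict Implicit.
Implicit Types (y s t a b c e q r l u v C : R) (n m p k j i J T : nat).
Local Notation cf_weight := (@cf_weight R).
Local Notation mu := (@lebesgue_measure R).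

(** To be read with [q = 32^j], [r = j], [l = ln y], and [u], [v] the values of [count_order (g _)]
    at [y] and at [q]. The factor 1024 is the square of the block ratio, and 10 bounds
    [ln y / j]. *)
Lemma integrand_arith C q r l y u v : 0 < C -> 0 < q -> 1 <= r -> q <= y -> y <= 32 * q ->
  r <= l -> l <= r * 10 -> 0 < v -> 0 < u -> u <= C * v -> v <= C * u ->
  (C * (1024 * 10))^-1 * (v / (q * r) / q) <= u / (y ^+ 2 * l) <= C * (v / (q * r) / q).
Proof.
move=> C0 q0 r1 qy yq rl lr v0 u0 uv vu.
have K0 : 0 < 1024 * 10 :> R by lra.
have y0 : 0 < y by lra.
have l0 : 0 < l by lra.
have y2 : q ^+ 2 <= y ^+ 2 by rewrite lerXn2r ?nnegrE; lra.
have y2' : y ^+ 2 <= (32 * q) ^+ 2 by rewrite lerXn2r ?nnegrE; lra.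
have q2 : 0 < q ^+ 2 by rewrite exprn_gt0.
have Y0 : 0 < y ^+ 2 * l by rewrite mulr_gt0 ?exprn_gt0.
have lo : q ^+ 2 * r <= y ^+ 2 * l by apply: ler_pM => //; lra.
have hi : y ^+ 2 * l <= (1024 * 10) * (q ^+ 2 * r).
  have -> : (1024 * 10) * (q ^+ 2 * r) = (32 * q) ^+ 2 * (r * 10) by ring.
  by apply: ler_pM => //; lra.
have -> : v / (q * r) / q = v / (q ^+ 2 * r) by field; rewrite (gt_eqF q0) gt_eqF //; lra.
have Q0 : 0 < q ^+ 2 * r by rewrite mulr_gt0 //; lra.
move: K0 Q0 Y0 lo hi; move: (1024 * 10) (q ^+ 2 * r) (y ^+ 2 * l) => K Q Y K0 Q0 Y0 lo hi.
apply/andP; split.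
  have -> : (C * K)^-1 * (v / Q) = (v / C) / (K * Q).
    by field; rewrite (gt_eqF Q0) (gt_eqF K0) gt_eqF.
  have KQ0 : 0 < K * Q by rewrite mulr_gt0.
  apply: ler_pM; [by rewrite divr_ge0 // ltW|by rewrite invr_ge0 ltW| |].
    by rewrite ler_pdivrMr // mulrC.
  by rewrite lef_pV2 ?posrE.
rewrite mulrA; apply: ler_pM => //; [by rewrite ltW|by rewrite invr_ge0 ltW|].
by rewrite lef_pV2 ?posrE.
Qed.

Variable g : R -> R.
Hypothesis mg : measurable_fun (`[0, +oo[ : set R) g.
Hypothesis g3 : forall t, 0 <= t -> 3 < g t.

Let integrand y : R := (g y / ln (ln (g y))) / (y ^+ 2 * ln y).

(** Common yardstick for the integral over block [j] and the sum over its primes: about [32^j / j]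
    primes of weight about [32^(-2j)], or a length of order [32^j] with [y^2 ln y] of order
    [32^(2j) * j]. *)
Definition block_term j : R := count_order (g (32 ^ j)%:R) / ((32 ^ j)%:R * j%:R).

Let order_gt0 t : 0 <= t -> 0 < count_order (g t).
Proof. by move=> t0; apply/count_order_gt0/ltW/g3. Qed.

Lemma block_term_ge0 j : 0 <= block_term j.
Proof. by apply: divr_ge0; [apply/ltW/order_gt0|apply: mulr_ge0]. Qed.

Let integrand_ge0 y : 1 <= y -> 0 <= integrand y.
Proof.
move=> y1; apply: divr_ge0; first by apply/ltW/order_gt0; lra.
by rewrite mulr_ge0 ?exprn_ge0 ?ln_ge0 //; lra.
Qed.

Let measurable_integrand : measurable_fun (`[1, +oo[ : set R) (EFin \o integrand).
Proof.
apply/measurable_EFinP.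
(* Both inverted factors are nonnegative on the domain, so the inverses are powers with exponent -1,
   and measurability reduces to that of the power function. *)
pose f y := (g y * (ln (ln (g y))) `^ (-1)) * (y ^+ 2 * ln y) `^ (-1).
apply: (eq_measurable_fun f).
  move=> y; rewrite inE /= in_itv /= andbT => y1.
  have gy : 3 <= g y by apply/ltW/g3; lra.
  rewrite /f /integrand !powR_inv1 //; first by rewrite mulr_ge0 ?exprn_ge0 ?ln_ge0 //; lra.
  exact/ltW/lnln_ge3_gt0.
have mg1 : measurable_fun (`[1, +oo[ : set R) g.
  apply: measurable_funS mg => //; apply: subset_itvr; rewrite bnd_simp; exact: ler01.
have ml : measurable_fun (`[1, +oo[ : set R) (fun y => ln (ln (g y))).
  do 2! apply: measurableT_comp => //; exact: measurable_ln.
have minv (h : R -> R) : measurable_fun (`[1, +oo[ : set R) h ->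
    measurable_fun (`[1, +oo[ : set R) (fun y => h y `^ (-1)).
  by move=> mh; apply: (measurableT_comp (measurable_powR (-1)) mh).
apply: measurable_funM.
  by apply: measurable_funM => //; apply: minv.
apply: minv.
apply: measurable_funM; last by apply: measurable_funTS; apply: measurable_ln.
by apply: measurable_funX; apply: measurable_id.
Qed.

Let block j : set R := `[(32 ^ j)%:R, (32 ^ j.+1)%:R[.

Let bigcup_block J : \bigcup_i block (J + i) = `[(32 ^ J)%:R, +oo[%classic.
Proof.
apply/seteqP; split=> y /=; rewrite in_itv /= andbT.
  move=> [i _]; rewrite /block /= in_itv /= => /andP[h _]; apply: le_trans h.
  by rewrite ler_nat leq_exp2l // leq_addr.
move=> Jy; have y0 : 0 <= y by apply: le_trans Jy.
pose m := Num.truncn y.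
have Jm : (32 ^ J <= m)%N by rewrite truncn_ge_nat.
have m0 : (0 < m)%N by apply: leq_trans Jm; rewrite expn_gt0.
exists (trunc_log 32 m - J)%N => //.
have Jl : (J <= trunc_log 32 m)%N by apply: trunc_log_max.
rewrite /block /= in_itv /= subnKC //; apply/andP; split.
  by rewrite -truncn_ge_nat //; apply: trunc_logP.
by rewrite -truncn_lt_nat //; apply: trunc_log_ltn.
Qed.

Let trivIset_block J : trivIset setT (fun i => block (J + i)).
Proof.
apply: ltn_trivIset => i j ij; apply/seteqP; split=> y //=.
rewrite /block /= !in_itv /= => -[/andP[_ h1] /andP[h2 _]].
have : (32 ^ (J + j).+1)%:R <= (32 ^ (J + i))%:R :> R by rewrite ler_nat leq_exp2l // -addnS leq_add2l.
lra.
Qed.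

Let integral_blocks J :
  (\int[mu]_(y in `[(32 ^ J)%:R, +oo[) (integrand y)%:E =
   \sum_(0 <= i <oo) \int[mu]_(y in block (J + i)) (integrand y)%:E)%E.
Proof.
have sub : [set` `[(32 ^ J)%:R : R, +oo[] `<=` `[1, +oo[.
  by apply: subset_itvr; rewrite bnd_simp ler1n expn_gt0.
rewrite -bigcup_block ge0_integral_bigcup //.
- by move=> i; apply: measurable_itv.
- by rewrite bigcup_block; apply: measurable_funS measurable_integrand.
- move=> y; rewrite bigcup_block => /sub; rewrite /= in_itv /= andbT => y1.
  by rewrite lee_fin integrand_ge0.
Qed.

Section Comparison.
Variables (C : R) (J : nat).
Hypotheses (C0 : 0 < C) (J0 : (0 < J)%N).
Hypothesis order_comparable : forall j s t, (J <= j)%N ->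
  (32 ^ j)%:R <= s <= (32 ^ j.+1)%:R -> (32 ^ j)%:R <= t <= (32 ^ j.+1)%:R ->
  count_order (g s) <= C * count_order (g t).

Let integrand_bounds : exists2 D : R, 0 < D & forall j y, (J <= j)%N ->
  (32 ^ j)%:R <= y <= (32 ^ j.+1)%:R ->
  D^-1 * (block_term j / (32 ^ j)%:R) <= integrand y <= C * (block_term j / (32 ^ j)%:R).
Proof.
exists (C * (1024 * 10)); first by apply: mulr_gt0; [exact: C0|lra].
move=> j y Jj /andP[jy yj].
have j0 : (0 < j)%N by apply: leq_trans Jj.
have p32 : 0 < (32 ^ j)%:R :> R by rewrite ltr0n expn_gt0.
have jR : 1 <= j%:R :> R by rewrite ler1n.
have e : (32 ^ j.+1)%:R = 32 * (32 ^ j)%:R :> R by rewrite expnS natrM.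
have ends : (32 ^ j)%:R <= ((32 ^ j)%:R : R) <= (32 ^ j.+1)%:R.
  by rewrite lexx /= ler_nat leq_exp2l // leqnSn.
have yb : (32 ^ j)%:R <= y <= (32 ^ j.+1)%:R by rewrite jy yj.
have h1 := order_comparable Jj yb ends.
have h2 := order_comparable Jj ends yb.
have l2 := @ln2_ge_half R; have l21 := @ln2_le1 R.
have y0 : 0 < y by lra.
have ly : j%:R <= ln y.
  apply: (@le_trans _ _ (ln (32 ^ j)%:R)); last by rewrite ler_ln ?posrE.
  by rewrite lnXn32 ler_peMr // ln32E; lra.
have ly2 : ln y <= j%:R * 10.
  apply: (@le_trans _ _ (ln (32 ^ j.+1)%:R)); first by rewrite ler_ln ?posrE // e; lra.
  by rewrite lnXn32 ln32E -natr1; nra.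
rewrite /integrand -/(count_order (g y)) /block_term.
have b0 : 0 < count_order (g (32 ^ j)%:R) by apply/order_gt0/ltW.
have by0 : 0 < count_order (g y) by apply/order_gt0/ltW.
rewrite e in yj.
exact: integrand_arith.
Qed.

Let block_length j : mu (block j) = (31 * (32 ^ j)%:R)%:E.
Proof.
rewrite /block lebesgue_measure_itv /= lte_fin ltr_nat ltn_exp2l // ltnSn -EFinD.
by congr (_%:E); rewrite expnS natrM; lra.
Qed.

Let block_integral : exists2 D : R, 0 < D & forall j, (J <= j)%N ->
  ((D * block_term j)%:E <= \int[mu]_(y in block j) (integrand y)%:E
    <= (31 * C * block_term j)%:E)%E.
Proof.
have [D D0 bounds] := integrand_bounds.
exists (31 / D); first by rewrite divr_gt0.
move=> j Jj.
have mb : measurable (block j : set (measurableTypeR R)) by apply: measurable_itv.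
have p32 : 0 < (32 ^ j)%:R :> R by rewrite ltr0n expn_gt0.
have sub : block j `<=` `[1, +oo[.
  move=> y; rewrite /block /= !in_itv /= andbT => /andP[h _]; apply: le_trans h.
  by rewrite ler1n expn_gt0.
have mF : measurable_fun (block j : set R) (EFin \o integrand).
  exact: measurable_funS measurable_integrand.
have inb y : block j y -> (32 ^ j)%:R <= y <= (32 ^ j.+1)%:R.
  by rewrite /block /= in_itv /= => /andP[-> /ltW ->].
have bt := block_term_ge0 j.
apply/andP; split.
  have -> : (31 / D * block_term j)%:E =
     (\int[mu]_(y in block j) cst (D^-1 * (block_term j / (32 ^ j)%:R))%:E y)%E.
    rewrite integral_cst // [X in (_ * X)%E]block_length -EFinM; congr (_%:E).
    by move: p32; move: (32 ^ j)%:R (block_term j) => q b q0; field; rewrite (gt_eqF q0) gt_eqF.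
  apply: ge0_le_integral => //.
  - by move=> y _; rewrite /cst lee_fin; apply: mulr_ge0; [rewrite invr_ge0 ltW|apply: divr_ge0].
  - by move=> y /inb /(bounds _ _ Jj)/andP[h _]; rewrite lee_fin.
have -> : (31 * C * block_term j)%:E =
   (\int[mu]_(y in block j) cst (C * (block_term j / (32 ^ j)%:R))%:E y)%E.
  rewrite integral_cst // [X in (_ * X)%E]block_length -EFinM; congr (_%:E).
  by move: p32; move: (32 ^ j)%:R (block_term j) => q b q0; field; rewrite gt_eqF.
apply: ge0_le_integral => //.
- move=> y /sub; rewrite /= in_itv /= andbT => y1; by rewrite lee_fin integrand_ge0.
- by move=> y /inb /(bounds _ _ Jj)/andP[_ h]; rewrite lee_fin.
Qed.

Lemma gintegral_infinite c B : (32 ^ J)%:R <= c -> gintegral g c = +oo%E ->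
  exists T, B < \sum_(J <= j < T) block_term j.
Proof.
move=> Jc inf; apply: contrapT => nex.
have bnd T : \sum_(J <= j < T) block_term j <= B.
  by rewrite leNgt; apply/negP => h; apply: nex; exists T.
have J1 : 1 <= (32 ^ J)%:R :> R by rewrite ler1n expn_gt0.
have [k k0 blocks] := block_integral.
have : (gintegral g c < +oo)%E; last by rewrite inf.
apply: (@le_lt_trans _ _ (\int[mu]_(y in `[(32 ^ J)%:R, +oo[) (integrand y)%:E)%E).
  apply: ge0_subset_integral => //.
  - by apply: measurable_funS measurable_integrand => //; apply: subset_itvr; rewrite bnd_simp.
  - move=> y; rewrite /= in_itv /= andbT => Jy; rewrite lee_fin integrand_ge0 //; lra.
  - by apply: subset_itvr; rewrite bnd_simp.
rewrite integral_blocks; apply: (@le_lt_trans _ _ (31 * C * B)%:E); last exact: ltry.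
have int0 i : (0 <= \int[mu]_(y in block (J + i)) (integrand y)%:E)%E.
  have /andP[+ _] := blocks _ (leq_addr i J).
  by apply: le_trans; rewrite lee_fin mulr_ge0 ?block_term_ge0 // ltW.
apply: lime_le; first by apply: is_cvg_nneseries => n _ _.
near=> N; rewrite big_mkord.
apply: (@le_trans _ _ (\sum_(i < N) (31 * C * block_term (J + i))%:E)%E).
  by apply: lee_sum => i _; have /andP[] := blocks _ (leq_addr i J).
rewrite sumEFin lee_fin -mulr_sumr ler_wpM2l ?mulr_ge0 ?(ltW C0) //.
have := bnd (J + N)%N; rewrite -{1}[J]add0n big_addn addKn big_mkord.
by under eq_bigr do rewrite addnC.
Unshelve. all: by end_near.
Qed.

Lemma gintegral_finite c : (32 ^ J)%:R <= c -> (gintegral g c < +oo)%E ->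
  exists B, forall T, \sum_(J <= j < T) block_term j <= B.
Proof.
move=> Jc fin.
have J1 : 1 <= (32 ^ J)%:R :> R by rewrite ler1n expn_gt0.
have [k k0 blocks] := block_integral.
(* [c] may fall inside a block: whole blocks are compared with the integral only from [32^a >= c]
   on, and the finitely many blocks from [J] to [a] enter the bound directly. *)
pose a := (maxn J (Num.truncn c).+1).
have ac : c <= (32 ^ a)%:R.
  apply: le_trans (ltW (truncnS_gt c)) _; rewrite ler_nat.
  by apply: leq_trans (leq_maxr J _) _; apply/ltnW/ltn_expl.
have Ja : (J <= a)%N by rewrite leq_maxl.
have le1 : (\int[mu]_(y in `[(32 ^ a)%:R, +oo[) (integrand y)%:E <= gintegral g c)%E.
  apply: ge0_subset_integral => //.
  - apply: measurable_funS measurable_integrand => //; apply: subset_itvr; rewrite bnd_simp; lra.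
  - move=> y; rewrite /= in_itv /= andbT => Jy; rewrite lee_fin integrand_ge0 //; lra.
  - by apply: subset_itvr; rewrite bnd_simp.
have int0 i : (0 <= \int[mu]_(y in block (a + i)) (integrand y)%:E)%E.
  have /andP[+ _] := blocks _ (leq_trans Ja (leq_addr i a)).
  by apply: le_trans; rewrite lee_fin mulr_ge0 ?block_term_ge0 // ltW.
have g0 : (0 <= gintegral g c)%E.
  apply: integral_ge0 => y; rewrite /= in_itv /= andbT => cy.
  by rewrite lee_fin integrand_ge0 //; lra.
have fing : gintegral g c \is a fin_num by rewrite ge0_fin_numE.
exists (\sum_(J <= j < a) block_term j + fine (gintegral g c) / k) => T.
have tail N : \sum_(i < N) block_term (a + i) <= fine (gintegral g c) / k.
  rewrite ler_pdivlMr // mulrC -lee_fin fineK //; apply: le_trans le1.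
  rewrite integral_blocks.
  apply: le_trans (nneseries_lim_ge N _) => [|i _ _]; last exact: int0.
  rewrite mulr_sumr -sumEFin big_mkord; apply: lee_sum => i _.
  by have /andP[] := blocks _ (leq_trans Ja (leq_addr i a)).
have [Ta|aT] := leqP T a.
  have f0 : 0 <= fine (gintegral g c) / k by have := tail 0%N; rewrite big_ord0.
  apply: (@le_trans _ _ (\sum_(J <= j < a) block_term j)); last by rewrite lerDl.
  have [TJ|JT] := leqP T J; first by rewrite big_geq // sumr_ge0 // => j _; apply: block_term_ge0.
  rewrite [leRHS](@big_cat_nat _ _ _ T) ?(ltnW JT) //= lerDl.
  by apply: sumr_ge0 => j _; apply: block_term_ge0.
rewrite (@big_cat_nat _ _ _ a) ?(ltnW aT) //= lerD2l.
have -> : \sum_(a <= i < T) block_term i = \sum_(i < T - a) block_term (a + i).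
  by rewrite -{1}[a]add0n big_addn big_mkord; apply: eq_bigr => i _; rewrite addnC.
exact: tail.
Qed.

Let weight_bounds p j : (32 ^ j <= p < 32 ^ j.+1)%N ->
  (32 * (32 ^ j)%:R)^-1 ^+ 2 <= cf_weight p <= (32 ^ j)%:R^-1 ^+ 2.
Proof.
move=> /andP[jp pj].
have p32 : 0 < (32 ^ j)%:R :> R by rewrite ltr0n expn_gt0.
have jpR : (32 ^ j)%:R <= p%:R :> R by rewrite ler_nat.
have p0 : 0 < p%:R :> R by apply: lt_le_trans jpR.
have pjR : p%:R + 1 <= 32 * (32 ^ j)%:R :> R by rewrite natr1 -natrM -expnS ler_nat.
rewrite /cf_weight natrM -[p.+1%:R]natr1 !exprVn.
move: p32 jpR p0 pjR; move: (32 ^ j)%:R p%:R => q r q0 qr r0 rq.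
have R0 : 0 < r * (r + 1) by rewrite mulr_gt0 //; lra.
have Q0 : 0 < q ^+ 2 by rewrite exprn_gt0.
have K0 : 0 < (32 * q) ^+ 2 by rewrite exprn_gt0 // mulr_gt0.
rewrite !lef_pV2 ?posrE // !expr2; apply/andP; split; apply: ler_pM; lra.
Qed.

Let in_block p j : (32 ^ j <= p < 32 ^ j.+1)%N -> (32 ^ j)%:R <= (p%:R : R) <= (32 ^ j.+1)%:R.
Proof. by move=> /andP[h1 h2]; rewrite !ler_nat h1 ltnW. Qed.

Let in_block0 j : (32 ^ j)%:R <= ((32 ^ j)%:R : R) <= (32 ^ j.+1)%:R.
Proof. by rewrite lexx /= ler_nat leq_exp2l // leqnSn. Qed.

Lemma prime_sum_lower : exists2 D : R, 0 < D & forall T, (J <= T)%N ->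
  D * \sum_(J <= j < T) block_term j <=
  \sum_(32 ^ J <= p < 32 ^ T | prime p) cf_weight p * count_order (g p%:R).
Proof.
exists (2 * C * 32 ^+ 2)^-1.
  by rewrite invr_gt0 mulr_gt0 ?exprn_gt0 ?mulr_gt0.
move=> T JT; rewrite block_sums // mulr_sumr big_seq_cond [leRHS]big_seq_cond.
apply: ler_sum => j; rewrite mem_index_iota andbT => /andP[Jj _].
have j0 : (0 < j)%N by apply: leq_trans Jj.
have p32 : 0 < (32 ^ j)%:R :> R by rewrite ltr0n expn_gt0.
have jR : 0 < j%:R :> R by rewrite ltr0n.
have b0 : 0 < count_order (g (32 ^ j)%:R) by apply/order_gt0.
pose lo := (32 * (32 ^ j)%:R)^-1 ^+ 2 * (count_order (g (32 ^ j)%:R) / C).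
have lo0 : 0 <= lo.
  by apply: mulr_ge0; [rewrite exprn_ge0 // invr_ge0 mulr_ge0|rewrite divr_ge0 // ltW].
have := @block_sum_lower R (fun p => cf_weight p * count_order (g p%:R)) lo j j0 lo0.
have -> : lo * (2^-1 * (32 ^ j)%:R / j%:R) = (2 * C * 32 ^+ 2)^-1 * block_term j.
  rewrite /lo /block_term; move: p32 jR b0; move: (32 ^ j)%:R j%:R (count_order _) => q r b q0 r0 b0.
  by field; rewrite (gt_eqF q0) (gt_eqF r0) (gt_eqF C0).
apply=> p pp pj; have /andP[w1 _] := weight_bounds pj.
apply: ler_pM => //.
- by rewrite divr_ge0 // ltW.
- by rewrite ler_pdivrMr // mulrC; apply: (order_comparable Jj (in_block0 j) (in_block pj)).
Qed.

Lemma prime_sum_upper T : (J <= T)%N ->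
  \sum_(32 ^ J <= p < 32 ^ T | prime p) cf_weight p * count_order (g p%:R)
  <= 26 * C * \sum_(J <= j < T) block_term j.
Proof.
move=> JT; rewrite block_sums // mulr_sumr big_seq_cond [leRHS]big_seq_cond.
apply: ler_sum => j; rewrite mem_index_iota andbT => /andP[Jj _].
have j0 : (0 < j)%N by apply: leq_trans Jj.
have p32 : 0 < (32 ^ j)%:R :> R by rewrite ltr0n expn_gt0.
have jR : 0 < j%:R :> R by rewrite ltr0n.
have b0 : 0 < count_order (g (32 ^ j)%:R) by apply/order_gt0.
pose hi := (32 ^ j)%:R^-1 ^+ 2 * (C * count_order (g (32 ^ j)%:R)).
have hi0 : 0 <= hi.
  by apply: mulr_ge0; [rewrite exprn_ge0 // invr_ge0|apply: mulr_ge0; exact: ltW].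
have := @block_sum_upper R (fun p => cf_weight p * count_order (g p%:R)) hi j j0 hi0.
have -> : hi * (26 * (32 ^ j)%:R / j%:R) = 26 * C * block_term j.
  rewrite /hi /block_term; move: p32 jR b0; move: (32 ^ j)%:R j%:R (count_order _) => q r b q0 r0 b0.
  by field; rewrite (gt_eqF q0) (gt_eqF r0).
apply=> p pp pj; have /andP[_ w1] := weight_bounds pj.
apply: ler_pM => //.
- by rewrite cf_weight_ge0.
- by apply/ltW/order_gt0.
- exact: (order_comparable Jj (in_block pj) (in_block0 j)).
Qed.

End Comparison.
End GaugeIntegral.

(** * The dichotomy *)

Section Counting.
Context {R : realType}.
Set Implicit Arguments.
Unset Strict Implicit.
Implicit Types (x z w c A : R) (n p k j T P N : nat).
Local Notation cf_weight := (@cf_weight R).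
Local Notation nlnln := (@nlnln R).
Local Notation lnln := (@lnln R).

Lemma ln_le_sub1 x : 0 < x -> ln x <= x - 1.
Proof.
move=> x0; have := @le_ln1Dx R (x - 1).
by have -> : 1 + (x - 1) = x; [lra|apply; lra].
Qed.

(** Absorbs the rounding when a count is bounded by an integer part plus one. *)
Lemma count_order_ge1 z : 3 <= z -> 1 <= count_order z.
Proof.
move=> z3; have [lz _] := lnln_ge3 z3; have l0 := lnln_ge3_gt0 z3.
rewrite /count_order ler_pdivlMr // mul1r.
have h1 : ln (ln z) <= ln z - 1 by apply: ln_le_sub1; lra.
have h2 : ln z <= z - 1 by apply: ln_le_sub1; lra.
lra.
Qed.

(** If [n^2 <= z], the bound follows from [ln (ln z) <= 2 * sqrt z] alone. Otherwise [ln z] is at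
    most [2 * ln (n + 16)], so [ln (ln z) <= 2 * lnln n], and the hypothesis on [nlnln n] gives the
    rest. *)
Lemma nlnln_le_count A z n : 0 < A -> 3 <= z -> A * nlnln n <= z ->
  n%:R <= (2 + 2 / A) * count_order z.
Proof.
move=> A0 z3 Anz; have [lz _] := lnln_ge3 z3; have l0 := lnln_ge3_gt0 z3.
have co0 := count_order_gt0 z3.
have A20 : 0 <= 2 / A * count_order z by apply: mulr_ge0; [apply: divr_ge0 => //; exact: ltW|exact: ltW].
rewrite mulrDl.
have [nz|zn] := leP (n%:R ^+ 2) z.
  suff : n%:R <= 2 * count_order z by lra.
  rewrite /count_order mulrA ler_pdivlMr //.
  have [->|np] := posnP n; first by rewrite mul0r; lra.
  have n1 : 1 <= n%:R :> R by rewrite ler1n.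
  set s := Num.sqrt z.
  have s0 : 0 < s by rewrite sqrtr_gt0; lra.
  have s2 : z = s ^+ 2 by rewrite sqr_sqrtr //; lra.
  have ns : n%:R <= s by rewrite -(ger0_norm (ler0n R n)) -sqrtr_sqr ler_wsqrtr.
  have h1 : ln (ln z) <= ln z - 1 by apply: ln_le_sub1; lra.
  have h2 : ln z <= 2 * s.
    rewrite s2 lnXn // -[_ *+ 2]mulr_natl.
    by have := ln_le_sub1 s0; lra.
  have lls : ln (ln z) <= 2 * s by lra.
  apply: (@le_trans _ _ (s * (2 * s))); first by apply: ler_pM => //; lra.
  by rewrite s2 expr2; lra.
suff : n%:R <= 2 / A * count_order z by lra.
have np : (0 < n)%N by case: n zn {Anz} => // ; rewrite expr0n /=; lra.
have nR : 0 < n%:R :> R by rewrite ltr0n.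
have w2 := @ln_shift_ge2 R n; set w := ln (n + 16)%:R in w2.
have wl : ln z <= 2 * w.
  have : ln z <= ln (n%:R ^+ 2) by rewrite ler_ln ?posrE ?exprn_gt0 //; lra.
  rewrite lnXn // -[_ *+ 2]mulr_natl => h; apply: le_trans h _.
  by rewrite ler_wpM2l // ler_ln ?posrE ?ltr0n ?addn_gt0 ?np // ler_nat leq_addr.
have lw : ln (ln z) <= 2 * lnln n.
  have -> : 2 * lnln n = ln (w ^+ 2) by rewrite lnXn ?mulr_natl //; lra.
  by rewrite ler_ln ?posrE ?exprn_gt0 ?expr2 //; [nra|lra|lra].
rewrite /count_order mulrA ler_pdivlMr // mulrAC ler_pdivlMr //.
rewrite /nlnln in Anz.
have : A * n%:R * ln (ln z) <= A * n%:R * (2 * lnln n).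
  by apply: ler_wpM2l => //; rewrite mulr_ge0 // ltW.
lra.
Qed.

Lemma sum_lt_le M K : (\sum_(n < M) (n < K) <= K)%N.
Proof.
have -> : (\sum_(n < M) (n < K) = minn M K)%N; last exact: geq_minr.
elim: M => [|M IH]; first by rewrite big_ord0 min0n.
by rewrite big_ord_recr /= IH; case: (ltnP M K) => h; rewrite /minn; case: ltnP; case: ltnP; lia.
Qed.

Lemma count_upper A z M : 0 < A -> 3 <= z ->
  (\sum_(n < M) (A * nlnln n <= z)%R)%:R <= (3 + 2 / A) * count_order z.
Proof.
move=> A0 z3; have co1 := count_order_ge1 z3.
set B := (2 + 2 / A) * count_order z.
have A20 : 0 <= 2 / A by apply: divr_ge0 => //; exact: ltW.
have B0 : 0 <= B by apply: mulr_ge0; lra.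
apply: (@le_trans _ _ (Num.truncn B).+1%:R).
  rewrite ler_nat; apply: leq_trans (sum_lt_le M _); apply: leq_sum => n _.
  have [h|//] := leP (A * nlnln n) z.
  by rewrite ltnS truncn_ge_nat // nlnln_le_count.
rewrite -natr1; have : (Num.truncn B)%:R <= B by rewrite truncn_le.
rewrite /B; lra.
Qed.

(** For such [n] one has [n + 16 <= c * z], hence [lnln n <= d * ln (ln z)]; the choice
    [k <= 1 / (A * d)] then makes [A * nlnln n] at most [z]. *)
Lemma count_lower A : 0 < A -> exists2 k : R, 0 < k & forall z, 3 <= z ->
  forall n, n%:R <= k * count_order z -> A * nlnln n <= z.
Proof.
move=> A0; have l30 := @lnln3_gt0 R.
set c := (ln (ln 3))^-1 + 16 : R.
have i0 : 0 <= (ln (ln 3))^-1 :> R by rewrite invr_ge0 ltW.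
have c1 : 1 <= c by rewrite /c; lra.
have [d d0 H] := lnln_le_mul c1.
pose k := Num.min 1 (A * d)^-1.
have k0 : 0 < k by rewrite lt_min ltr01 invr_gt0 mulr_gt0.
exists k => // z z3 n nk; have l0 := lnln_ge3_gt0 z3.
have [_ l3z] := lnln_ge3 z3.
have co0 := count_order_gt0 z3.
have k1 : k <= 1 by rewrite ge_min lexx.
have kAd : A * d * k <= 1.
  rewrite mulrC -ler_pdivlMr ?mulr_gt0 // div1r ge_min lexx orbT //.
have n16 : (n + 16)%:R <= c * z.
  have coz : count_order z <= (ln (ln 3))^-1 * z.
    by rewrite /count_order mulrC ler_wpM2r ?lef_pV2 ?posrE //; lra.
  have : k * count_order z <= count_order z by rewrite ler_piMl // ltW.
  by rewrite natrD /c; lra.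
have h : lnln n <= d * ln (ln z).
  by apply: H => //; rewrite natrD; have := ler0n R n; lra.
rewrite /nlnln; apply: (@le_trans _ _ (A * (k * count_order z * (d * ln (ln z))))).
  rewrite ler_wpM2l ?(ltW A0) //; apply: ler_pM => //; apply/ltW/lnln_gt0.
have -> : A * (k * count_order z * (d * ln (ln z))) = (A * d * k) * z.
  by rewrite /count_order; field; rewrite gt_eqF.
by rewrite ler_piMl //; lra.
Qed.

(** After exchanging the sums, the value [p] collects about [k * count_order (z p)] positions.
    Starting at [n1] instead of 0 loses at most [n1] in all, because the weights sum to at most 1,
    so divergence survives any start. *)
Lemma divergent_counts (z : nat -> R) A : 0 < A -> (forall p, prime p -> 3 <= z p) ->
  (forall B : R, exists P, B <= \sum_(0 <= p < P | prime p) cf_weight p * count_order (z p)) ->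
  forall n1, exists P N, 8^-1 <= \sum_(n1 <= n < N) \sum_(p < P)
    (prime p && (A * nlnln n <= z p))%:R * cf_weight p.
Proof.
move=> A0 z3 div n1; have [k k0 H] := count_lower A0.
have [P HP] := div ((8^-1 + n1%:R) / k).
pose K p := (Num.truncn (k * count_order (z p))).+1.
pose N := (\max_(p < P) K p)%N.
exists P, N; rewrite exchange_big /=.
rewrite ler_pdivrMr // mulrC mulr_sumr big_mkord in HP.
apply: (@le_trans _ _ (\sum_(p < P | prime p) k * (cf_weight p * count_order (z p)) - n1%:R * 1)); first by lra.
have h1 : n1%:R * (\sum_(p < P) cf_weight p) <= n1%:R * 1 :> R.
  by rewrite ler_wpM2l // sum_cf_weight_le1.
apply: (@le_trans _ _ (\sum_(p < P | prime p) k * (cf_weight p * count_order (z p)) - n1%:R * (\sum_(p < P) cf_weight p))).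
  by lra.
rewrite mulr_sumr big_mkcond -sumrB; apply: ler_sum => p _.
have w0 := @cf_weight_ge0 R p.
case: ifP => pp /=; last first.
  rewrite sub0r; apply: (@le_trans _ _ 0); first by rewrite oppr_le0 mulr_ge0.
  by apply: sumr_ge0 => n _; rewrite mulr_ge0.
rewrite -mulr_suml.
have -> : k * (cf_weight p * count_order (z p)) - n1%:R * cf_weight p =
  (k * count_order (z p) - n1%:R) * cf_weight p by ring.
rewrite ler_wpM2r //.
have KN : (K p <= N)%N by rewrite /N (bigD1 p) //= leq_maxl.
have Kp : k * count_order (z p) <= (K p)%:R by apply/ltW/truncnS_gt.
have [Kn1|n1K] := leqP (K p) n1.
  apply: (@le_trans _ _ 0); last by apply: sumr_ge0.
  have KnR : (K p)%:R <= n1%:R :> R by rewrite ler_nat.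
  lra.
apply: (@le_trans _ _ (\sum_(n1 <= n < K p) 1)).
  by rewrite sumr_const_nat natrB ?(ltnW n1K) //; lra.
rewrite [leRHS](@big_cat_nat _ _ _ (K p)) ?(ltnW n1K) //=.
rewrite -[leLHS]addr0 lerD //; last by apply: sumr_ge0.
rewrite big_seq_cond [leRHS]big_seq_cond; apply: ler_sum => n.
rewrite mem_index_iota andbT => /andP[_ nK].
rewrite H ?z3 //; apply: le_trans (_ : (Num.truncn (k * count_order (z p)))%:R <= _).
  by rewrite ler_nat -ltnS.
by rewrite truncn_le mulr_ge0 ?(ltW k0) //; apply/ltW/count_order_gt0/z3.
Qed.

Lemma convergent_counts (z : nat -> R) A B : 0 < A -> (forall p, prime p -> 3 <= z p) ->
  (forall P, \sum_(0 <= p < P | prime p) cf_weight p * count_order (z p) <= B) ->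
  forall (M : nat -> nat) P,
  \sum_(p < P) cf_weight p * (\sum_(n < M p) (prime p && (A * nlnln n <= z p)%R))%:R
    <= (3 + 2 / A) * B.
Proof.
move=> A0 z3 conv M P.
have C0 : 0 <= 3 + 2 / A by rewrite addr_ge0 // divr_ge0 // ltW.
apply: le_trans (ler_wpM2l C0 (conv P)); rewrite mulr_sumr big_mkord [leRHS]big_mkcond.
apply: ler_sum => p _; case: ifP => pp; last by rewrite big1 ?mulr0 // => n _.
have -> : (3 + 2 / A) * (cf_weight p * count_order (z p)) =
  cf_weight p * ((3 + 2 / A) * count_order (z p)) by ring.
rewrite ler_wpM2l ?cf_weight_ge0 //.
by apply: count_upper => //; apply: z3.
Qed.

(** Block [j] contributes at least [1 / (64 * j * ln (10 * j))], since [ln (p + 1) <= 10 * j] there,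
    and the sum over [j] telescopes against [ln (ln (10 * T))]. The shift to [p + 1] accommodates
    the prime 2, as the counting estimates ask for values at least 3. *)
Lemma identity_divergent (B : R) : exists P,
  B <= \sum_(0 <= p < P | prime p) cf_weight p * count_order (p%:R + 1).
Proof.
have l10 : 1 <= ln 10 :> R.
  have : ln 3 <= ln 10 :> R by rewrite ler_ln ?posrE //; lra.
  by have := @ln3_gt1 R; lra.
have tele T : (0 < T)%N ->
    ln (ln (10 * T%:R)) - ln (ln 10) <= \sum_(1 <= j < T) (j%:R * ln (10 * j%:R))^-1 :> R.
  elim: T => // -[|T] IH _; first by rewrite big_geq // mulr1 subrr.
  rewrite big_nat_recr //=.
  have {}IH := IH isT.
  have T0 : 1 <= T.+1%:R :> R by rewrite ler1n.
  have e2 : T.+2%:R = T.+1%:R + 1 :> R by rewrite natr1.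
  rewrite e2.
  move: T.+1%:R T0 IH => t T0 IH.
  have lt1 : 1 <= ln (10 * t).
    by apply: le_trans l10 _; rewrite ler_ln ?posrE //; lra.
  have step : ln (10 * (t + 1)) <= ln (10 * t) + t^-1.
    have -> : 10 * (t + 1) = 10 * t * (1 + t^-1) by field; rewrite gt_eqF //; lra.
    have ti0 : 0 < t^-1 by rewrite invr_gt0; lra.
    have -> : ln (10 * t * (1 + t^-1)) = ln (10 * t) + ln (1 + t^-1).
      by rewrite lnM ?posrE //; [lra|exact: addr_gt0].
    by rewrite lerD2l; apply: le_ln1Dx; lra.
  have ti0 : 0 < t^-1 by rewrite invr_gt0; lra.
  have l2 : ln (ln (10 * (t + 1))) <= ln (ln (10 * t)) + (t * ln (10 * t))^-1.
    apply: (@le_trans _ _ (ln (ln (10 * t) + t^-1))).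
      rewrite ler_ln ?posrE //; last by lra.
      by apply: lt_le_trans (_ : 1 <= _) => //; apply: le_trans l10 _; rewrite ler_ln ?posrE //; lra.
    have -> : ln (10 * t) + t^-1 = ln (10 * t) * (1 + (t * ln (10 * t))^-1).
      by field; rewrite !gt_eqF //; lra.
    have tl0 : 0 < (t * ln (10 * t))^-1 by rewrite invr_gt0 mulr_gt0 //; lra.
    rewrite lnM ?posrE; [|lra|lra].
    by rewrite lerD2l; apply: le_ln1Dx; lra.
  lra.
pose T := (Num.truncn (expR (expR (64 * B + ln (ln 10))))).+1.
exists (32 ^ T)%N.
have T0 : (0 < T)%N by [].
have TB : 64 * B <= \sum_(1 <= j < T) (j%:R * ln (10 * j%:R))^-1 :> R.
  apply: le_trans (tele T T0); rewrite lerBrDr.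
  have eT : expR (expR (64 * B + ln (ln 10))) < T%:R by apply: truncnS_gt.
  have e0 := expR_gt0 (expR (64 * B + ln (ln 10))).
  rewrite -[leLHS]expRK ler_ln ?posrE ?expR_gt0 //; last first.
    by apply: lt_le_trans (_ : 1 <= _) => //; apply: le_trans l10 _; rewrite ler_ln ?posrE ?mulr_gt0 ?ltr0n // ler_peMr // ler1n.
  by rewrite -[leLHS]expRK ler_ln ?posrE ?mulr_gt0 ?ltr0n //; lra.
rewrite (@big_cat_nat _ _ _ (32 ^ 1)) ?leq_exp2l //= block_sums //.
have co0 p : prime p -> 0 <= cf_weight p * count_order (p%:R + 1).
  move=> pp; rewrite mulr_ge0 ?cf_weight_ge0 //; apply/ltW/count_order_gt0.
  have p2 : 2 <= p%:R :> R by rewrite (ler_nat R 2) prime_gt1.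
  lra.
have h0 : 0 <= \sum_(0 <= p < 32 ^ 1 | prime p) cf_weight p * count_order (p%:R + 1).
  exact: sumr_ge0.
suff : B <= \sum_(1 <= j < T) \sum_(32 ^ j <= p < 32 ^ j.+1 | prime p) cf_weight p * count_order (p%:R + 1) by lra.
have : B <= \sum_(1 <= j < T) (j%:R * ln (10 * j%:R))^-1 / 64 by rewrite -mulr_suml; lra.
move=> h; apply: le_trans h _.
rewrite big_seq_cond [leRHS]big_seq_cond; apply: ler_sum => j.
rewrite mem_index_iota andbT => /andP[j0 _].
have p32 : 0 < (32 ^ j)%:R :> R by rewrite ltr0n expn_gt0.
have jR : 1 <= j%:R :> R by rewrite ler1n.
have lj : 1 <= ln (10 * j%:R) :> R.
  by apply: le_trans l10 _; rewrite ler_ln ?posrE //; lra.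
pose lo : R := (32 * (32 ^ j)%:R * ln (10 * j%:R))^-1.
have lo0 : 0 <= lo by rewrite invr_ge0 !mulr_ge0 //; lra.
have := @block_sum_lower R (fun p => cf_weight p * count_order (p%:R + 1)) lo j j0 lo0.
have -> : lo * (2^-1 * (32 ^ j)%:R / j%:R) = (j%:R * ln (10 * j%:R))^-1 / 64.
  by rewrite /lo; field; rewrite !gt_eqF //; lra.
apply=> p pp /andP[jp pj].
have p2 : 2 <= p%:R :> R by rewrite (ler_nat R 2) prime_gt1.
have p1 : p%:R + 1 <= (32 ^ j.+1)%:R :> R by rewrite natr1 ler_nat.
have pj2 : p%:R <= 32 * (32 ^ j)%:R :> R by rewrite -natrM -expnS ler_nat ltnW.
have l0 := @lnln_ge3_gt0 R (p%:R + 1).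
have {}l0 : 0 < ln (ln (p%:R + 1)) :> R by apply: l0; lra.
have lp : ln (ln (p%:R + 1)) <= ln (10 * j%:R) :> R.
  have lp1 : ln (p%:R + 1) <= 10 * j%:R :> R.
    apply: (@le_trans _ _ (ln (32 ^ j.+1)%:R)); first by rewrite ler_ln ?posrE ?ltr0n ?expn_gt0 //; lra.
    rewrite lnXn32 ln32E -natr1; have := @ln2_le1 R; have := @ln2_ge_half R; nra.
  have p3 : 3 <= p%:R + 1 :> R by lra.
  have [lp0 _] := lnln_ge3 p3.
  by rewrite ler_ln ?posrE //; lra.
rewrite /cf_weight /count_order natrM -[p.+1%:R]natr1.
have -> : (p%:R * (p%:R + 1))^-1 * ((p%:R + 1) / ln (ln (p%:R + 1))) = (p%:R * ln (ln (p%:R + 1)))^-1 :> R.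
  by field; rewrite !gt_eqF //; lra.
rewrite lef_pV2 ?posrE ?mulr_gt0 //; try lra.
by apply: ler_pM => //; lra.
Qed.

End Counting.

(** * Passage to almost every point *)

Section Assembly.
Context {R : realType}.
Set Implicit Arguments.
Unset Strict Implicit.
Implicit Types (x z e A : R) (n p k P N : nat).
Local Notation mu := (@lebesgue_measure R).
Local Notation Om := (@unit_irr R).
Local Notation cf_weight := (@cf_weight R).
Local Notation nlnln := (@nlnln R).

Lemma ae_unit_irr (P : set R) : mu.-negligible (Om `&` [set x | ~ P x]) ->
  {ae mu, forall x, x \in `]0, 1] -> P x}.
Proof.
move=> nP; have nQ : mu.-negligible (@rational R).
  by exists (@rational R); split=> //; [exact: measurable_rational|exact: lebesgue_measure_rat].
apply: negligibleS (negligibleU nP nQ) => x /= /not_implyP[].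
rewrite in_itv /= => /andP[x0 x1] nPx.
have [qx|nqx] := pselect (rational x); [by right|left; split=> //].
split=> //=; rewrite in_itv /= x0 lt_neqAle x1 andbT.
by apply/eqP => e; apply: nqx; rewrite e; exact: (rational_int 1).
Qed.

Lemma limn_esup_eq_pinfty (h : nat -> \bar R) :
  (forall k N, exists n, (N <= n)%N /\ (k%:R%:E <= h n)%E) -> limn_esup h = +oo%E.
Proof.
move=> H; rewrite limn_esup_lim.
suff -> : esups h = cst +oo%E by apply: lim_cst.
apply/funext => N; rewrite /esups /=; apply/eqyP => r r0.
have [n [Nn kn]] := H (Num.truncn r).+1 N.
apply: le_trans (_ : (h n <= _)%E); last by apply: ereal_sup_ubound; exists n.
by apply: le_trans kn; rewrite lee_fin; apply/ltW/truncnS_gt.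
Qed.

Lemma cvg_pratio0 (h : nat -> \bar R) :
  (forall k, exists N, forall n, (N <= n)%N ->
     exists r : R, [/\ h n.+1 = r%:E, 0 <= r & r <= k.+1%:R^-1]) ->
  h @ \oo --> 0%:E.
Proof.
move=> H; apply/fine_cvgP; split.
  have [N HN] := H 0; exists N.+1 => // -[//|n] /= Nn.
  by have [r [-> _ _]] := HN n Nn.
apply/cvgrPdist_le => e e0.
have [k ke] : exists k, k.+1%:R^-1 <= e.
  exists (Num.truncn e^-1); rewrite -[leRHS]invrK lef_pV2 ?posrE ?invr_gt0 ?ltr0n //.
  exact/ltW/truncnS_gt.
have [N HN] := H k; exists N.+1 => // -[//|n] /= Nn.
have [r [-> r0 rk]] := HN n Nn.
by rewrite /= sub0r normrN ger0_norm //; apply: le_trans ke.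
Qed.

(** Stated for a sequence [z] indexed by digit values, so that it serves both [g] and the shifted
    identity. At a hit the prefix sum is at most [32 * 194 * nlnln n], so [A k * nlnln n <= z] makes
    [z] at least [k + 1] times the prefix sum. *)
Lemma infinitely_often_large (z : nat -> R) : (forall p, prime p -> 3 <= z p) ->
  (forall B : R, exists P, B <= \sum_(0 <= p < P | prime p) cf_weight p * count_order (z p)) ->
  mu.-negligible (Om `&` [set x | ~ forall k N, exists n, [/\ (N <= n)%N,
    prime (cfdigit n.+1 x) & k%:R * (psum n.+1 x)%:R <= z (cfdigit n.+1 x)]]).
Proof.
move=> z3 div; pose A k : R := k.+1%:R * (32 * 194).
have K0 : 0 < 32 * 194 :> R by lra.
have A0 k : 0 < A k by rewrite /A; apply: mulr_gt0 K0; rewrite ltr0n.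
have bad k := @infinitely_often_digits R 194
  (fun n p => prime p && (A k * nlnln n <= z p)) (ltr0n _ _) (@prime_mean_le_lnln R)
  (@divergent_counts R z (A k) (A0 k) z3 div).
apply: negligibleS (negligible_bigcup bad) => x [Ox nH].
apply: contrapT => nbad; apply: nH => k N; apply: contrapT => nex.
apply: nbad; exists k => //; split=> //; exists N => n Nn [/andP[pp Az] Sn].
apply: nex; exists n; split=> //; apply: le_trans Az.
rewrite /A -mulrA; apply: ler_pM => //; first by rewrite ler_nat.
Qed.

Lemma limn_esup_pratio (g : R -> R) (x : R) :
  (forall k N, exists n, [/\ (N <= n)%N, prime (cfdigit n.+1 x) &
     k%:R * (psum n.+1 x)%:R <= g (cfdigit n.+1 x)%:R]) ->
  limn_esup (fun n => pratio g n x) = +oo%E.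
Proof.
move=> H; apply: limn_esup_eq_pinfty => k N.
have [n [Nn pp kS]] := H k N; exists n.+1; split; first exact: leqW.
rewrite /pratio /pdigit pp; case: eqP => [|/eqP S0]; first by rewrite leey.
by rewrite lee_fin ler_pdivlMr // ltr0n lt0n.
Qed.

(** With [p + 1] in place of the digit [p], a bound [2 * k * psum <= p + 1] still gives
    [k * psum <= p]. *)
Lemma identity_limsup : {ae mu, forall x : R, x \in `]0, 1] ->
  limn_esup (fun n => pratio (fun t : R => t) n x) = +oo%E}.
Proof.
apply: ae_unit_irr.
have z3 p : prime p -> 3 <= p%:R + 1 :> R.
  by move=> pp; have := prime_gt1 pp; rewrite -(ler_nat R); lra.
apply: negligibleS (infinitely_often_large z3 (@identity_divergent R)) => x [Ox nlim].
split=> // H; apply: nlim; apply: limn_esup_pratio => k N.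
have [n [Nn pp kS]] := H (2 * k)%N N; exists n; split=> //.
have := prime_gt1 pp; rewrite -(ler_nat R) => p2.
by rewrite natrM in kS; lra.
Qed.

Lemma psum_ge_nlnln : mu.-negligible (Om `&` [set x | ~ exists N, forall n, (N <= n)%N ->
  1024^-1 * nlnln n < (psum n.+1 x)%:R]).
Proof.
have [n0 Hn0] : exists n0 : nat, forall n, (n0 <= n)%N -> (25 < trunc_log 32 n)%N.
  suff H k : exists n0 : nat, forall n, (n0 <= n)%N -> (k <= trunc_log 32 n)%N by exact: (H 26).
  by exists (32 ^ k)%N => n; apply: trunc_log_max.
have c0 : 0 < 128^-1 :> R by rewrite invr_gt0.
apply: negligibleS (@psum_lower R _ n0.+1 sqrt_level c0 _ _) => //=.
- move=> x [Ox nex]; split=> // N; apply: contrapT => nN; apply: nex; exists N => n Nn.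
  rewrite ltNge; apply/negP => h; apply: nN; exists n; split=> //.
  by apply: le_trans h _; rewrite le_eqVlt; apply/orP; left; apply/eqP; lra.
- by move=> n n1; apply: sqrt_level_bound; apply: leq_trans n1.
- by move=> n n1; apply: lnln_le_prime_mean; apply: Hn0; exact: ltnW.
Qed.

(** At a prime digit [g] is eventually below [e k * nlnln n], with [e k] matched to the lower bound
    [nlnln n / 1024] of the prefix sum. At any other digit the numerator is the constant [g 0],
    which the growing prefix sum beats. *)
Lemma pratio_cvg0 (g : R -> R) B : (forall t, 0 <= t -> 3 < g t) ->
  (forall P, \sum_(0 <= p < P | prime p) cf_weight p * count_order (g p%:R) <= B) ->
  {ae mu, forall x : R, x \in `]0, 1] -> (fun n => pratio g n x) @ \oo --> 0%:E}.
Proof.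
move=> g3 conv; apply: ae_unit_irr.
pose e k : R := (1024 * k.+1%:R)^-1.
have K0 : 0 < 1024 :> R by lra.
have e0 k : 0 < e k by rewrite invr_gt0; apply: (mulr_gt0 K0); rewrite ltr0n.
have z3 p : prime p -> 3 <= g p%:R by move=> _; apply/ltW/g3.
have good k : mu.-negligible (Om `&` [set x | forall N, exists n, (N <= n)%N /\
    (prime (cfdigit n.+1 x) && (e k * nlnln n <= g (cfdigit n.+1 x)%:R))]).
  (* The bound on positions for the value [p]: as [nlnln n >= n / 2], the condition
     [e k * nlnln n <= g p] forces [n <= 2 * g p / e k]. *)
  apply: (@finitely_many_digits R (fun n p => prime p && (e k * nlnln n <= g p%:R))
    (fun p => (Num.truncn (2 * g p%:R / e k)).+1) ((3 + 2 / e k) * B)).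
    move=> p n /andP[pp h]; rewrite ltnS truncn_ge_nat; last first.
      by rewrite divr_ge0 ?(ltW (e0 k)) // mulr_ge0 //; have := z3 p pp; lra.
    rewrite ler_pdivlMr //; have := @nlnln_ge_half R n => hn.
    have : e k * (n%:R / 2) <= e k * nlnln n by rewrite ler_wpM2l // ltW.
    lra.
  exact: (@convergent_counts R (fun p => g p%:R) (e k) B (e0 k) z3 conv
    (fun p => (Num.truncn (2 * g p%:R / e k)).+1)).
apply: negligibleS (negligibleU psum_ge_nlnln (negligible_bigcup good)) => x [Ox nlim].
apply: contrapT => /not_orP[n1 n2]; apply: nlim.
have {n1}[N1 HS] : exists N, forall n, (N <= n)%N -> 1024^-1 * nlnln n < (psum n.+1 x)%:R.
  by apply: contrapT => h; apply: n1.
have {}n2 k : exists N, forall n, (N <= n)%N ->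
    ~ (prime (cfdigit n.+1 x) && (e k * nlnln n <= g (cfdigit n.+1 x)%:R)).
  apply: contrapT => h; apply: n2; exists k => //; split=> // N.
  by apply: contrapT => nN; apply: h; exists N => n Nn D; apply: nN; exists n.
apply: cvg_pratio0 => k; have [N2 HD] := n2 k.
exists (maxn N1 (maxn N2 (Num.truncn (g 0 * (2048 * k.+1%:R))).+1)) => n.
rewrite !geq_max => /and3P[n1 {}n2 n3].
have nl := @nlnln_ge_half R n; have S1 := HS n n1.
have nR : 0 < n%:R :> R by rewrite ltr0n; apply: leq_trans n3.
have S0 : 0 < (psum n.+1 x)%:R :> R by lra.
have kR : 0 < k.+1%:R :> R by rewrite ltr0n.
have S00 : psum n.+1 x != 0%N by rewrite -lt0n -(ltr0n R).
rewrite /pratio (negbTE S00); eexists; split; first by [].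
  by apply: divr_ge0; [apply: le_trans (ltW (g3 _ (ler0n _ _)))|apply: ltW].
rewrite ler_pdivrMr // mulrC ler_pdivlMr //.
rewrite /pdigit; case: ifP => pp.
  have := HD n n2; rewrite pp /= => /negP; rewrite -ltNge /e invfM => h.
  have : g (cfdigit n.+1 x)%:R * k.+1%:R <= (1024^-1 / k.+1%:R * nlnln n) * k.+1%:R.
    by rewrite ler_wpM2r // ltW.
  have -> : 1024^-1 / k.+1%:R * nlnln n * k.+1%:R = 1024^-1 * nlnln n.
    by field; rewrite gt_eqF.
  lra.
have : g 0 * (2048 * k.+1%:R) <= n%:R.
  by apply/ltW/(lt_le_trans (truncnS_gt _)); rewrite ler_nat.
lra.
Qed.

End Assembly.

Theorem theorem2p8 (R : realType) :
  {ae (@lebesgue_measure R), forall x : R, x \in `]0, 1] ->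
     limn_esup (fun n => pratio (fun t : R => t) n x) = +oo%E}
  /\
  forall g : R -> R,
    measurable_fun (`[0, +oo[ : set R) g ->
    (forall t : R, 0 <= t -> 3 < g t) ->
    (forall eta : R -> R, asymp_equiv eta ->
       asymp_comparable (fun t => g (eta t)) g) ->
    exists c0 : R, 1 < c0 /\
      forall c : R, c0 <= c ->
        (({ae (@lebesgue_measure R), forall x : R, x \in `]0, 1] ->
             limn_esup (fun n => pratio g n x) = +oo%E})
           <-> gintegral g c = +oo%E)
        /\
        ((gintegral g c < +oo)%E ->
           {ae (@lebesgue_measure R), forall x : R, x \in `]0, 1] ->
             (fun n => pratio g n x) @ \oo --> (0%R)%:E}).
Proof.
split; first exact: identity_limsup.
move=> g mg g3 greg.
have [C [J [C0 J0 oc]]] := gauge_order_comparable g3 greg.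
(* From [32^J] on, [count_order (g _)] is comparable to a constant on each block, and one choice of
   blocks serves every larger [c]. *)
exists (32 ^ J)%:R; split.
  by rewrite (ltr_nat R 1) -[1%N](exp1n J) ltn_exp2r.
move=> c cJ.
have z3 p : prime p -> 3 <= g p%:R by move=> _; apply/ltW/g3.
have co0 p : prime p -> 0 <= cf_weight p * count_order (g p%:R).
  by move=> pp; rewrite mulr_ge0 ?cf_weight_ge0 //; apply/ltW/count_order_gt0/z3.
have sum_split T : (J <= T)%N ->
    \sum_(0 <= p < 32 ^ T | prime p) cf_weight p * count_order (g p%:R) =
    \sum_(0 <= p < 32 ^ J | prime p) cf_weight p * count_order (g p%:R) +
    \sum_(32 ^ J <= p < 32 ^ T | prime p) cf_weight p * count_order (g p%:R).
  by move=> JT; rewrite -big_cat_nat // leq_exp2l.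
have infinite_case : gintegral g c = +oo%E ->
    {ae (@lebesgue_measure R), forall x : R, x \in `]0, 1] ->
       limn_esup (fun n => pratio g n x) = +oo%E}.
  move=> ioo; apply: ae_unit_irr.
  have [D D0 HD] := prime_sum_lower g3 C0 J0 oc.
  have div B : exists P, B <= \sum_(0 <= p < P | prime p) cf_weight p * count_order (g p%:R).
    have [T BT] := gintegral_infinite mg g3 C0 J0 oc (`|B| / D) cJ ioo.
    have JT : (J <= T)%N.
      rewrite leqNgt; apply/negP => TJ; move: BT; rewrite big_geq ?(ltnW TJ) //.
      by rewrite ltNge divr_ge0 // ltW.
    exists (32 ^ T)%N; rewrite sum_split //.
    have s0 : 0 <= \sum_(0 <= p < 32 ^ J | prime p) cf_weight p * count_order (g p%:R).
      exact: sumr_ge0.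
    have := HD T JT; rewrite ltr_pdivrMr // mulrC in BT.
    have := ler_norm B; lra.
  apply: negligibleS (infinitely_often_large z3 div) => x [Ox nlim].
  by split=> // H; apply: nlim; apply: limn_esup_pratio.
have finite_case : (gintegral g c < +oo)%E ->
    {ae (@lebesgue_measure R), forall x : R, x \in `]0, 1] ->
       (fun n => pratio g n x) @ \oo --> (0%R)%:E}.
  move=> ioo; have [B HB] := gintegral_finite mg g3 C0 J0 oc cJ ioo.
  apply: (@pratio_cvg0 _ _ (\sum_(0 <= p < 32 ^ J | prime p) cf_weight p * count_order (g p%:R) +
    26 * C * B) g3) => P.
  pose T := (J + P)%N; have JT : (J <= T)%N by exact: leq_addr.
  have PT : (P <= 32 ^ T)%N.
    by apply: leq_trans (ltnW (ltn_expl T (_ : 1 < 32)%N)) => //; exact: leq_addl.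
  apply: (@le_trans _ _ (\sum_(0 <= p < 32 ^ T | prime p) cf_weight p * count_order (g p%:R))).
    by rewrite [leRHS](@big_cat_nat _ _ _ P) //= lerDl sumr_ge0.
  rewrite sum_split // lerD2l; apply: le_trans (prime_sum_upper g3 C0 J0 oc JT) _.
  by rewrite ler_wpM2l // mulr_ge0 // ltW.
(* Remaining implication: were the integral finite, the ratio would almost everywhere both tend to 0
   and have infinite limsup, and an interval of length 1 would be null. *)
split=> //; split=> // Hsup; apply: contrapT => /eqP; rewrite -ltey => ioo.
have Hcvg := finite_case ioo.
have : (@lebesgue_measure R).-negligible `]0, 1].
  apply: negligibleS (negligibleU Hsup Hcvg) => x x01.
  apply: contrapT => /not_orP[/contrapT hs /contrapT hc].
  have xin : x \in `]0, 1] by exact: x01.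
  by have [_] := cvg_limn_einf_sup (hc xin); rewrite (hs xin).
have e1 : lebesgue_measure (`]0, 1]%classic : set R) = 1%E.
  by rewrite lebesgue_measure_itv /= lte_fin ltr01 sube0.
move=> /measure_negligible h; have := etrans (esym e1) (h (measurable_itv _)).
by move=> /eqP; rewrite eqe oner_eq0.
Qed.
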